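(* The sequences $(R^N)_{N\ge1}$ and $(S^N)_{N\ge1}$ are mutually contiguous. Explicitly, for any sequence of events $A_N\in\mathcal{G}_N$, $N\ge1$, one has $\lim_{N\to\infty}S^N(A_N)=0$ if and only if $\lim_{N\to\infty}R^N(A_N)=0$.
   Context: Let $P,Q$ be Borel probability measures on $\mathbb{R}^d$, and let $\mu$ be a probability measure on $\mathbb{R}^d\times\mathbb{R}^d$ with marginals $P$ and $Q$, absolutely continuous with respect to $P\otimes Q$, with density $\xi=\frac{d\mu}{d(P\otimes Q)}$. Define $\mathcal{A}:L^2(P)\to L^2(Q)$ and its adjoint $\mathcal{A}^*:L^2(Q)\to L^2(P)$ by $(\mathcal{A}f)(y)=\int f(x)\xi(x,y)\,dP(x)$ and $(\mathcal{A}^*g)(x)=\int g(y)\xi(x,y)\,dQ(y)$. Assumptions: (i) $\xi\in L^2(P\otimes Q)$; consequently $\mathcal{A}$ is compact and there are eigenvalue decompositions $\mathcal{A}^*\mathcal{A}\alpha_k=s_k^2\alpha_k$, $\mathcal{A}\mathcal{A}^*\beta_k=s_k^2\beta_k$, $k\ge 0$, with $s_0=1$, $\alpha_0=\beta_0=\mathbf{1}$, $0\le s_k\le 1$, $\mathcal{A}\alpha_k=s_k\beta_k$, $\mathcal{A}^*\beta_k=s_k\alpha_k$. (ii) $s_k\le s_1<1$ for all $k\ge 1$. Let $(X_i,Y_i)_{i=1}^N$ be the coordinate variables on $(\mathbb{R}^d\times\mathbb{R}^d)^N$, and let $\mathcal{G}_N$ be the $\sigma$-algebra generated by the pair of empirical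 measures $(\hat P^N,\hat Q^N)$, $\hat P^N=\frac1N\sum_{i=1}^N\delta_{X_i}$, $\hat Q^N=\frac1N\sum_{i=1}^N\delta_{Y_i}$. Let $R^N:=(P\otimes Q)^N|_{\mathcal{G}_N}$ and $S^N:=\mu^N|_{\mathcal{G}_N}$ be the restrictions to $\mathcal{G}_N$ of the $N$-fold product measures $(P\otimes Q)^N$ and $\mu^N$ (equivalently, the laws of $(\hat P^N,\hat Q^N)$ when $(X_i,Y_i)$ are i.i.d. from $P\otimes Q$, respectively from $\mu$). *)

(* Defs.v *)
From HB Require Import structures.
From mathcomp Require Import all_boot all_order all_algebra.
From mathcomp Require Import all_classical all_reals all_analysis.
From mathcomp Require Import giry.

Set Implicit Arguments.
Unset Strict Implicit.
Unset Printing Implicit Defensive.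

Import Order.TTheory GRing.Theory Num.Theory.
Import numFieldNormedType.Exports.

Local Open Scope classical_set_scope.
Local Open Scope ring_scope.

(* R^d with its Borel sigma-algebra, generated by the open sets. *)
Definition euclidean (R : realType) (d : nat) :=
  g_sigma_algebraType (@open 'rV[R]_d).

HB.instance Definition _ (R : realType) (d : nat) :=
  Measurable.on (euclidean R d).

Section power_measure.
Context d (T : measurableType d) (R : realType).

Definition tcons n (p : T * n.-tuple T) : n.+1.-tuple T :=
  [the n.+1.-tuple T of p.1 :: p.2].

Lemma measurable_tcons n : measurable_fun [set: T * n.-tuple T] (@tcons n).
Proof. exact: measurable_cons. Qed.

HB.instance Definition _ n :=
  isMeasurableFun.Build _ _ _ _ (@tcons n) (@measurable_tcons n).

(* The n-fold product measure P^n, as the image of P \x P^(n-1) under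
   T * T^(n-1) = T^n; see power_measure_box. *)
Fixpoint power_measure (P : probability T R) (n : nat) :
    probability (n.-tuple T) R :=
  match n with
  | 0 => \d_([tuple of [::]] : 0.-tuple T)
  | n.+1 => distribution (P \x power_measure P n)%E (@tcons n)
  end.

Lemma power_measure_box (P : probability T R) n (A : 'I_n -> set T) :
  (forall i, measurable (A i)) ->
  power_measure P n [set t | forall i, A i (tnth t i)] =
  (\prod_(i < n) P (A i))%E.
Proof.
elim: n A => [|n IH] A mA /=.
  rewrite big_ord0 diracE mem_set//=; by case.
rewrite /distribution /pushforward /= big_ord_recl -IH; last by move=> i.
rewrite -product_measure1E//; last first.
  rewrite (_ : mkset _ = \bigcap_(i in [set: 'I_n])
      ((fun t => tnth t i) @^-1` A (lift ord0 i))).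
    apply: fin_bigcap_measurable => // i _.
    rewrite -[X in measurable X]setTI.
    exact: measurable_tnth.
  by apply/seteqP; split => t /= h i => [_|]; exact: h.
congr (_ _); apply/seteqP; split => -[x t] /= => [h|[hx ht] i].
  split; first exact: (h ord0).
  by move=> i; have := h (lift ord0 i); rewrite tnthS.
have [j ->|->//] := unliftP ord0 i.
by rewrite tnthS; exact: ht.
Qed.

End power_measure.

Section empirical_measure.
Context d (T : measurableType d) (R : realType).

Definition empirical N (x : N.-tuple T) : set T -> \bar R :=
  mscale (N%:R^-1)%:nng (msum (fun k => \d_(nth point x k)) N).

Lemma empiricalE N (x : N.-tuple T) (A : set T) :
  empirical x A = ((N%:R^-1)%:E * \sum_(i < N) \d_(tnth x i) A)%E.
Proof.
rewrite /empirical /mscale /msum/=; congr (_ * _)%E.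
by apply: eq_bigr => i _; rewrite (tnth_nth point).
Qed.

HB.instance Definition _ N (x : N.-tuple T) := Measure.on (empirical x).

Lemma empirical_setT_le1 N (x : N.-tuple T) :
  (empirical x [set: T] <= 1)%E.
Proof.
rewrite empiricalE (eq_bigr (fun=> 1%:E)); last first.
  by move=> i _; rewrite diracT.
rewrite sumEFin big_const_ord iter_addr_0 -EFinM lee_fin.
have [->|N0] := eqVneq N 0%N; first by rewrite mulr0.
by rewrite mulVf// pnatr_eq0.
Qed.

HB.instance Definition _ N (x : N.-tuple T) :=
  Measure_isSubProbability.Build _ _ _ (empirical x) (empirical_setT_le1 x).

(* [giry T R] carries the sigma-algebra generated by the evaluations
   m |-> m A; it consists of subprobabilities, so that the case N = 0 (where
   [empirical] is the zero measure) needs no special treatment. *)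
Definition empirical_pair N (z : N.-tuple (T * T)) : giry T R * giry T R :=
  (empirical (map_tuple fst z) : giry T R,
   empirical (map_tuple snd z) : giry T R).

Definition empirical_sigma_algebra N : set (set (N.-tuple (T * T))) :=
  g_sigma_algebra_preimage (@empirical_pair N).

End empirical_measure.
Arguments empirical_sigma_algebra {d} T R N.

Section transition_operators.
Context d1 d2 (T1 : measurableType d1) (T2 : measurableType d2) (R : realType).
Variables (P : probability T1 R) (Q : probability T2 R) (xi : T1 * T2 -> R).

Definition opA (f : T1 -> R) : T2 -> R :=
  fun y => \int[P]_x (f x * xi (x, y)).

Definition opA_adj (g : T2 -> R) : T1 -> R :=
  fun x => \int[Q]_y (g y * xi (x, y)).

End transition_operators.

(* An orthonormal basis of L^2(P), indexed by nat.  When L^2(P) is finite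
   dimensional the family is completed by zeros; zeros may occur at any place,
   since the two bases of a singular value decomposition share one indexing
   although L^2(P) and L^2(Q) may have different dimensions. *)
Record orthonormal_basis d (T : measurableType d) (R : realType)
    (P : probability T R) (e : nat -> T -> R) : Prop := {
  onb_L2 : forall k, e k \in Lfun P 2%:E ;
  onb_orthogonal : forall j k, j != k -> \int[P]_x (e j x * e k x) = 0 ;
  onb_normalized : forall k,
    \int[P]_x (e k x * e k x) = 1 \/ e k = cst 0 %[ae P] ;
  onb_expansion : forall f, f \in Lfun P 2%:E ->
    ('N[P]_2%:E[(fun x => (f x - \sum_(k < n)
       (\int[P]_t (f t * e k t)) * e k x)%:E)])%E @[n --> \oo] --> 0%E
}.

(* When xi is in L^2(P \x Q), opA is compact, and such s, alpha, beta exist by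
   the spectral theorem, provided xi is the density of a coupling of P and Q;
   the s k with k >= 1 need not be sorted. *)
Record singular_decomposition d1 d2 (T1 : measurableType d1)
    (T2 : measurableType d2) (R : realType) (P : probability T1 R)
    (Q : probability T2 R) (xi : T1 * T2 -> R)
    (s : nat -> R) (alpha : nat -> T1 -> R) (beta : nat -> T2 -> R) : Prop := {
  sd_alpha : orthonormal_basis P alpha ;
  sd_beta : orthonormal_basis Q beta ;
  sd_AadjA : forall k,
    opA_adj Q xi (opA P xi (alpha k)) = (fun x => s k ^+ 2 * alpha k x)
      %[ae P] ;
  sd_AAadj : forall k,
    opA P xi (opA_adj Q xi (beta k)) = (fun y => s k ^+ 2 * beta k y)
      %[ae Q] ;
  sd_A : forall k, opA P xi (alpha k) = (fun y => s k * beta k y) %[ae Q] ;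
  sd_Aadj : forall k,
    opA_adj Q xi (beta k) = (fun x => s k * alpha k x) %[ae P] ;
  sd_s0 : s 0%N = 1 ;
  sd_alpha0 : alpha 0%N = cst 1 %[ae P] ;
  sd_beta0 : beta 0%N = cst 1 %[ae Q] ;
  sd_s_bounds : forall k, 0 <= s k <= 1
}.

(* Main.v *)
(* Let m = P \x Q.  The density L(z) = prod_i xi(z_i) of mu^N with respect to m^N
   enters only through its inner products with functions that are invariant
   under permutations of the second coordinates.  Expanding
   xi = sum_k s_k alpha_k beta_k, such inner products do not see the difference
   between L and its average over these permutations, which is
     sum_n (prod_k s_k ^ n_k) / c_n * E_n(X) * E'_n(Y),
   where n ranges over the multi-indices on k >= 1, E_n(X) is the sum over the
   c_n words of type n of the products of the alpha_k(X_i), and E'_n is the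
   same with beta.  The summands are orthogonal with square norm
   prod_k s_k ^ (2 n_k), so the average has square norm at most
   prod_k (1 - s_k ^ 2)^-1 for all N, which by Cauchy-Schwarz yields one
   implication, and it is approximated in L^2, uniformly in N, by finite
   partial sums (finitely many k, all n_k <= M).

   For the other implication these partial sums must be bounded away from 0
   with probability close to 1.  With U_k = N^(-1/2) sum_i alpha_k(X_i), and V_k
   likewise, N^(-|n|/2) E_n - prod_k H_(n_k)(U_k) / n_k! tends to 0 in
   probability, H_n being the Hermite polynomials, so Mehler's formula makes the
   partial sum close to
     prod_k (1 - s_k^2)^(-1/2)
            exp((2 s_k U_k V_k - s_k^2 (U_k^2 + V_k^2)) / (2 (1 - s_k^2))).
   The sums over k of the two terms in the exponents have moments controlled by
   sum_k s_k^2, so the product is bounded below in probability, uniformly in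
   the number of factors. *)

From HB Require Import structures.
Require Import Defs.
From mathcomp Require Import all_boot all_order all_algebra.
From mathcomp Require Import all_classical all_reals all_analysis.
From mathcomp Require Import measurable_realfun giry fingroup perm ring lra.

Set Implicit Arguments.
Unset Strict Implicit.
Unset Printing Implicit Defensive.

Import Order.TTheory GRing.Theory Num.Theory.
Import numFieldNormedType.Exports.

Local Open Scope classical_set_scope.
Local Open Scope ring_scope.

(** * Square integrable functions and product measures *)

(** Invariance comes from the events: permuting the Y_i among themselves changes neither empirical
    measure, hence no event of [G_N]. Averaging over these permutations is what makes Cauchy-Schwarz
    useful, since L itself has square norm [ip m xi xi ^+ N], which grows exponentially in N unless
    xi = 1.

    The order of the choices shapes the second implication. Where the partial sum is at least eps,
    the independent probability is at most 1/eps times the coupled one, up to the approximation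
    error divided by eps. So that error has to be small compared with eps, and eps must be fixed
    before the number of letters; the lower bound may therefore depend on the s_k only through s_1
    and a bound on sum_k s_k^2.

    The expansion of xi is used only through finite-rank kernels with K letters: for fixed N, K
    tends to infinity, while the bounds on the averaged sums are uniform in K and N. The Hermite
    limits come from a three-term recurrence that holds up to an error tending to 0 in L^1, combined
    with tightness of U_k and V_k. *)

Section square_integrable.
Context d (T : measurableType d) (R : realType) (m : probability T R).
Implicit Types f g h : T -> R.

(** Membership in L^2(m) for honest functions with real-valued integrals, so that the algebra of
    [ip] involves neither classes nor extended reals. [Lfun_sqint] and [sqint_Lfun] identify it with
    [Lfun] at exponent 2. *)
Definition sqint f :=
  measurable_fun setT f /\ m.-integrable setT (EFin \o (fun x => f x ^+ 2)).

Definition ip f g := \int[m]_x (f x * g x).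

Lemma integrable_measurable f : m.-integrable setT (EFin \o f) ->
  measurable_fun setT f.
Proof. by move=> /integrableP[/measurable_EFinP]. Qed.

Lemma sqint_measurable f : sqint f -> measurable_fun setT f.
Proof. by case. Qed.

Lemma integrable_le f g : measurable_fun setT f ->
  m.-integrable setT (EFin \o g) -> (forall x, `|f x| <= `|g x|) ->
  m.-integrable setT (EFin \o f).
Proof.
move=> mf ig fg; apply: (le_integrable measurableT _ _ ig).
  exact/measurable_EFinP.
by move=> x _ /=; rewrite lee_fin.
Qed.

Lemma sqint_mul_integrable f g : sqint f -> sqint g ->
  m.-integrable setT (EFin \o (fun x => f x * g x)).
Proof.
move=> [mf f2] [mg g2].
apply: (@integrable_le _ (fun x => f x ^+ 2 + g x ^+ 2)).
- exact: measurable_funM.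
- have := integrableD measurableT f2 g2; apply: eq_integrable => // x _.
- move=> x; rewrite normrM [leRHS]ger0_norm ?addr_ge0 ?sqr_ge0//.
  rewrite -(real_normK (num_real (f x))) -(real_normK (num_real (g x))).
  have := normr_ge0 (f x); have := normr_ge0 (g x); nra.
Qed.

Lemma sqint_le f g : measurable_fun setT f -> sqint g ->
  (forall x, `|f x| <= `|g x|) -> sqint f.
Proof.
move=> mf [_ ig] fg; split => //.
apply: integrable_le ig _; first exact: measurable_funX.
by move=> x; rewrite !normrX lerXn2r// nnegrE.
Qed.

Lemma sqint_cst c : sqint (fun=> c).
Proof.
by split => //; exact: finite_measure_integrable_cst.
Qed.

Lemma sqint_bounded f c : measurable_fun setT f -> (forall x, `|f x| <= c) ->
  sqint f.
Proof.
move=> mf fc; apply: sqint_le mf (sqint_cst c) _ => x.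
exact: le_trans (fc x) (ler_norm _).
Qed.

Lemma sqint_integrable f : sqint f -> m.-integrable setT (EFin \o f).
Proof.
move=> fL; have := sqint_mul_integrable fL (sqint_cst 1).
by apply: eq_integrable => // x _ /=; rewrite mulr1.
Qed.

Lemma sqintD f g : sqint f -> sqint g -> sqint (fun x => f x + g x).
Proof.
move=> fL gL; split.
  by apply: measurable_funD; [exact: (fL.1)|exact: (gL.1)].
have mf := fL.1; have mg := gL.1.
apply: (@integrable_le _ (fun x => (f x ^+ 2 + g x ^+ 2) + (f x ^+ 2 + g x ^+ 2))).
- by apply: measurable_funX; exact: measurable_funD.
- have h := integrableD measurableT fL.2 gL.2.
  by have := integrableD measurableT h h; apply: eq_integrable => // x _.
- move=> x; rewrite !ger0_norm ?addr_ge0 ?sqr_ge0//.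
  have := sqr_ge0 (f x - g x); nra.
Qed.

Lemma sqintZ c f : sqint f -> sqint (fun x => c * f x).
Proof.
move=> [mf fL]; split; first exact: measurable_funM.
have := integrableZl measurableT (c ^+ 2) fL.
by apply: eq_integrable => // x _ /=; rewrite exprMn EFinM.
Qed.

Lemma sqintN f : sqint f -> sqint (fun x => - f x).
Proof.
by move=> /(sqintZ (-1)); congr sqint; apply/funext => x; rewrite mulN1r.
Qed.

Lemma sqintB f g : sqint f -> sqint g -> sqint (fun x => f x - g x).
Proof. by move=> fL gL; apply: sqintD => //; exact: sqintN. Qed.

Lemma sqint_sum (I : Type) (r : seq I) (P : pred I) (F : I -> T -> R) :
  (forall i, P i -> sqint (F i)) -> sqint (fun x => \sum_(i <- r | P i) F i x).
Proof.
move=> FL; elim: r => [|i r IH].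
  by under eq_fun do rewrite big_nil; exact: sqint_cst.
under eq_fun do rewrite big_cons.
by have [Pi|//] := boolP (P i); apply: sqintD => //; exact: FL.
Qed.

Lemma sqint_abs f : sqint f -> sqint (fun x => `|f x|).
Proof.
move=> fL; apply: sqint_le (fL) _; last by move=> x; rewrite normr_id.
by apply: measurableT_comp => //; exact: fL.1.
Qed.

Lemma ipC f g : ip f g = ip g f.
Proof. by rewrite /ip; apply: eq_Rintegral => x _; rewrite mulrC. Qed.

Lemma ipDl f g h : sqint f -> sqint g -> sqint h ->
  ip (fun x => f x + g x) h = ip f h + ip g h.
Proof.
move=> fL gL hL; rewrite /ip -RintegralD//; try exact: sqint_mul_integrable.
by apply: eq_Rintegral => x _; rewrite mulrDl.
Qed.

Lemma ipZl c f h : sqint f -> sqint h -> ip (fun x => c * f x) h = c * ip f h.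
Proof.
move=> fL hL; rewrite /ip -RintegralZl//; last exact: sqint_mul_integrable.
by apply: eq_Rintegral => x _; rewrite mulrA.
Qed.

Lemma ipDr f g h : sqint f -> sqint g -> sqint h ->
  ip h (fun x => f x + g x) = ip h f + ip h g.
Proof. by move=> *; rewrite ipC ipDl// ipC (ipC g). Qed.

Lemma ipZr c f h : sqint f -> sqint h -> ip h (fun x => c * f x) = c * ip h f.
Proof. by move=> *; rewrite ipC ipZl// ipC. Qed.

Lemma ipBl f g h : sqint f -> sqint g -> sqint h ->
  ip (fun x => f x - g x) h = ip f h - ip g h.
Proof.
move=> fL gL hL.
rewrite (_ : (fun x => _) = (fun x => f x + (-1) * g x)); last first.
  by apply/funext => x; rewrite mulN1r.
by rewrite ipDl//; [rewrite ipZl// mulN1r|exact: sqintZ].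
Qed.

Lemma ipBr f g h : sqint f -> sqint g -> sqint h ->
  ip h (fun x => f x - g x) = ip h f - ip h g.
Proof. by move=> *; rewrite ipC ipBl// ipC (ipC g). Qed.

Lemma ip_suml (I : Type) (r : seq I) (P : pred I) (F : I -> T -> R) h :
  (forall i, P i -> sqint (F i)) -> sqint h ->
  ip (fun x => \sum_(i <- r | P i) F i x) h = \sum_(i <- r | P i) ip (F i) h.
Proof.
move=> FL hL; elim: r => [|i r IH].
  rewrite big_nil (_ : (fun x => _) = (fun x => 0 * h x)).
    by rewrite ipZl// mul0r.
  by apply/funext => x; rewrite big_nil mul0r.
rewrite big_cons; have [Pi|nPi] := boolP (P i).
  rewrite -IH -ipDl//; [|exact: FL|exact: sqint_sum].
  by congr (ip _ h); apply/funext => x; rewrite big_cons Pi.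
by rewrite -IH; congr (ip _ h); apply/funext => x; rewrite big_cons (negPf nPi).
Qed.

Lemma ip_sumr (I : Type) (r : seq I) (P : pred I) (F : I -> T -> R) h :
  (forall i, P i -> sqint (F i)) -> sqint h ->
  ip h (fun x => \sum_(i <- r | P i) F i x) = \sum_(i <- r | P i) ip h (F i).
Proof.
move=> FL hL; rewrite ipC ip_suml//.
by apply: eq_bigr => i Pi; rewrite ipC.
Qed.

Lemma ip_ge0 f : 0 <= ip f f.
Proof. by apply: Rintegral_ge0 => x _; rewrite -expr2 sqr_ge0. Qed.

Lemma ip_le f g h k : sqint f -> sqint g -> sqint h -> sqint k ->
  (forall x, f x * g x <= h x * k x) -> ip f g <= ip h k.
Proof.
move=> fL gL hL kL H; apply: le_Rintegral => //; exact: sqint_mul_integrable.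
Qed.

Lemma Rintegral_probability_cst c : \int[m]_x c = c.
Proof. by rewrite Rintegral_cst//= probability_setT mulr1. Qed.

Lemma ip11 : ip (fun=> 1) (fun=> 1) = 1.
Proof. by rewrite /ip Rintegral_probability_cst mulr1. Qed.

Lemma cauchy_schwarz f g : sqint f -> sqint g ->
  ip f g ^+ 2 <= ip f f * ip g g.
Proof.
move=> fL gL.
(* The square norm of f + t g as a polynomial in t; its sign at a suitable t gives the claim. *)
have H t : 0 <= ip f f + (2 * t) * ip f g + t ^+ 2 * ip g g.
  have := ip_ge0 (fun x => f x + t * g x).
  have tL := sqintZ t gL; have ftL := sqintD fL tL.
  by rewrite ipDl// !ipDr// ?ipZl// !ipZr// (ipC g f); lra.
have [g0|g0] := eqVneq (ip g g) 0.
  have [->|fg0] := eqVneq (ip f g) 0; first by rewrite expr0n/= mulr_ge0 ?ip_ge0.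
  (* Without quadratic term the polynomial is affine with nonzero slope, and at this t it equals
     -1. *)
  have := H (- (ip f f + 1) / (2 * ip f g)).
  rewrite g0 mulr0 addr0 (_ : _ + _ = -1).
    by rewrite lerNr oppr0 ler10.
  by field.
have gp : 0 < ip g g by rewrite lt_def g0 ip_ge0.
have := H (- ip f g / ip g g).
rewrite -(pmulr_rge0 _ gp) (_ : _ * _ = ip f f * ip g g - ip f g ^+ 2).
  by rewrite subr_ge0.
by field.
Qed.

Lemma cauchy_schwarz_norm f g : sqint f -> sqint g ->
  `|ip f g| <= Num.sqrt (ip f f) * Num.sqrt (ip g g).
Proof.
move=> fL gL; rewrite -sqrtrM ?ip_ge0// -sqrtr_sqr ler_sqrt.
  exact: cauchy_schwarz.
by rewrite mulr_ge0 ?ip_ge0.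
Qed.

End square_integrable.

Section power_integral.
Context d (T : measurableType d) (R : realType) (m : probability T R).

(** The pure tensor of the [phi i] on N-tuples, whose integrals and inner products factor over the
    sites. For a constant family it is the N-fold product density. *)
Definition pf N (phi : 'I_N -> T -> R) (z : N.-tuple T) : R :=
  \prod_(i < N) phi i (tnth z i).

Lemma pf_tcons N (phi : 'I_N.+1 -> T -> R) x w :
  pf phi (tcons (x, w)) = phi ord0 x * pf (fun i => phi (lift ord0 i)) w.
Proof.
rewrite /pf big_ord_recl; congr (_ * _).
by apply: eq_bigr => i _; rewrite tnthS.
Qed.

Lemma measurable_pf N (phi : 'I_N -> T -> R) :
  (forall i, measurable_fun setT (phi i)) -> measurable_fun setT (pf phi).
Proof.
move=> mphi; rewrite /pf; apply: measurable_prod => i _.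
apply: measurableT_comp; first exact: mphi.
exact: measurable_tnth.
Qed.

Lemma ge0_integral_tcons N (F : N.+1.-tuple T -> \bar R) :
  measurable_fun setT F -> (forall z, 0 <= F z)%E ->
  (\int[power_measure m N.+1]_z F z =
   \int[m]_x \int[power_measure m N]_w F (tcons (x, w)))%E.
Proof.
move=> mF F0.
rewrite /= ge0_integral_distribution//.
have mFt : measurable_fun setT (F \o @tcons _ T N).
  by apply: measurableT_comp => //; exact: measurable_tcons.
by rewrite fubini_tonelli1 => [|//|p]; [exact: eq_integral|exact: F0].
Qed.

Lemma pf_integrable N (phi : 'I_N -> T -> R) :
  (forall i, m.-integrable setT (EFin \o phi i)) ->
  (power_measure m N).-integrable setT (EFin \o pf phi).
Proof.
elim: N phi => [|N IH] phi iphi.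
  apply: (@eq_integrable _ _ _ _ _ measurableT (cst 1%E)).
    by move=> z _ /=; rewrite /pf big_ord0.
  exact: finite_measure_integrable_cst.
have mphi i : measurable_fun setT (phi i).
  exact: integrable_measurable (iphi i).
apply/integrableP; split; first by apply/measurable_EFinP; exact: measurable_pf.
rewrite ge0_integral_tcons//; last first.
  by apply: measurableT_comp => //; apply/measurable_EFinP; exact: measurable_pf.
have iphi' := IH _ (fun i => iphi (lift ord0 i)).
under eq_integral => x _.
  under eq_integral => w _ do rewrite /= pf_tcons normrM EFinM.
  rewrite ge0_integralZl//; last first.
    by apply/measurable_EFinP; apply: measurableT_comp => //; exact: measurable_pf.
  over.
rewrite /= ge0_integralZr//.
- apply: lte_mul_pinfty.
  + exact: integral_ge0.
  + rewrite ge0_fin_numE ?integral_ge0//.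
    by have /integrableP[] := iphi ord0.
  + by have /integrableP[] := iphi'.
- by apply/measurable_EFinP; exact: measurableT_comp.
- exact: integral_ge0.
Qed.

Lemma pf_Rintegral N (phi : 'I_N -> T -> R) :
  (forall i, m.-integrable setT (EFin \o phi i)) ->
  \int[power_measure m N]_z pf phi z = \prod_(i < N) \int[m]_x phi i x.
Proof.
elim: N phi => [|N IH] phi iphi.
  rewrite big_ord0 (_ : pf phi = fun=> 1); last first.
    by apply/funext => z; rewrite /pf big_ord0.
  exact: (Rintegral_probability_cst (power_measure m 0)).

have iphi' := IH _ (fun i => iphi (lift ord0 i)).
have iphiN := pf_integrable iphi.
have mphi := measurable_int _ iphiN.
have iphit : (m \x power_measure m N)%E.-integrable setT
    (fun p => (phi ord0 p.1 * pf (fun i => phi (lift ord0 i)) p.2)%:E).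
  move/integrableP: iphiN => [_]; rewrite ge0_integral_distribution//; last first.
    exact: measurableT_comp.
  move=> fin; apply/integrableP; split; last first.
    by move: fin; under eq_integral => p _ do rewrite /= pf_tcons.
  apply/measurable_EFinP; apply: measurable_funM.
    by apply: measurableT_comp => //; exact: integrable_measurable (iphi _).
  apply: measurableT_comp => //; apply: measurable_pf => i.
  exact: integrable_measurable (iphi _).
have ipf' := pf_integrable (fun i => iphi (lift ord0 i)).
rewrite big_ord_recl -iphi' /Rintegral /= integral_distribution//; last first.
  by apply: eq_integrable iphit => // -[x w] _ /=; rewrite pf_tcons.
rewrite (eq_integral (fun p =>
    (phi ord0 p.1 * pf (fun i => phi (lift ord0 i)) p.2)%:E)); last first.
  by move=> [x w] _ /=; rewrite pf_tcons.
rewrite -integral12_prod_meas1//=.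
set I := (\int[power_measure m N]_w (pf _ w)%:E)%E.
have If : I \is a fin_num by exact: integrable_fin_num.
rewrite (eq_integral (fun x => (phi ord0 x)%:E * I)%E); last first.
  move=> x _; rewrite /fubini_F/=; under eq_integral => w _ do rewrite EFinM.
  by rewrite integralZl.
rewrite -[in LHS](fineK If) integralZr//; last exact: iphi.
by rewrite fineM//; exact: (integrable_fin_num measurableT (iphi ord0)).
Qed.

Lemma sqint_pf N (phi : 'I_N -> T -> R) : (forall i, sqint m (phi i)) ->
  sqint (power_measure m N) (pf phi).
Proof.
move=> phiL; split; first by apply: measurable_pf => i; exact: (phiL i).1.
have := pf_integrable (fun i => (phiL i).2).
by apply: eq_integrable => // z _ /=; rewrite /pf prodrXl.
Qed.

Lemma ip_pf N (phi psi : 'I_N -> T -> R) :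
  (forall i, sqint m (phi i)) -> (forall i, sqint m (psi i)) ->
  ip (power_measure m N) (pf phi) (pf psi) = \prod_(i < N) ip m (phi i) (psi i).
Proof.
move=> phiL psiL; rewrite -pf_Rintegral => [|i]; last exact: sqint_mul_integrable.
by apply: eq_Rintegral => z _; rewrite /pf big_split.
Qed.

End power_integral.

Section tuple_measure_unique.
Context d (T : measurableType d) (R : realType) (N : nat).
Variable G : set (set T).
Hypothesis mG : d.-measurable = <<s G >>.
Hypothesis setIG : setI_closed G.
Hypothesis GT : G setT.

Definition box (A : 'I_N -> set T) : set (N.-tuple T) :=
  [set t | forall i, A i (tnth t i)].

(** Boxes with sides in the pi-system [G] form a pi-system. Since [G] contains [setT], they include
    the cylinders over [G], which generate the product sigma-algebra. *)
Lemma tuple_measure_unique (m1 m2 : probability (N.-tuple T) R) :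
  (forall A, (forall i, G (A i)) -> m1 (box A) = m2 (box A)) ->
  forall X, measurable X -> m1 X = m2 X.
Proof.
move=> m12 X mX.
pose H := [set box A | A in [set A : 'I_N -> set T | forall i, G (A i)]].
have mbox A : (forall i, G (A i)) -> measurable (box A).
  move=> GA; rewrite (_ : box A = \bigcap_(i in [set: 'I_N])
      ((fun t => tnth t i) @^-1` A i)).
    apply: fin_bigcap_measurable => // i _; rewrite -[X in measurable X]setTI.
    by apply: measurable_tnth => //; rewrite mG; exact: sub_sigma_algebra.
  by apply/seteqP; split => t /= h i => [_|]; exact: h.
have HT : H setT.
  by exists (fun=> setT) => //; apply/seteqP; split.
apply: (measure_unique H (fun=> setT)) => //.
- rewrite eqEsubset; split; last first.
    apply: smallest_sub; first exact: sigma_algebra_measurable.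
    by move=> _ [A GA <-]; exact: mbox.
  apply: smallest_sub; first exact: smallest_sigma_algebra.
  rewrite -bigcup_seq => B [i _ /= [C mC <-]]; rewrite setTI.
  have : <<s G >> C by rewrite -mG.
  apply: (@smallest_sub _ (sigma_algebra setT) G
    [set C | <<s H >> ((@tnth N T)^~ i @^-1` C)]).
    split => /=.
    + by rewrite preimage_set0; exact: sigma_algebra0.
    + move=> D HD; rewrite setTD preimage_setC -setTD.
      exact: sigma_algebraCD.
    + move=> F HF; rewrite preimage_bigcup; exact: sigma_algebra_bigcup.
  move=> D GD /=; apply: sub_sigma_algebra.
  exists (fun j => if j == i then D else setT) => [j /=|]; first by case: ifP.
  apply/seteqP; split => t /= => [/(_ i)|Dt j]; first by rewrite eqxx.
  by case: eqP => [->|].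
- move=> _ _ [A GA <-] [B GB <-]; exists (fun i => A i `&` B i).
    by move=> i; exact: setIG.
  apply/seteqP; split => t /= => [h|[h1 h2] i] //; split => // i; by have [] := h i.
- by apply/seteqP; split => // t _; exists 0%N.
- by move=> _ [A GA <-]; exact: m12.
- by move=> n; apply: le_lt_trans (probability_le1 _ _) (ltry _).
Qed.

End tuple_measure_unique.

(** * Invariance under permutations of the second coordinates *)

Section permute_second.
Context d (T : measurableType d) (R : realType) (P Q : probability T R).
Variable N : nat.

Definition permY (p : {perm 'I_N}) (z : N.-tuple (T * T)) : N.-tuple (T * T) :=
  [tuple ((tnth z i).1, (tnth z (p i)).2) | i < N].

Lemma measurable_permY p : measurable_fun setT (permY p).
Proof.
apply/measurable_fun_tnthP => i.
rewrite (_ : _ \o _ = (fun z => ((tnth z i).1, (tnth z (p i)).2))).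
  apply: measurable_fun_pair => /=.
    by apply: measurableT_comp => //; exact: measurable_tnth.
  by apply: measurableT_comp => //; exact: measurable_tnth.
by apply/funext => z /=; rewrite tnth_mktuple.
Qed.

HB.instance Definition _ p :=
  isMeasurableFun.Build _ _ _ _ (permY p) (measurable_permY p).

(** This is the independence of the two coordinates under [P \x Q]. A box whose sides are rectangles
    has as preimage the box with the second sides permuted, and both masses are the same product of
    P- and Q-masses. Boxes with other sides need not pull back to boxes, hence the pi-system of
    rectangles. *)
Lemma power_measure_permY p A : measurable A ->
  distribution (power_measure (P \x Q)%E N) (permY p) A =
  power_measure (P \x Q)%E N A.
Proof.
move=> mA.
pose G := [set B `*` C | B in [set B : set T | measurable B] & C in [set C : set T | measurable C]].
apply: (@tuple_measure_unique _ _ _ _ G) => //.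
- exact: measurable_prod_measurableType.
- move=> _ _ [B1 mB1 [C1 mC1 <-]] [B2 mB2 [C2 mC2 <-]].
  exists (B1 `&` B2); first exact: measurableI.
  exists (C1 `&` C2); first exact: measurableI.
  by rewrite setXI.
- exists setT; first exact: measurableT.
  by exists setT; [exact: measurableT|rewrite setXTT].
move=> D GD.
have /choice[BC HBC] : forall i, exists BC, [/\ measurable BC.1, measurable BC.2 & D i = BC.1 `*` BC.2].
  by move=> i; case: (GD i) => B mB [C mC <-]; exists (B, C).
transitivity (power_measure (P \x Q)%E N (permY p @^-1` box D)); first by [].
have -> : permY p @^-1` box D =
    box (fun i => (BC i).1 `*` (BC ((p^-1)%g i)).2).
  apply/seteqP; split => z /= h i.
    split.
      by have := h i; rewrite tnth_mktuple; have [_ _ ->] := HBC i; case.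
    have := h ((p^-1)%g i); rewrite tnth_mktuple permKV.
    by have [_ _ ->] := HBC ((p^-1)%g i); case.
  rewrite tnth_mktuple; have [_ _ ->] := HBC i; split => /=.
    by have [] := h i.
  by have [_] := h (p i); rewrite permK.
have -> : box D = box (fun i => (BC i).1 `*` (BC i).2).
  by congr box; apply/funext => i; have [] := HBC i.
have mBC1 i : measurable (BC i).1 by have [] := HBC i.
have mBC2 i : measurable (BC i).2 by have [] := HBC i.
rewrite !power_measure_box; try by move=> i; exact: measurableX.
transitivity (\prod_(i < N) (P (BC i).1 * Q (BC ((p^-1)%g i)).2))%E.
  by apply: eq_bigr => i _; exact: product_measure1E.
transitivity (\prod_(i < N) (P (BC i).1 * Q (BC i).2))%E; last first.
  by apply: eq_bigr => i _; rewrite -product_measure1E.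
rewrite !big_split /=; congr (_ * _)%E.
rewrite [RHS](reindex_inj (@perm_inj _ (p^-1)%g)) /=.
by apply: eq_bigr.
Qed.

Lemma Rintegral_permY p (H : N.-tuple (T * T) -> R) :
  (power_measure (P \x Q)%E N).-integrable setT (EFin \o H) ->
  (power_measure (P \x Q)%E N).-integrable setT (EFin \o (H \o permY p)) ->
  \int[power_measure (P \x Q)%E N]_z H (permY p z) =
  \int[power_measure (P \x Q)%E N]_z H z.
Proof.
move=> iH iHp; rewrite /Rintegral; congr fine.
rewrite -[LHS](@integral_distribution _ _ _ _ _ _ (permY p) (EFin \o H))//.
  by apply: eq_measure_integral => A mA _; exact: power_measure_permY.
exact: measurable_int iH.
Qed.

End permute_second.

(** * Densities of product measures *)

Section power_density.
Context d (T : measurableType d) (R : realType) (m mu : probability T R).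
Variable xi : T -> R.
Hypothesis mxi : measurable_fun setT xi.
Hypothesis xi0 : forall x, 0 <= xi x.
Hypothesis xi_mu : forall psi : T -> \bar R, measurable_fun setT psi ->
  (forall x, 0 <= psi x)%E ->
  (\int[mu]_x psi x = \int[m]_x (psi x * (xi x)%:E))%E.

(** Tonelli peels off the first coordinate and the induction hypothesis treats the others. [xi_mu]
    is then applied to the inner integral, which may be infinite; hence its extended-valued form. *)
Lemma ge0_integral_power_density N (F : N.-tuple T -> \bar R) :
  measurable_fun setT F -> (forall z, 0 <= F z)%E ->
  (\int[power_measure mu N]_z F z =
   \int[power_measure m N]_z (F z * (pf (fun=> xi) z)%:E))%E.
Proof.
elim: N F => [|N IH] F mF F0.
  apply: eq_integral => z _.
  by rewrite /pf big_ord0 mule1.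
have mpf n : measurable_fun setT (@pf _ T R n (fun=> xi)).
  by apply: measurable_pf.
have pf0 n z : 0 <= @pf _ T R n (fun=> xi) z by apply: prodr_ge0.
have mpfE n : measurable_fun setT (fun z => (@pf _ T R n (fun=> xi) z)%:E).
  by apply/measurable_EFinP; exact: mpf.
have mFt : measurable_fun setT (F \o @tcons _ T N).
  by apply: measurableT_comp => //; exact: measurable_tcons.
have mFx x : measurable_fun setT (fun w => F (tcons (x, w))).
  exact: (measurableT_comp mFt (pair1_measurable x)).
rewrite ge0_integral_tcons// ge0_integral_tcons//; last 2 first.
- by apply: emeasurable_funM; [exact: mF|exact: mpfE].
- by move=> z; rewrite mule_ge0// lee_fin.
under eq_integral => x _ do rewrite IH//.
rewrite xi_mu; last 2 first.
- have mG : measurable_fun setT (fun p : T * N.-tuple T =>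
      F (tcons p) * (pf (fun=> xi) p.2)%:E)%E.
    apply: emeasurable_funM => //.
    exact: (measurableT_comp (mpfE N)).
  apply: (@measurable_fun_fubini_tonelli_F _ _ _ _ _ (power_measure m N) _ mG).
  by move=> p; rewrite mule_ge0// lee_fin.
- by move=> x; apply: integral_ge0 => w _; rewrite mule_ge0// lee_fin.
apply: eq_integral => x _.
rewrite -ge0_integralZr//; last 3 first.
- by apply: emeasurable_funM; [exact: mFx|exact: mpfE].
- by move=> w _; rewrite mule_ge0// lee_fin.
- by rewrite lee_fin.
by apply: eq_integral => w _; rewrite pf_tcons EFinM -muleA (muleC (pf _ w)%:E).
Qed.

Lemma power_measure_density N (A : set (N.-tuple T)) : measurable A ->
  (power_measure mu N A =
   \int[power_measure m N]_z (\1_A z * pf (fun=> xi) z)%:E)%E.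
Proof.
move=> mA; transitivity (\int[power_measure mu N]_z (\1_A z)%:E)%E.
  by rewrite integral_indic// setIT.
by rewrite ge0_integral_power_density//; apply/measurable_EFinP.
Qed.

End power_density.

Section tensor.
Context d (T : measurableType d) (R : realType) (P Q : probability T R).

Lemma integrable_tensor (f g : T -> R) :
  P.-integrable setT (EFin \o f) -> Q.-integrable setT (EFin \o g) ->
  (P \x Q)%E.-integrable setT (EFin \o (fun z => f z.1 * g z.2)).
Proof.
move=> fi gi; have mf := integrable_measurable fi.
have mg := integrable_measurable gi.
apply/integrable12ltyP.
  by apply/measurable_EFinP; apply: measurable_funM; exact: measurableT_comp.
under eq_integral => x _.
  under eq_integral => y _ do rewrite /= normrM EFinM.
  rewrite ge0_integralZl//; last first.
    by apply/measurable_EFinP; exact: measurableT_comp.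
  over.
rewrite /= ge0_integralZr//.
- apply: lte_mul_pinfty.
  + exact: integral_ge0.
  + rewrite ge0_fin_numE ?integral_ge0//.
    by have /integrableP[] := fi.
  + by have /integrableP[] := gi.
- by apply/measurable_EFinP; exact: measurableT_comp.
- exact: integral_ge0.
Qed.

Lemma Rintegral_tensor (f g : T -> R) :
  P.-integrable setT (EFin \o f) -> Q.-integrable setT (EFin \o g) ->
  \int[(P \x Q)%E]_z (f z.1 * g z.2) = (\int[P]_x f x) * (\int[Q]_y g y).
Proof.
move=> fi gi; have fgi := integrable_tensor fi gi.
have Ig := integrable_fin_num measurableT gi.
have If := integrable_fin_num measurableT fi.
rewrite /Rintegral -integral12_prod_meas1// -fineM//; congr fine.
transitivity (\int[P]_x ((f x)%:E * \int[Q]_y (g y)%:E))%E.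
  by apply: eq_integral => x _; rewrite /fubini_F -integralZl.
by rewrite -[in LHS](fineK Ig) integralZr// fineK.
Qed.

Lemma sqint_tensor (f g : T -> R) : sqint P f -> sqint Q g ->
  sqint (P \x Q)%E (fun z => f z.1 * g z.2).
Proof.
move=> [mf fL] [mg gL]; split.
  by apply: measurable_funM; exact: measurableT_comp.
have := integrable_tensor fL gL.
by apply: eq_integrable => // z _ /=; rewrite exprMn.
Qed.

Lemma ip_tensor (f g f' g' : T -> R) :
  sqint P f -> sqint Q g -> sqint P f' -> sqint Q g' ->
  ip (P \x Q)%E (fun z => f z.1 * g z.2) (fun z => f' z.1 * g' z.2) =
  ip P f f' * ip Q g g'.
Proof.
move=> fL gL f'L g'L.
rewrite -Rintegral_tensor; [|exact: sqint_mul_integrable..].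
by apply: eq_Rintegral => z _; rewrite mulrACA.
Qed.

End tensor.

(** * Expansion over words *)

Section chaos.
Context d (T : measurableType d) (R : realType) (P Q : probability T R).
Notation m := (P \x Q : probability (T * T)%type R)%E.
Variables (I : finType) (a b : I -> T -> R) (s : I -> R).
Hypothesis aL : forall i, sqint P (a i).
Hypothesis bL : forall i, sqint Q (b i).
Hypothesis aa : forall i j, ip P (a i) (a j) = (i == j)%:R.
Hypothesis bb : forall i j, ip Q (b i) (b j) = (i == j)%:R.
Hypothesis a1 : forall i, ip P (a i) (fun=> 1) = 0.
Hypothesis b1 : forall i, ip Q (b i) (fun=> 1) = 0.

(* The letter [None] stands for the pair alpha_0 = beta_0 = 1. *)
Definition letter (e : I -> T -> R) (o : option I) : T -> R :=
  if o is Some i then e i else fun=> 1.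

Definition weight (o : option I) : R := if o is Some i then s i else 1.

Lemma sqint_lettera o : sqint P (letter a o).
Proof. by case: o => [i|] /=; [exact: aL|exact: sqint_cst]. Qed.

Lemma sqint_letterb o : sqint Q (letter b o).
Proof. by case: o => [i|] /=; [exact: bL|exact: sqint_cst]. Qed.

Lemma ip_lettera o o' : ip P (letter a o) (letter a o') = (o == o')%:R.
Proof.
case: o o' => [i|] [j|] /=; [exact: aa|exact: a1|by rewrite ipC a1|].
by rewrite ip11.
Qed.

Lemma ip_letterb o o' : ip Q (letter b o) (letter b o') = (o == o')%:R.
Proof.
case: o o' => [i|] [j|] /=; [exact: bb|exact: b1|by rewrite ipC b1|].
by rewrite ip11.
Qed.

Definition ten (o o' : option I) (z : T * T) : R :=
  letter a o z.1 * letter b o' z.2.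

Lemma sqint_ten o o' : sqint m (ten o o').
Proof. by apply: sqint_tensor; [exact: sqint_lettera|exact: sqint_letterb]. Qed.

Lemma ip_ten o o' p p' :
  ip m (ten o o') (ten p p') = ((o == p) && (o' == p'))%:R.
Proof.
rewrite ip_tensor; [|exact: sqint_lettera|exact: sqint_letterb
  |exact: sqint_lettera|exact: sqint_letterb].
by rewrite ip_lettera ip_letterb -natrM mulnb.
Qed.

Variable N : nat.
Notation word := {ffun 'I_N -> option I}.
Notation mN := (power_measure m N).

Definition mono (f g : word) : N.-tuple (T * T) -> R :=
  pf (fun i => ten (f i) (g i)).

Lemma sqint_mono f g : sqint mN (mono f g).
Proof. by apply: sqint_pf => i; exact: sqint_ten. Qed.

Lemma ip_mono f g f' g' :
  ip mN (mono f g) (mono f' g') = ((f == f') && (g == g'))%:R.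
Proof.
rewrite ip_pf; [|by move=> i; exact: sqint_ten..].
under eq_bigr do rewrite ip_ten.
have [/andP[/eqP -> /eqP ->]|H] := boolP ((f == f') && (g == g')).
  by rewrite big1// => i _; rewrite !eqxx.
have [i Hi] : exists i, ~~ ((f i == f' i) && (g i == g' i)).
  apply/existsP; rewrite -negb_forall; apply: contra H => /forallP H.
  apply/andP; split; apply/eqP/ffunP => i; have /andP[/eqP ? /eqP ?] // := H i.
by rewrite (bigD1 i)//= (negPf Hi) mul0r.
Qed.

Definition comb (c : word -> word -> R) (z : N.-tuple (T * T)) : R :=
  \sum_f \sum_g c f g * mono f g z.

Lemma sqint_comb c : sqint mN (comb c).
Proof.
apply: sqint_sum => f _; apply: sqint_sum => g _.
by apply: sqintZ; exact: sqint_mono.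
Qed.

Lemma ip_combl c phi : sqint mN phi ->
  ip mN (comb c) phi = \sum_f \sum_g c f g * ip mN (mono f g) phi.
Proof.
move=> phiL; rewrite ip_suml//; last first.
  by move=> f _; apply: sqint_sum => g _; apply: sqintZ; exact: sqint_mono.
apply: eq_bigr => f _; rewrite ip_suml//; last first.
  by move=> g _; apply: sqintZ; exact: sqint_mono.
by apply: eq_bigr => g _; rewrite ipZl//; exact: sqint_mono.
Qed.

Lemma ip_comb c c' : ip mN (comb c) (comb c') = \sum_f \sum_g c f g * c' f g.
Proof.
rewrite ip_combl; last exact: sqint_comb.
apply: eq_bigr => f _; apply: eq_bigr => g _; congr (_ * _).
rewrite ipC ip_combl; last exact: sqint_mono.
rewrite (bigD1 f)//= (bigD1 g)//= ip_mono !eqxx mulr1.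
rewrite big1 ?addr0 => [|g' /negPf g'g]; last first.
  by rewrite ip_mono g'g andbF mulr0.
rewrite big1 ?addr0// => f' /negPf f'f.
by rewrite big1// => g' _; rewrite ip_mono f'f mulr0.
Qed.

End chaos.

(** * Words, their types and the coefficients of the average *)

Section word_types.
Context (I : finType) (N : nat).
Notation word := {ffun 'I_N -> option I}.
Implicit Types f g : word.

Definition occ f (o : option I) : nat := #|[pred i | f i == o]|.

(** Counting the proper letters suffices: the length N then fixes the number of [None] ([occ_sum]),
    so words related by [same] are rearrangements of each other. *)
Definition same f g := [forall k, occ f (Some k) == occ g (Some k)].

Lemma same_occP f g : reflect (forall k, occ f (Some k) = occ g (Some k)) (same f g).
Proof. by apply: (iffP forallP) => H k; apply/eqP; exact: H. Qed.

Lemma occ_sum f : (occ f None + \sum_k occ f (Some k) = N)%N.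
Proof.
rewrite -[RHS]card_ord -sum1_card (partition_big f predT)//=.
rewrite (bigD1 None)//=; congr (_ + _)%N.
  by rewrite sum1_card; apply: eq_card => i; rewrite inE; case: (f i).
rewrite (reindex_omap Some id) => [|[i|]]//=.
apply: eq_big => [k|k _]; first by rewrite eqxx.
by rewrite sum1_card; apply: eq_card => i; rewrite inE; case: (f i).
Qed.

Lemma count_occ f o : count_mem o [tuple f i | i < N] = occ f o.
Proof.
rewrite /occ /= count_map -sum1_count big_enum_cond/= -sum1_card.
by apply: eq_bigl => i; rewrite inE.
Qed.

Lemma same_perm f g : same f g ->
  exists p : {perm 'I_N}, g = [ffun i => f (p i)].
Proof.
move=> /same_occP fg.
have H : perm_eq [tuple g i | i < N] [tuple f i | i < N].
  apply/allP => o _ /=; rewrite !count_occ; case: o => [k|]; first by rewrite fg.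
  rewrite -(eqn_add2r (\sum_k occ g (Some k))) occ_sum.
  by under eq_bigr do rewrite -fg; rewrite occ_sum.
have /tuple_permP[p Hp] := H.
exists p; apply/ffunP => i; rewrite ffunE.
have := congr1 (fun t => nth None t i) Hp.
by rewrite -!tnth_nth !tnth_mktuple.
Qed.

Lemma same_refl f : same f f.
Proof. exact/same_occP. Qed.

Lemma same_sym f g : same f g = same g f.
Proof. by apply: eq_forallb => k; rewrite eq_sym. Qed.

Lemma same_trans : transitive same.
Proof. by move=> g f h /same_occP fg /same_occP gh; apply/same_occP => k; rewrite fg. Qed.

Definition same_words f := [pred g | same f g].

Lemma orb_gt0 f : (0 < #|same_words f|)%N.
Proof. by apply/card_gt0P; exists f; rewrite inE; exact: same_refl. Qed.

Lemma card_orb_same f g : same f g -> #|same_words f| = #|same_words g|.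
Proof.
move=> fg; apply: eq_card => h; rewrite !inE; apply/idP/idP.
  by apply: same_trans; rewrite same_sym.
exact: same_trans.
Qed.

(** Concatenate constant blocks, one per letter, and pad with [None]; the hypothesis leaves room for
    the padding. *)
Lemma occ_exists (n : I -> nat) : (\sum_k n k <= N)%N ->
  exists f, forall k, occ f (Some k) = n k.
Proof.
move=> nN.
pose l := flatten [seq nseq (n k) (Some k) | k <- enum I] ++
          nseq (N - \sum_k n k) None.
have sl : size l == N.
  rewrite /l size_cat size_flatten size_nseq /shape -map_comp sumnE big_map.
  under eq_bigr do rewrite /= size_nseq.
  by rewrite big_enum/= subnKC.
exists [ffun i => tnth (Tuple sl) i] => k.
rewrite -count_occ (_ : [tuple _ | i < N] = Tuple sl); last first.
  by apply: eq_from_tnth => i; rewrite tnth_mktuple ffunE.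
rewrite /= count_cat count_flatten -map_comp count_nseq /= mul0n addn0.
rewrite sumnE big_map big_enum/= (bigD1 k)//= count_nseq /= eqxx mul1n.
rewrite big1 ?addn0// => j jk; rewrite count_nseq /=.
by rewrite (inj_eq (@Some_inj _)) (negPf jk).
Qed.

End word_types.

Section chaos_coefficients.
Context (R : realType) (I : finType) (s : I -> R) (N : nat).
Notation word := {ffun 'I_N -> option I}.
Implicit Types f g : word.

Definition word_weight f : R := \prod_i weight s (f i).

Lemma word_weightE f : word_weight f = \prod_k s k ^+ occ f (Some k).
Proof.
rewrite /word_weight (partition_big f predT)//= (bigD1 None)//=.
rewrite big1 ?mul1r => [|i /eqP ->//].
rewrite (reindex_omap Some id) => [|[i|]]//=.
apply: eq_big => [k|k _]; first by rewrite eqxx.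
rewrite (eq_bigr (fun=> s k)) => [|i /eqP ->//].
by rewrite prodr_const; congr (_ ^+ _); apply: eq_card => i; rewrite !inE.
Qed.

Definition bounded M f := [forall k, occ f (Some k) <= M]%N.

(* Averaging over the permutations of the second coordinates spreads the weight
   of the diagonal pair (f, f) over all pairs (f, g) with g of the type of f. *)
Definition coef M f g : R :=
  if bounded M f && same f g then word_weight f / #|same_words f|%:R else 0.

(** The square norm of the partial sum ([ip_chaos]), expressed by its coefficients alone. *)
Definition normL M : R := \sum_f \sum_g coef M f g ^+ 2.

(** Hence the bound [M = N] on the exponents discards no word, and the partial sum becomes the full
    average. *)
Lemma bounded_size f : bounded N f.
Proof. by apply/forallP => k; rewrite -[leqRHS]card_ord max_card. Qed.

Lemma word_weight_same f g : same f g -> word_weight f = word_weight g.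
Proof.
by move=> /same_occP fg; rewrite !word_weightE; apply: eq_bigr => k _; rewrite fg.
Qed.

Lemma normL_bounded M :
  normL M = \sum_(f | bounded M f) word_weight f ^+ 2 / #|same_words f|%:R.
Proof.
rewrite [RHS]big_mkcond; apply: eq_bigr => f _; rewrite /coef.
case: (bounded M f); last by rewrite big1// => g _; rewrite expr0n.
rewrite (bigID (same f))/= [X in _ + X]big1 ?addr0 => [|g /negPf ->]; last first.
  by rewrite expr0n.
rewrite (eq_bigr (fun=> (word_weight f / #|same_words f|%:R) ^+ 2)) => [|g ->//].
rewrite sumr_const [X in _ *+ X](_ : _ = #|same_words f|); last first.
  by apply: eq_card => h; rewrite !inE.
have f0 : #|same_words f|%:R != 0 :> R by rewrite pnatr_eq0 -lt0n orb_gt0.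
by rewrite -mulr_natr; field.
Qed.

(** The shape in which the same number arises as the inner product of the density with the partial
    sum ([ip_pf_chaos]). *)
Lemma normL_diag M : normL M = \sum_f coef M f f * word_weight f.
Proof.
rewrite normL_bounded big_mkcond; apply: eq_bigr => f _; rewrite /coef same_refl.
by case: ifP => _ /=; rewrite ?mul0r// expr2 mulrAC.
Qed.

(** The c_n^2 pairs of words of type n each contribute the square of the weight divided by c_n, so
    the counts cancel. Only types realized by a word of length N occur. *)
Lemma normLE M : normL M =
  \sum_(n : {ffun I -> 'I_M.+1} | [exists f : word, forall k, occ f (Some k) == n k])
    \prod_k (s k ^+ 2) ^+ n k.
Proof.
(* [inord] returns the true count on words bounded by M, the only ones summed over. *)
pose tyM f : {ffun I -> 'I_M.+1} := [ffun k => inord (occ f (Some k))].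
have tyME f n : (bounded M f && (tyM f == n)) =
    [forall k, occ f (Some k) == n k].
  apply/andP/forallP => [[/forallP bf /eqP <-] k|H].
    by rewrite ffunE inordK// ltnS.
  split; first by apply/forallP => k; rewrite (eqP (H k)) -ltnS.
  by apply/eqP/ffunP => k; rewrite ffunE (eqP (H k)) inord_val.
rewrite normL_bounded.
rewrite (partition_big tyM predT)//= [RHS]big_mkcond/=.
apply: eq_bigr => n _; under eq_bigl do rewrite tyME.
case: ifPn => [/existsP[f Hf]|]; last first.
  by rewrite negb_exists => /forallP H; rewrite big_pred0// => f; exact/negbTE.
have Hs g : [forall k, occ g (Some k) == n k] = same f g.
  apply/forallP/forallP => H k; first by rewrite (eqP (H k)) (forallP Hf k).
  by rewrite -(eqP (H k)) (forallP Hf k).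
under eq_bigl do rewrite Hs.
rewrite (eq_bigr (fun=> word_weight f ^+ 2 / #|same_words f|%:R)) => [|g fg]; last first.
  by rewrite (word_weight_same fg) (card_orb_same fg).
rewrite sumr_const [X in _ *+ X](_ : _ = #|same_words f|); last first.
    by apply: eq_card => h; rewrite !inE.
have f0 : #|same_words f|%:R != 0 :> R by rewrite pnatr_eq0 -lt0n orb_gt0.
rewrite -[LHS]mulr_natr divfK// word_weightE -prodrXl.
by apply: eq_bigr => k _; rewrite (eqP (forallP Hf k)) exprAC.
Qed.

Lemma normL_le M : normL M <= \prod_k \sum_(j < M.+1) (s k ^+ 2) ^+ j.
Proof.
rewrite normLE bigA_distr_bigA/=.
rewrite [leRHS](bigID (fun n : {ffun I -> 'I_M.+1} =>
  [exists f : word, forall k, occ f (Some k) == n k]))/= lerDl.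
by apply: sumr_ge0 => n _; apply: prodr_ge0 => k _; rewrite exprn_ge0// sqr_ge0.
Qed.

(** For such N every multi-index with entries at most M is the type of some word, so the sum over
    multi-indices factors completely and N disappears. *)
Lemma normL_eq M : (#|I| * M <= N)%N ->
  normL M = \prod_k \sum_(j < M.+1) (s k ^+ 2) ^+ j.
Proof.
move=> IMN; rewrite normLE bigA_distr_bigA/=; apply: eq_bigl => n.
have [|f Hf] := @occ_exists I N (fun k => n k).
  apply: leq_trans IMN; rewrite -sum_nat_const; apply: leq_sum => k _.
  by rewrite -ltnS.
by apply/existsP; exists f; apply/forallP => k; apply/eqP.
Qed.

End chaos_coefficients.

(** * Symmetrization of the product density *)

Section symmetrization.
Context d (T : measurableType d) (R : realType) (P Q : probability T R).
Notation m := (P \x Q : probability (T * T)%type R)%E.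
Variable N : nat.
Notation mN := (power_measure m N).

Definition symY (V : Type) (phi : N.-tuple (T * T) -> V) :=
  forall p z, phi (permY p z) = phi z.

Section one_family.
Variables (I : finType) (a b : I -> T -> R) (s : I -> R).
Hypothesis aL : forall i, sqint P (a i).
Hypothesis bL : forall i, sqint Q (b i).
Hypothesis aa : forall i j, ip P (a i) (a j) = (i == j)%:R.
Hypothesis bb : forall i j, ip Q (b i) (b j) = (i == j)%:R.
Hypothesis a1 : forall i, ip P (a i) (fun=> 1) = 0.
Hypothesis b1 : forall i, ip Q (b i) (fun=> 1) = 0.
Notation word := {ffun 'I_N -> option I}.
Implicit Types f g : word.

Definition chaos M : N.-tuple (T * T) -> R := comb a b (coef s M).

Definition kernel_of (z : T * T) : R :=
  \sum_(o : option I) weight s o * ten a b o o z.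

Lemma sqint_chaos M : sqint mN (chaos M).
Proof. exact: sqint_comb. Qed.

Lemma sqint_kernel_of : sqint m kernel_of.
Proof. by apply: sqint_sum => o _; apply: sqintZ; exact: sqint_ten. Qed.

Lemma ip_chaos M : ip mN (chaos M) (chaos M) = normL s N M.
Proof.
by rewrite ip_comb//; apply: eq_bigr => f _; apply: eq_bigr => g _; rewrite -expr2.
Qed.

Lemma mono_permY f g (p : {perm 'I_N}) z :
  mono a b f [ffun i => g (p i)] (permY p z) = mono a b f g z.
Proof.
rewrite /mono /pf /ten !big_split/=; congr (_ * _).
  by apply: eq_bigr => i _; rewrite tnth_mktuple.
rewrite [RHS](reindex_inj (@perm_inj _ p))/=.
by apply: eq_bigr => i _; rewrite tnth_mktuple ffunE.
Qed.

(** A permutation of the second coordinates carries one monomial to the other and changes neither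
    [phi] nor the measure. *)
Lemma ip_mono_same phi f g g' : sqint mN phi -> symY phi -> same g g' ->
  ip mN (mono a b f g) phi = ip mN (mono a b f g') phi.
Proof.
move=> phiL phiS /same_perm[p ->].
rewrite -[RHS](Rintegral_permY (p := p)); last 2 first.
- by apply: sqint_mul_integrable => //; exact: sqint_mono.
- have := sqint_mul_integrable (sqint_mono aL bL f g) phiL.
  by apply: eq_integrable => // z _ /=; rewrite mono_permY phiS.
by apply: eq_Rintegral => z _; rewrite mono_permY phiS.
Qed.

(** Permuting the second coordinates permutes the letters of g, and the coefficient depends on g
    only through its type. *)
Lemma chaos_symY M : symY (chaos M).
Proof.
move=> p z; apply: eq_bigr => f _.
pose h (g : word) : word := [ffun i => g (p i)].
have hK : cancel (fun g : word => [ffun i => g ((p^-1)%g i)] : word) h.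
  by move=> g; apply/ffunP => i; rewrite !ffunE permK.
have hinj : injective h.
  move=> g g' /ffunP gg'; apply/ffunP => i.
  by have := gg' ((p^-1)%g i); rewrite !ffunE permKV.
rewrite (reindex_inj hinj)/=; apply: eq_bigr => g _.
rewrite mono_permY; congr (_ * _); rewrite /coef.
suff -> : same f (h g) = same f g by [].
have gh : same g (h g).
  apply/forallP => k; apply/eqP.
  rewrite /occ -!sum1_card (reindex_inj (@perm_inj _ p))/=.
  by apply: eq_bigl => i; rewrite !inE ffunE.
by apply/idP/idP => /same_trans; apply => //; rewrite same_sym.
Qed.

Lemma pf_kernel_of z :
  pf (fun=> kernel_of) z = \sum_(f : word) word_weight s f * mono a b f f z.
Proof.
rewrite /pf /kernel_of bigA_distr_bigA/=; apply: eq_bigr => f _.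
by rewrite /word_weight /mono /pf -big_split.
Qed.

(** The product density expands over diagonal pairs (f, f). Against an invariant [phi] each of them
    may be replaced by the mean over the pairs (f, g) with g of the type of f. *)
Lemma ip_pf_kernel_of phi : sqint mN phi -> symY phi ->
  ip mN (pf (fun=> kernel_of)) phi = ip mN (chaos N) phi.
Proof.
move=> phiL phiS.
rewrite (_ : pf _ = fun z => \sum_(f : word) word_weight s f * mono a b f f z); last first.
  by apply/funext => z; exact: pf_kernel_of.
rewrite ip_suml//; last by move=> f _; apply: sqintZ; exact: sqint_mono.
rewrite ip_combl//; apply: eq_bigr => f _.
rewrite ipZl//; last exact: sqint_mono.
rewrite (bigID (same f))/= [X in _ = _ + X]big1 ?addr0; last first.
  by move=> g /negPf fg; rewrite /coef fg andbF mul0r.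
rewrite (eq_bigr (fun=> word_weight s f / #|same_words f|%:R * ip mN (mono a b f f) phi)).
  rewrite sumr_const [X in _ *+ X](_ : _ = #|same_words f|); last first.
    by apply: eq_card => h; rewrite !inE.
  have f0 : #|same_words f|%:R != 0 :> R by rewrite pnatr_eq0 -lt0n orb_gt0.
  by rewrite -[RHS]mulr_natr mulrAC divfK.
move=> g fg; rewrite /coef fg bounded_size/=.
by rewrite (ip_mono_same f phiL phiS fg).
Qed.

(** Only diagonal monomials pair with the product density, and only the coefficients of [xi] on the
    letters enter, so a kernel with more letters may take the place of [xi]. With [ip_chaos] this
    makes the partial sum behave as an orthogonal projection: its inner product with the density is
    its own square norm. *)
Lemma ip_pf_chaos (xi : T * T -> R) M : sqint m xi ->
  (forall o o', ip m xi (ten a b o o') = (o == o')%:R * weight s o) ->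
  ip mN (pf (fun=> xi)) (chaos M) = normL s N M.
Proof.
move=> xiL xiE.
have pL : sqint mN (pf (fun=> xi)) by exact: sqint_pf.
have E f g : ip mN (pf (fun=> xi)) (mono a b f g) = (f == g)%:R * word_weight s f.
  rewrite ip_pf//; last by move=> i; exact: sqint_ten.
  under eq_bigr do rewrite xiE.
  have [->|/eqP fg] := eqVneq f g.
    by rewrite mul1r; apply: eq_bigr => i _; rewrite eqxx mul1r.
  have [i Hi] : exists i, f i != g i.
    apply/existsP; rewrite -negb_forall; apply/negP => /forallP H.
    by apply: fg; apply/ffunP => i; apply/eqP.
  by rewrite mul0r (bigD1 i)//= (negPf Hi) !mul0r.
rewrite ipC ip_combl// normL_diag; apply: eq_bigr => f _.
rewrite (bigD1 f)//= ipC E eqxx mul1r big1 ?addr0// => g gf.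
by rewrite ipC E eq_sym (negPf gf) mul0r mulr0.
Qed.

End one_family.

Record orthonormal_letters (I : finType) (a b : I -> T -> R) : Prop := {
  letters_aL : forall i, sqint P (a i) ;
  letters_bL : forall i, sqint Q (b i) ;
  letters_aa : forall i j, ip P (a i) (a j) = (i == j)%:R ;
  letters_bb : forall i j, ip Q (b i) (b j) = (i == j)%:R ;
  letters_a1 : forall i, ip P (a i) (fun=> 1) = 0 ;
  letters_b1 : forall i, ip Q (b i) (fun=> 1) = 0 }.

(* [xi] is replaced by [kernel_of a' b' s'], for which the expansion is exact on
   invariant functions; the first square root pays for this replacement, the
   second one for the discarded multi-indices. *)
Lemma chaos_approximation (I J : finType) (a b : I -> T -> R) (s : I -> R)
    (a' b' : J -> T -> R) (s' : J -> R) (xi : T * T -> R) M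
    (phi : N.-tuple (T * T) -> R) :
  orthonormal_letters a b -> orthonormal_letters a' b' -> sqint m xi ->
  (forall o o', ip m xi (ten a b o o') = (o == o')%:R * weight s o) ->
  (forall o o', ip m (kernel_of a' b' s') (ten a b o o') =
                (o == o')%:R * weight s o) ->
  sqint mN phi -> symY phi ->
  `|ip mN (pf (fun=> xi)) phi - ip mN (chaos a b s M) phi| <=
  (Num.sqrt (ip m xi xi ^+ N - 2 * ip m xi (kernel_of a' b' s') ^+ N +
             ip m (kernel_of a' b' s') (kernel_of a' b' s') ^+ N) +
   Num.sqrt (normL s' N N - normL s N M)) * Num.sqrt (ip mN phi phi).
Proof.
move=> [aL bL aa bb a1 b1] [a'L b'L a'a' b'b' a'1 b'1] xiL xiE kE phiL phiS.
set k := kernel_of a' b' s' in kE *.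
have kL : sqint m k by exact: sqint_kernel_of.
have pxL : sqint mN (pf (fun=> xi)) by exact: sqint_pf.
have pkL : sqint mN (pf (fun=> k)) by exact: sqint_pf.
have lL : sqint mN (chaos a b s M) by exact: sqint_chaos.
have l'L : sqint mN (chaos a' b' s' N) by exact: sqint_chaos.
(* On the invariant [phi] the power of [k] and its full average [chaos a' b' s' N] act alike, which
   splits the error in two. *)
have -> : ip mN (pf (fun=> xi)) phi - ip mN (chaos a b s M) phi =
    ip mN (fun z => pf (fun=> xi) z - pf (fun=> k) z) phi +
    ip mN (fun z => chaos a' b' s' N z - chaos a b s M z) phi.
  by rewrite !ipBl// -(ip_pf_kernel_of s' a'L b'L)//; ring.
rewrite mulrDl (le_trans (ler_normD _ _))// lerD//.
  apply: (le_trans (cauchy_schwarz_norm _ _)) => //; first exact: sqintB.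
  rewrite ler_wpM2r ?sqrtr_ge0// le_eqVlt; apply/orP; left; apply/eqP.
  congr Num.sqrt; rewrite ipBl ?ipBr//; last exact: sqintB.
  rewrite !ip_pf// !prodr_const card_ord (ipC m k xi).
  ring.
apply: (le_trans (cauchy_schwarz_norm _ _)) => //; first exact: sqintB.
rewrite ler_wpM2r ?sqrtr_ge0// le_eqVlt; apply/orP; left; apply/eqP.
congr Num.sqrt; rewrite ipBl ?ipBr//; last exact: sqintB.
rewrite (ip_chaos s' a'L b'L)// (ip_chaos s aL bL)//.
rewrite (ipC _ (chaos a b s M)).
(* The partial sum is itself invariant, so its inner product with the full average is the one with
   the power of [k], namely [normL s N M]. Hence the squared distance is the difference of the
   squared norms. *)
rewrite -(ip_pf_kernel_of s' a'L b'L)//; last exact: chaos_symY.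
rewrite (ip_pf_chaos aL bL)//.
ring.
Qed.

End symmetrization.

(** * Words of a given type *)

Section multi_index.
Context (I : finType).

Definition incr (n : I -> nat) (k : I) : I -> nat := fun j => (n j + (j == k))%N.
Definition decr (n : I -> nat) (k : I) : I -> nat := fun j => (n j - (j == k))%N.
Definition deg (n : I -> nat) : nat := (\sum_k n k)%N.

Lemma decrK n k : (0 < n k)%N -> incr (decr n k) k = n.
Proof.
move=> nk; apply/funext => j; rewrite /decr /incr.
by case: eqVneq => [->|_]; rewrite ?subnK// subn0 addn0.
Qed.

Lemma deg_incr n k : deg (incr n k) = (deg n).+1.
Proof.
rewrite /deg /incr big_split/= (_ : (\sum_j (j == k) = 1)%N) ?addn1//.
by rewrite (bigD1 k)//= eqxx big1// => j /negPf ->.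
Qed.

Lemma deg_decr n k : (0 < n k)%N -> (deg (decr n k)).+1 = deg n.
Proof. by move=> nk; rewrite -(deg_incr _ k) decrK. Qed.

End multi_index.

Section word_sums.
Context (I : finType) (N : nat) (V : comNzRingType).
Notation word := {ffun 'I_N -> option I}.
Implicit Types (f : word) (n : I -> nat) (phi : word -> V).

Definition hastype n f := [forall k, occ f (Some k) == n k].

Lemma hastypeP n f : reflect (forall k, occ f (Some k) = n k) (hastype n f).
Proof. by apply: (iffP forallP) => H k; apply/eqP; exact: H. Qed.

Definition upd f (i : 'I_N) (o : option I) : word :=
  [ffun j => if j == i then o else f j].

Lemma upd_same f i o : upd f i o i = o.
Proof. by rewrite ffunE eqxx. Qed.

Lemma upd_id f i o : upd (upd f i o) i (f i) = f.
Proof. by apply/ffunP => j; rewrite !ffunE; case: (eqVneq j i) => [->|]. Qed.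

Lemma occ_upd f i k l : f i = None ->
  occ (upd f i (Some k)) (Some l) = (occ f (Some l) + (l == k))%N.
Proof.
move=> fi; rewrite /occ -!sum1_card (bigID (pred1 i))/= addnC.
congr (_ + _)%N.
  apply: eq_bigl => j; rewrite !inE ffunE; case: (eqVneq j i) => [->|_]; last by rewrite andbT.
  by rewrite fi andbF.
have [->|lk] := eqVneq l k.
  rewrite (bigD1 i)/= ?big1 ?addn0//; last by rewrite !inE ffunE !eqxx.
  by move=> j /andP[/andP[_ ->]].
rewrite big1// => j /andP[]; rewrite !inE ffunE => + /eqP ji.
by rewrite ji eqxx (inj_eq (@Some_inj _)) eq_sym (negPf lk).
Qed.

Lemma sum_hastype_upd n k i phi :
  \sum_(f | hastype n f && (f i == None)) phi (upd f i (Some k)) =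
  \sum_(f | hastype (incr n k) f && (f i == Some k)) phi f.
Proof.
rewrite [RHS](reindex_onto (fun f => upd f i (Some k)) (fun f => upd f i None)).
  apply: eq_bigl => f; rewrite upd_same eqxx andbT.
  have -> : (upd (upd f i (Some k)) i None == f) = (f i == None).
    apply/eqP/eqP => [<-|fi]; first by rewrite upd_same.
    by rewrite -fi upd_id.
  have [fi|fi] := eqVneq (f i) None; last by rewrite !andbF.
  rewrite !andbT; apply/hastypeP/hastypeP => H l.
    by rewrite occ_upd// H.
  by apply/eqP; rewrite -(eqn_add2r (l == k)) -(occ_upd k l fi) H.
by move=> f /andP[_ /eqP fi]; rewrite -fi upd_id.
Qed.

(** Filling a free site with k turns words of type n into words of type n + e_k, and each of the
    latter arises once from each of its n_k + 1 sites with letter k. The ring is R for functions and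
    [int] for counting words. *)
Lemma sum_hastype_incr n k phi :
  \sum_i \sum_(f | hastype n f && (f i == None)) phi (upd f i (Some k)) =
  (n k).+1%:R * \sum_(f | hastype (incr n k) f) phi f.
Proof.
under eq_bigr do rewrite sum_hastype_upd big_mkcondr.
rewrite exchange_big mulr_sumr/=; apply: eq_bigr => f /hastypeP Hf.
rewrite -big_mkcond sumr_const mulr_natl; congr (_ *+ _).
have := Hf k; rewrite /incr eqxx addn1 => <-.
by apply: eq_card => i; rewrite !inE.
Qed.

Lemma hastype_split n i phi :
  \sum_(f | hastype n f) phi f = \sum_(f | hastype n f && (f i == None)) phi f +
  \sum_(k | (0 < n k)%N)
    \sum_(f | hastype (decr n k) f && (f i == None)) phi (upd f i (Some k)).
Proof.
rewrite (partition_big (fun f => f i) predT)//= (bigD1 None)//=; congr (_ + _).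
rewrite (reindex_omap Some id) => [|[k|]]//=.
rewrite (bigID (fun k => 0 < n k)%N)/= [X in _ + X]big1 ?addr0; last first.
  move=> k; rewrite lt0n negbK => /andP[_ /eqP nk].
  rewrite big_pred0// => f; apply/negbTE; rewrite negb_and -implybE.
  apply/implyP => /hastypeP /(_ k); rewrite nk => /card0_eq /(_ i).
  by rewrite !inE => ->.
apply: eq_big => [k|k nk]; first by rewrite eqxx.
have {}nk : (0 < n k)%N by case/andP: nk.
by rewrite sum_hastype_upd decrK.
Qed.

Definition wprod (F : 'I_N -> option I -> V) f := \prod_i F i (f i).

Lemma wprod_upd F f i k : (forall j, F j None = 1) -> f i = None ->
  wprod F (upd f i (Some k)) = F i (Some k) * wprod F f.
Proof.
move=> F1 fi; rewrite /wprod (bigD1 i)//= ffunE eqxx.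
rewrite [in RHS](bigD1 i)//= fi F1 mul1r; congr (_ * _).
by apply: eq_bigr => j /negPf ji; rewrite ffunE ji.
Qed.

Definition nwords n := #|[pred f : word | hastype n f]|.
Definition nwords_at n i := #|[pred f : word | hastype n f && (f i == None)]|.

End word_sums.

Section word_counts.
Context (I : finType) (N : nat).

Lemma sum_nwords_at (n : I -> nat) (k : I) :
  (\sum_i @nwords_at I N n i = (n k).+1 * @nwords I N (incr n k))%N.
Proof.
apply/eqP; rewrite -(eqr_nat int) natr_sum natrM /nwords -sum1_card natr_sum.
under [X in _ == _ * X]eq_bigl do rewrite inE.
rewrite -(@sum_hastype_incr I N int n k (fun=> 1)); apply/eqP.
apply: eq_bigr => i _; rewrite /nwords_at -sum1_card natr_sum.
by apply: eq_bigl => f; rewrite inE.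
Qed.

(** Both sides count the pairs of a word of type n and a free site of it; there are N - |n| free
    sites. *)
Lemma nwords_incr (n : I -> nat) (k : I) :
  ((n k).+1 * @nwords I N (incr n k) = (N - deg n) * @nwords I N n)%N.
Proof.
rewrite -sum_nwords_at /nwords_at.
under eq_bigr do rewrite -sum1_card.
under eq_bigr do rewrite big_mkcond.
rewrite exchange_big/= mulnC -sum_nat_const big_mkcond [RHS]big_mkcond/=.
apply: eq_bigr => f _; rewrite [in RHS]inE.
case: ifPn => [|/negPf nf]; last by rewrite big1// => i _; rewrite inE nf.
move=> hf; have /hastypeP Hf := hf.
rewrite -big_mkcond/= (_ : (N - deg n = occ f None)%N); last first.
  rewrite -[X in (X - _)%N](occ_sum f).
  by rewrite (eq_bigr n) ?addnK// => k' _; rewrite Hf.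
by rewrite /occ -sum1_card; apply: eq_bigl => i; rewrite !inE hf.
Qed.

Lemma deg_eq0 (n : I -> nat) : deg n = 0%N -> forall k, n k = 0%N.
Proof.
by move=> n0 k; apply/eqP; rewrite -leqn0 -n0 /deg (bigD1 k)//= leq_addr.
Qed.

Lemma hastype0 (n : I -> nat) (f : {ffun 'I_N -> option I}) :
  deg n = 0%N -> hastype n f = (f == [ffun=> None]).
Proof.
move=> n0; apply/hastypeP/eqP => [H|-> k].
  apply/ffunP => i; rewrite ffunE; case E : (f i) => [k|//].
  have := H k; rewrite deg_eq0// => /card0_eq /(_ i).
  by rewrite !inE E eqxx.
by rewrite deg_eq0//; apply: eq_card0 => i; rewrite !inE ffunE.
Qed.

Lemma nwords0 (n : I -> nat) : deg n = 0%N -> @nwords I N n = 1%N.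
Proof.
move=> n0; rewrite /nwords -(card1 ([ffun=> None] : {ffun 'I_N -> option I})).
by apply: eq_card => f; rewrite !inE hastype0.
Qed.

(** Strong induction on the degree, because the Hermite-type recurrence for [incr n k] involves
    [decr n k] besides n. *)
Lemma multi_index_ind (p : (I -> nat) -> Prop) :
  (forall n, deg n = 0%N -> p n) ->
  (forall n k, (forall n', (deg n' <= deg n)%N -> p n') -> p (incr n k)) ->
  forall n, p n.
Proof.
move=> p0 pS n; have [D] := ubnP (deg n); elim: D n => // D IH n.
rewrite ltnS => nD.
have [n0|n0] := eqVneq (deg n) 0%N; first exact: p0.
have [k nk] : exists k, (0 < n k)%N.
  apply/existsP; apply: contraR n0; rewrite negb_exists => /forallP H.
  by rewrite /deg big1// => k _; apply/eqP; rewrite -leqn0 leqNgt.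
rewrite -(decrK nk); apply: pS => n' n'n; apply: IH.
by apply: leq_ltn_trans n'n _; rewrite deg_decr.
Qed.

(** c_n is the multinomial coefficient N! / ((N - |n|)! prod_k n_k!), written without division; both
    sides vanish when |n| exceeds N. *)
Lemma nwords_ffact (n : I -> nat) :
  (@nwords I N n * \prod_k (n k)`! = N ^_ deg n)%N.
Proof.
elim/multi_index_ind: n => [n n0|n k IH].
  by rewrite nwords0// n0 ffactn0 big1 ?muln1// => k _; rewrite deg_eq0.
rewrite deg_incr ffactnSr -IH// (bigD1 k)//= [in RHS](bigD1 k)//=.
have -> : (incr n k k = (n k).+1)%N by rewrite /incr eqxx addn1.
rewrite factS.
rewrite (eq_bigr (fun j => (n j)`!)) => [|j /negPf jk]; last first.
  by rewrite /incr jk addn0.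
rewrite !mulnA [(_ * (n k).+1)%N]mulnC nwords_incr; ring.
Qed.

Lemma nwords_le (n : I -> nat) : (@nwords I N n <= N ^ deg n)%N.
Proof.
apply: (@leq_trans (N ^_ deg n)); last first.
  rewrite ffact_prod -[X in (_ <= _ ^ X)%N]card_ord -prod_nat_const.
  by apply: leq_prod => i _; exact: leq_subr.
rewrite -nwords_ffact leq_pmulr// prodn_gt0// => k; exact: fact_gt0.
Qed.

End word_counts.

(** * Elementary sums *)

Section L1.
Context d (T : measurableType d) (R : realType) (m : probability T R).
Implicit Types f g : T -> R.

Notation l1 f := (m.-integrable setT (EFin \o f)).

Definition nrm1 f := \int[m]_x `|f x|.

Lemma l1_abs f : l1 f -> l1 (fun x => `|f x|).
Proof.
by move=> fi; have := integrable_abse fi; apply: eq_integrable.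
Qed.

Lemma l1D f g : l1 f -> l1 g -> l1 (fun x => f x + g x).
Proof. by move=> fi gi; have := integrableD measurableT fi gi; apply: eq_integrable. Qed.

Lemma l1Z c f : l1 f -> l1 (fun x => c * f x).
Proof. by move=> fi; have := integrableZl measurableT c fi; apply: eq_integrable. Qed.

Lemma l1B f g : l1 f -> l1 g -> l1 (fun x => f x - g x).
Proof.
by move=> fi /(l1Z (-1)) gi; have := l1D fi gi; congr integrable;
   apply/funext => x /=; rewrite mulN1r.
Qed.

Lemma l1_sum (J : Type) (r : seq J) (p : pred J) (F : J -> T -> R) :
  (forall j, p j -> l1 (F j)) -> l1 (fun x => \sum_(j <- r | p j) F j x).
Proof.
move=> FL; elim: r => [|i r IH].
  under eq_fun do rewrite big_nil; exact: sqint_integrable (sqint_cst m 0).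
under eq_fun do rewrite big_cons.
by have [Pi|//] := boolP (p i); apply: l1D => //; exact: FL.
Qed.

Lemma nrm1_ge0 f : 0 <= nrm1 f.
Proof. by apply: Rintegral_ge0. Qed.

Lemma nrm1D f g : l1 f -> l1 g ->
  nrm1 (fun x => f x + g x) <= nrm1 f + nrm1 g.
Proof.
move=> fi gi; rewrite /nrm1 -RintegralD//; try exact: l1_abs.
apply: le_Rintegral => //; first exact/l1_abs/l1D.
  by apply: l1D; exact: l1_abs.
by move=> x _; exact: ler_normD.
Qed.

Lemma nrm1Z c f : l1 f -> nrm1 (fun x => c * f x) = `|c| * nrm1 f.
Proof.
move=> fi; rewrite /nrm1 -RintegralZl//; last exact: l1_abs.
by apply: eq_Rintegral => x _; rewrite normrM.
Qed.

Lemma nrm1B f g : l1 f -> l1 g ->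
  nrm1 (fun x => f x - g x) <= nrm1 f + nrm1 g.
Proof.
move=> fi gi; have := nrm1D fi (l1Z (-1) gi).
rewrite nrm1Z// normrN1 mul1r; congr (_ <= _).
by congr nrm1; apply/funext => x; rewrite mulN1r.
Qed.

Lemma nrm1_sum (J : Type) (r : seq J) (p : pred J) (F : J -> T -> R) :
  (forall j, p j -> l1 (F j)) ->
  nrm1 (fun x => \sum_(j <- r | p j) F j x) <= \sum_(j <- r | p j) nrm1 (F j).
Proof.
move=> FL; elim: r => [|i r IH].
  rewrite big_nil (_ : nrm1 _ = 0)// /nrm1.
  by under eq_Rintegral do rewrite big_nil normr0; rewrite Rintegral_probability_cst.
rewrite big_cons; have [Pi|nPi] := boolP (p i).
  rewrite (_ : (fun x => _) = fun x => F i x + \sum_(j <- r | p j) F j x).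
    by rewrite (le_trans (nrm1D _ _))//; [exact: FL|exact: l1_sum|rewrite lerD2l].
  by apply/funext => x; rewrite big_cons Pi.
by rewrite (_ : (fun x => _) = fun x => \sum_(j <- r | p j) F j x)//;
  apply/funext => x; rewrite big_cons (negPf nPi).
Qed.

Lemma nrm1_mul f g : sqint m f -> sqint m g ->
  nrm1 (fun x => f x * g x) <= Num.sqrt (ip m f f) * Num.sqrt (ip m g g).
Proof.
move=> fL gL; have := cauchy_schwarz_norm (sqint_abs fL) (sqint_abs gL).
have E h : ip m (fun x => `|h x|) (fun x => `|h x|) = ip m h h.
  by apply: eq_Rintegral => x _; rewrite -normrM ger0_norm// -expr2 sqr_ge0.
rewrite !E; apply: le_trans; apply: le_trans (ler_norm _).
by rewrite le_eqVlt; apply/orP; left; apply/eqP; apply: eq_Rintegral => x _; rewrite normrM.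
Qed.

Lemma nrm1_sqint f : sqint m f -> nrm1 f <= Num.sqrt (ip m f f).
Proof.
move=> fL; have := nrm1_mul fL (sqint_cst m 1).
rewrite ip11 sqrtr1 mulr1; congr (_ <= _).
by congr nrm1; apply/funext => x; rewrite mulr1.
Qed.

Lemma normr_Rintegral_le f : l1 f -> `|\int[m]_x f x| <= nrm1 f.
Proof. exact: le_normr_Rintegral. Qed.

Lemma markov_nrm1 f eps : 0 < eps -> l1 f ->
  (m [set x | (eps <= `|f x|)%R] <= (nrm1 f / eps)%:E)%E.
Proof.
move=> e0 fi.
have mA : measurable [set x | eps <= `|f x|].
  rewrite -[X in measurable X]setTI; apply: measurable_fun_le => //.
  by apply: measurableT_comp => //; exact: integrable_measurable fi.
have := @le_integral_comp_abse _ _ _ m _ measurableT (EFin \o f) eps id.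
rewrite setTI => /(_ _ _ _ _ e0); rewrite (_ : (fun x => _)%E = fun x => `|f x|%:E)//.
have -> : [set x | (eps%:E <= `|(EFin \o f) x|)%E] = [set x | eps <= `|f x|].
  by apply/seteqP; split => x; rewrite /= lee_fin.
move=> /(_ _ _ _ _) H.
rewrite EFinM lee_pdivlMr// muleC.
rewrite /nrm1 /Rintegral fineK; last first.
  by apply: (integrable_fin_num measurableT); exact: l1_abs.
apply: H => //.
by apply/measurable_EFinP; exact: integrable_measurable fi.
Qed.

(** Truncation of f where |f| exceeds a level. It is meant for products of two letters, which are
    only integrable, whereas the law of large numbers is proved through variances. *)
Lemma integrable_bounded_approx f : l1 f -> forall eps, 0 < eps ->
  exists M g, [/\ measurable_fun setT g, (forall x, `|g x| <= M) &
    nrm1 (fun x => f x - g x) <= eps].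
Proof.
move=> fi eps e0.
have mf := integrable_measurable fi.
pose g (n : nat) x := f x * ((`|f x| <= n%:R)%R)%:R.
have mg n : measurable_fun setT (g n).
  apply: measurable_funM => //.
  pose A : set T := [set x | (`|f x| <= n%:R)%R].
  rewrite (_ : (fun x => _) = \1_A); last first.
    by apply/funext => x; rewrite indicE mem_setE.
  apply: measurable_indic; rewrite -[X in measurable X]setTI.
  by apply: measurable_fun_le => //; exact: measurableT_comp.
have gf n x : `|g n x| <= `|f x|.
  by rewrite /g; case: (`|f x| <= n%:R)%R; rewrite /= ?mulr1// mulr0 normr0.
have gb n x : `|g n x| <= n%:R.
  by rewrite /g; case: (leP `|f x| n%:R) => H /=; rewrite ?mulr1// mulr0 normr0.
have gl n : l1 (g n) by exact: integrable_le (mg n) fi (gf n).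
have mEg n : measurable_fun setT (EFin \o g n) by apply/measurable_EFinP.
have mEf : measurable_fun setT (EFin \o f) by apply/measurable_EFinP.
have gcv : {ae m, forall x, setT x -> (EFin \o g n) x @[n --> \oo] --> (EFin \o f) x}.
  apply: aeW => x _ /=; apply: cvg_near_cst.
  near=> n; rewrite /g (_ : (_ <= _)%R = true) ?mulr1//.
  near: n; exact: nbhs_infty_ger.
have gd : {ae m, forall x n, setT x -> `|(EFin \o g n) x| <= (EFin \o (fun x => `|f x|%R)) x}%E.
  by apply: aeW => x n _ /=; rewrite lee_fin.
have [_ cv _] := dominated_convergence measurableT mEg mEf gcv (l1_abs fi) gd.
move/fine_cvgP : cv => [_ /cvgrPdist_le/(_ _ e0)][n _ /(_ n (leqnn _))].
rewrite /= sub0r normrN => H.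
exists n%:R, (g n); split => //.
apply: le_trans H; apply: le_trans (ler_norm _).
rewrite le_eqVlt; apply/orP; left; apply/eqP; rewrite /nrm1 /Rintegral.
by congr fine; apply: eq_integral => x _ /=; rewrite distrC.
Unshelve. all: by end_near. Qed.

End L1.

Section elementary_sums.
Context d (T : measurableType d) (R : realType) (m : probability T R).
Variables (I : finType) (e : I -> T -> R).
Hypothesis eL : forall i, sqint m (e i).
Hypothesis ee : forall i j, ip m (e i) (e j) = (i == j)%:R.
Hypothesis e1 : forall i, ip m (e i) (fun=> 1) = 0.

Notation l1 f := (m.-integrable setT (EFin \o f)).

Lemma sqint_letter o : sqint m (letter e o).
Proof. by case: o => [i|] /=; [exact: eL|exact: sqint_cst]. Qed.

Lemma ip_letter o o' : ip m (letter e o) (letter e o') = (o == o')%:R.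
Proof.
case: o o' => [i|] [j|] /=; [exact: ee|exact: e1|by rewrite ipC e1|].
by rewrite ip11.
Qed.

Section fixed_size.
Variable N : nat.
Notation mN := (power_measure m N).
Notation word := {ffun 'I_N -> option I}.
Implicit Types (f : word) (n : I -> nat).

Definition site (phi : T -> R) (i : 'I_N) : N.-tuple T -> R :=
  fun z => phi (tnth z i).

Lemma siteE phi i : site phi i = pf (fun j => if j == i then phi else fun=> 1).
Proof.
apply/funext => z; rewrite /pf (bigD1 i)//= eqxx big1 ?mulr1// => j /negPf ->//.
Qed.

Lemma sqint_site phi i : sqint m phi -> sqint mN (site phi i).
Proof.
move=> phiL; rewrite siteE; apply: sqint_pf => j.
by case: ifP => // _; exact: sqint_cst.
Qed.

Lemma ip_site phi psi i j : sqint m phi -> sqint m psi ->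
  ip mN (site phi i) (site psi j) =
  if i == j then ip m phi psi else ip m phi (fun=> 1) * ip m psi (fun=> 1).
Proof.
move=> phiL psiL; rewrite !siteE ip_pf; last 2 first.
- by move=> k; case: ifP => // _; exact: sqint_cst.
- by move=> k; case: ifP => // _; exact: sqint_cst.
rewrite (bigD1 i)//= eqxx; case: eqVneq => [->|ij].
  by rewrite big1 ?mulr1// => k /negPf ->; rewrite ip11.
rewrite (bigD1 j)/=; last by rewrite eq_sym.
rewrite eqxx eq_sym (negPf ij) big1 ?mulr1; last first.
  by move=> k /andP[/negPf -> /negPf ->]; rewrite ip11.
by rewrite (ipC m (fun=> 1) psi).
Qed.

Definition emono f : N.-tuple T -> R := pf (fun i => letter e (f i)).

Definition elsym n (z : N.-tuple T) := \sum_(f : word | hastype n f) emono f z.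

(** Site i is free in all these words, so the sum does not involve the coordinate i and is
    independent of functions of it. *)
Definition elsym_at n i (z : N.-tuple T) :=
  \sum_(f : word | hastype n f && (f i == None)) emono f z.

Lemma sqint_emono f : sqint mN (emono f).
Proof. by apply: sqint_pf => i; exact: sqint_letter. Qed.

Lemma ip_emono f g : ip mN (emono f) (emono g) = (f == g)%:R.
Proof.
rewrite ip_pf; [|by move=> i; exact: sqint_letter..].
under eq_bigr do rewrite ip_letter.
have [->|/eqP fg] := eqVneq f g; first by rewrite big1// => i _; rewrite eqxx.
have [i Hi] : exists i, f i != g i.
  apply/existsP; rewrite -negb_forall; apply/negP => /forallP H.
  by apply: fg; apply/ffunP => i; apply/eqP.
by rewrite (bigD1 i)//= (negPf Hi) mul0r.
Qed.

Lemma sqint_elsym n : sqint mN (elsym n).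
Proof. by apply: sqint_sum => f _; exact: sqint_emono. Qed.

Lemma nwords_at_le n i : (@nwords_at I N n i <= @nwords I N n)%N.
Proof.
by apply: subset_leq_card; apply/fintype.subsetP => f; rewrite !inE => /andP[].
Qed.

Lemma ip_elsym n : ip mN (elsym n) (elsym n) = (@nwords I N n)%:R.
Proof.
rewrite ip_suml; [|by move=> f _; exact: sqint_emono|exact: sqint_elsym].
rewrite /nwords -sum1_card natr_sum [RHS](eq_bigl (hastype n)) => [|f]; last first.
  by rewrite inE.
apply: eq_bigr => f hf; rewrite ip_sumr; last 2 first.
- by move=> g _; exact: sqint_emono.
- exact: sqint_emono.
rewrite (bigD1 f)//= ip_emono eqxx big1 ?addr0// => g /andP[_ /negPf gf].
by rewrite ip_emono eq_sym gf.
Qed.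

(** As site i is free, [phi] can occupy it like one more letter, and the resulting tensors are still
    orthogonal. *)
Lemma sqint_site_elsym_at phi n i : sqint m phi ->
  sqint mN (fun z => site phi i z * elsym_at n i z) /\
  ip mN (fun z => site phi i z * elsym_at n i z)
        (fun z => site phi i z * elsym_at n i z) =
  ip m phi phi * (@nwords_at I N n i)%:R.
Proof.
move=> phiL.
pose F f j := if j == i then phi else letter e (f j).
have FL f j : sqint m (F f j).
  by rewrite /F; case: ifP => // _; exact: sqint_letter.
have -> : (fun z => site phi i z * elsym_at n i z) =
    fun z => \sum_(f : word | hastype n f && (f i == None)) pf (F f) z.
  apply/funext => z; rewrite /elsym_at mulr_sumr; apply: eq_bigr => f.
  move=> /andP[_ /eqP fi]; rewrite /emono /pf (bigD1 i)//= fi mul1r.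
  rewrite [RHS](bigD1 i)//= /F eqxx; congr (_ * _).
  by apply: eq_bigr => j /negPf ->.
have sL : sqint mN (fun z => \sum_(f : word | hastype n f && (f i == None)) pf (F f) z).
  by apply: sqint_sum => f _; exact: sqint_pf.
split=> //; rewrite ip_suml//; last by move=> f _; exact: sqint_pf.
rewrite /nwords_at -sum1_card natr_sum mulr_sumr.
rewrite [RHS](eq_bigl (fun f => hastype n f && (f i == None))) => [|f]; last first.
  by rewrite inE.
apply: eq_bigr => f hf; rewrite mulr1 ip_sumr; last 2 first.
- by move=> g _; exact: sqint_pf.
- exact: sqint_pf.
rewrite (bigD1 f)//= ip_pf// (bigD1 i)//= [X in _ * X]big1 ?mulr1; last first.
  by move=> j /negPf ji; rewrite /F ji ip_letter eqxx.
have Fi g : F g i = phi by rewrite /F eqxx.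
rewrite !Fi big1 ?addr0// => g /andP[/andP[_ /eqP gi] /eqP gf].
rewrite ip_pf//.
have [j Hj] : exists j, f j != g j.
  apply/existsP; rewrite -negb_forall; apply/negP => /forallP H.
  by apply: gf; apply/ffunP => j; apply/eqP; rewrite eq_sym.
have ji : j != i.
  apply: contraNneq Hj => ->; have /andP[_ /eqP ->] := hf; by rewrite gi.
by rewrite (bigD1 j)//= /F (negPf ji) ip_letter (negPf Hj) mul0r.
Qed.

(** Here [phi] is only integrable. Writing |phi| as h * h with h square integrable reduces the claim
    to Cauchy-Schwarz between h at site i and h at site i times the sum. *)
Lemma l1_site_elsym_at phi n i : l1 phi ->
  mN.-integrable setT (EFin \o (fun z => site phi i z * elsym_at n i z)) /\
  nrm1 mN (fun z => site phi i z * elsym_at n i z) <=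
    nrm1 m phi * Num.sqrt (@nwords I N n)%:R.
Proof.
move=> phiL; have mphi := integrable_measurable phiL.
pose h x := `|phi x| `^ 2^-1.
have h2 x : h x ^+ 2 = `|phi x|.
  by rewrite -powR_mulrn ?powR_ge0// -powRrM mulVf// powRr1.
have mh : measurable_fun setT h.
  by apply: (measurableT_comp (measurable_powR _)) => //; exact: measurableT_comp.
have hL : sqint m h.
  split => //; have := l1_abs phiL.
  by apply: eq_integrable => // x _ /=; rewrite h2.
have iph : ip m h h = nrm1 m phi.
  by apply: eq_Rintegral => x _; rewrite -expr2 h2.
have [hEL hEE] := sqint_site_elsym_at n i hL.
have hsL := sqint_site i hL.
have normE z : `|site phi i z * elsym_at n i z| =
    `|site h i z * (site h i z * elsym_at n i z)|.
  by rewrite mulrA -expr2 /site h2 !normrM normr_id.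
have mprod : measurable_fun setT (fun z => site phi i z * elsym_at n i z).
  apply: measurable_funM.
    by apply: (measurableT_comp mphi); exact: measurable_tnth.
  apply: (sqint_measurable (m := mN)).
  by apply: sqint_sum => f _; exact: sqint_emono.
split.
  apply: (integrable_le mprod (sqint_mul_integrable hsL hEL)) => z.
  by rewrite normE.
rewrite [leLHS](_ : _ =
    nrm1 mN (fun z => site h i z * (site h i z * elsym_at n i z))); last first.
  by apply: eq_Rintegral => z _; rewrite normE.
apply: (le_trans (nrm1_mul hsL hEL)).
rewrite hEE ip_site// eqxx iph sqrtrM ?nrm1_ge0//.
rewrite mulrA -expr2 sqr_sqrtr ?nrm1_ge0//.
rewrite ler_wpM2l ?nrm1_ge0// ler_sqrt// ler_nat.
exact: nwords_at_le.
Qed.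

End fixed_size.
End elementary_sums.

Section elementary_sums_asymptotics.
Context d (T : measurableType d) (R : realType) (m : probability T R).
Variables (I : finType) (e : I -> T -> R).
Hypothesis eL : forall i, sqint m (e i).
Hypothesis ee : forall i j, ip m (e i) (e j) = (i == j)%:R.
Hypothesis e1 : forall i, ip m (e i) (fun=> 1) = 0.

Notation l1 f := (m.-integrable setT (EFin \o f)).

Definition rt (N : nat) : R := Num.sqrt N%:R.

Lemma rt_sqr N : rt N ^+ 2 = N%:R.
Proof. by rewrite sqr_sqrtr. Qed.

Lemma rt_ge0 N : 0 <= rt N.
Proof. exact: sqrtr_ge0. Qed.

Lemma rt_gt0 N : (0 < N)%N -> 0 < rt N.
Proof. by move=> N0; rewrite sqrtr_gt0 ltr0n. Qed.

Section fixed_size.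
Variable N : nat.
Notation mN := (power_measure m N).
Implicit Types (n : I -> nat).

Lemma sqrt_nwords_le n : Num.sqrt (@nwords I N n)%:R <= rt N ^+ deg n.
Proof.
rewrite -(ger0_norm (exprn_ge0 (deg n) (rt_ge0 N))) -sqrtr_sqr ler_sqrt ?sqr_ge0//.
by rewrite exprAC rt_sqr -natrX ler_nat nwords_le.
Qed.

Lemma elsym_split n i (z : N.-tuple T) : elsym e n z = elsym_at e n i z +
  \sum_(k | (0 < n k)%N) site (e k) i z * elsym_at e (decr n k) i z.
Proof.
rewrite /elsym (hastype_split n i); congr (_ + _).
apply: eq_bigr => k nk; rewrite mulr_sumr; apply: eq_bigr => f /andP[_ /eqP fi].
exact: (@wprod_upd _ _ _ (fun i o => letter e o (tnth z i)) f i k).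
Qed.

Lemma elsym_incr n k (z : N.-tuple T) :
  \sum_i site (e k) i z * elsym_at e n i z = (n k).+1%:R * elsym e (incr n k) z.
Proof.
rewrite -sum_hastype_incr; apply: eq_bigr => i _.
rewrite mulr_sumr; apply: eq_bigr => f /andP[_ /eqP fi].
by rewrite [RHS](@wprod_upd _ _ _ (fun i o => letter e o (tnth z i)) f i k).
Qed.

(** Such means arise when a letter meets an occupied site, [phi] being the product of the two
    letters. They obey a law of large numbers at scale N^(|n|/2): [phi] may be replaced by its mean
    and [elsym_at] by [elsym]. *)
Definition site_mean (phi : T -> R) n (z : N.-tuple T) : R :=
  N%:R^-1 * \sum_i site phi i z * elsym_at e n i z.

Lemma l1_site_mean phi n : l1 phi ->
  mN.-integrable setT (EFin \o site_mean phi n) /\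
  nrm1 mN (site_mean phi n) <= nrm1 m phi * rt N ^+ deg n.
Proof.
move=> phiL.
have H (i : 'I_N) := l1_site_elsym_at eL ee e1 n i phiL.
have sL : mN.-integrable setT
    (EFin \o (fun z => \sum_i site phi i z * elsym_at e n i z)).
  by apply: l1_sum => i _; exact: (H i).1.
split; first exact: l1Z.
rewrite nrm1Z// ger0_norm ?invr_ge0//.
have [->|N0] := posnP N.
  by rewrite invr0 mul0r mulr_ge0 ?nrm1_ge0// exprn_ge0 ?rt_ge0.
rewrite ler_pdivrMl ?ltr0n//.
apply: (le_trans (nrm1_sum _ _)) => [i _|]; first by exact: (H i).1.
apply: (@le_trans _ _ (\sum_(i < N) nrm1 m phi * rt N ^+ deg n)).
  apply: ler_sum => i _; apply: (le_trans (H i).2).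
  by rewrite ler_wpM2l ?nrm1_ge0// sqrt_nwords_le.
by rewrite sumr_const card_ord mulr_natl.
Qed.

Lemma nrm1_elsym n : nrm1 mN (elsym e n) <= rt N ^+ deg n.
Proof.
apply: (le_trans (nrm1_sqint (sqint_elsym eL N n))).
by rewrite ip_elsym// sqrt_nwords_le.
Qed.

Lemma sqint_mean phi : sqint m phi ->
  sqint mN (fun z => N%:R^-1 * \sum_i site phi i z).
Proof.
by move=> phiL; apply: sqintZ; apply: sqint_sum => i _; exact: sqint_site.
Qed.

Lemma ip_mean phi : (0 < N)%N -> sqint m phi -> ip m phi (fun=> 1) = 0 ->
  ip mN (fun z => N%:R^-1 * \sum_i site phi i z)
        (fun z => N%:R^-1 * \sum_i site phi i z) = ip m phi phi / N%:R.
Proof.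
move=> N0 phiL phi1.
have sL : sqint mN (fun z => \sum_i site phi i z).
  by apply: sqint_sum => i _; exact: sqint_site.
rewrite ipZl ?ipZr//; last exact: sqintZ.
rewrite ip_suml//; last by move=> i _; exact: sqint_site.
rewrite (eq_bigr (fun=> ip m phi phi)).
  rewrite sumr_const card_ord -[_ *+ _]mulr_natr.
  have n0 : N%:R != 0 :> R by rewrite pnatr_eq0 -lt0n.
  by field.
move=> i _; rewrite ip_sumr//; last 2 first.
- by move=> j _; exact: sqint_site.
- exact: sqint_site.
rewrite (bigD1 i)//= ip_site// eqxx big1 ?addr0// => j ji.
by rewrite ip_site// eq_sym (negPf ji) phi1 mul0r.
Qed.

(** Two errors of relative order N^(-1/2): the deviation of the empirical mean of [phi] from c, and
    the words of [elsym] that occupy site i, which leave site means of degree one less. *)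
Lemma site_mean_bounded phi n c : (0 < N)%N -> sqint m phi ->
  (forall k, l1 (fun x => phi x * e k x)) -> \int[m]_x phi x = c ->
  nrm1 mN (fun z => site_mean phi n z - c * elsym e n z) <=
  (Num.sqrt (ip m (fun x => phi x - c) (fun x => phi x - c)) +
   \sum_k nrm1 m (fun x => phi x * e k x)) / rt N * rt N ^+ deg n.
Proof.
move=> N0 phiL phieL cE.
pose psi x := phi x - c.
have psiL : sqint m psi by apply: sqintB => //; exact: sqint_cst.
have psi1 : ip m psi (fun=> 1) = 0.
  rewrite ipBl//; [|exact: sqint_cst|exact: sqint_cst].
  rewrite {2}/ip; under [X in _ - X]eq_Rintegral do rewrite mulr1.
  rewrite Rintegral_probability_cst /ip.
  by under eq_Rintegral do rewrite mulr1; rewrite cE subrr.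
have r0 := rt_gt0 N0.
have n0 : N%:R != 0 :> R by rewrite pnatr_eq0 -lt0n.
have E z : site_mean phi n z - c * elsym e n z =
    (N%:R^-1 * \sum_i site psi i z) * elsym e n z -
    \sum_(k | (0 < n k)%N) site_mean (fun x => phi x * e k x) (decr n k) z.
  rewrite /site_mean -mulr_sumr exchange_big/=.
  have -> : \sum_i site psi i z = \sum_i site phi i z - N%:R * c.
    by rewrite /site /psi big_split/= sumrN sumr_const card_ord mulr_natl.
  rewrite mulrBr mulKf// mulrBl addrAC; congr (_ - _).
  rewrite -mulrA -mulrBr; congr (_ * _); rewrite mulr_suml -sumrB.
  apply: eq_bigr => i _.
  have -> : \sum_(k | (0 < n k)%N)
        site (fun x => phi x * e k x) i z * elsym_at e (decr n k) i z =
      site phi i z *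
        \sum_(k | (0 < n k)%N) site (e k) i z * elsym_at e (decr n k) i z.
    by rewrite [RHS]mulr_sumr; apply: eq_bigr => k _; rewrite mulrA.
  by rewrite (elsym_split n i z) mulrDr addrK.
have pL := sqint_mean psiL.
have eL' := sqint_elsym eL N n.
have kL k := l1_site_mean (decr n k) (phieL k).
rewrite [leLHS](_ : _ = nrm1 mN (fun z =>
  (N%:R^-1 * \sum_i site psi i z) * elsym e n z -
  \sum_(k | (0 < n k)%N) site_mean (fun x => phi x * e k x) (decr n k) z)); last first.
  by congr nrm1; apply/funext => z; rewrite E.
apply: (le_trans (nrm1B _ _)).
- exact: sqint_mul_integrable.
- by apply: l1_sum => k _; exact: (kL k).1.
rewrite !mulrDl lerD//.
  apply: (le_trans (nrm1_mul _ _)) => //.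
  rewrite ip_mean// ip_elsym// ler_pM ?sqrtr_ge0//; last exact: sqrt_nwords_le.
  by rewrite sqrtrM ?ip_ge0// sqrtrV.
apply: (le_trans (nrm1_sum _ _)) => [k _|]; first exact: (kL k).1.
rewrite -mulrA mulr_suml big_mkcond/=; apply: ler_sum => k _.
have n1 := nrm1_ge0 m (fun x => phi x * e k x).
case: ifP => nk; last by rewrite mulr_ge0// mulr_ge0 ?exprn_ge0 ?invr_ge0 ?rt_ge0.
apply: (le_trans (kL k).2).
rewrite ler_wpM2l//.
by rewrite -(deg_decr nk) exprS mulKf// gt_eqF.
Qed.

End fixed_size.

Lemma rt_eventually (C eps : R) : 0 < eps ->
  exists N0, forall N, (N0 <= N)%N -> (0 < N)%N /\ C / rt N <= eps.
Proof.
move=> e0; exists (Num.truncn ((C / eps) ^+ 2)).+1 => N NN.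
have N0 : (0 < N)%N by apply: leq_trans NN.
split=> //; rewrite ler_pdivrMr ?rt_gt0// mulrC -ler_pdivrMr//.
apply: le_trans (ler_norm _) _; rewrite -sqrtr_sqr ler_sqrt//.
apply: ltW; apply: lt_le_trans (_ : _ < (Num.truncn ((C / eps) ^+ 2)).+1%:R) _.
  exact: truncnS_gt.
by rewrite ler_nat.
Qed.

Lemma site_mean_cvg phi n : l1 phi -> forall eps, 0 < eps ->
  exists N0, forall N, (N0 <= N)%N ->
  nrm1 (power_measure m N)
    (fun z => site_mean phi n z - (\int[m]_x phi x) * elsym e n z) <=
  eps * rt N ^+ deg n.
Proof.
move=> phiL eps eps0.
(* A quarter of eps goes to phi - g under the site mean, a quarter to the change of the mean value,
   and a half to the bounded function g. *)
have [M [g [mg gM Hg]]] := integrable_bounded_approx phiL (divr_gt0 eps0 (@ltr0n R 4)).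
have gL : sqint m g by exact: sqint_bounded gM.
have gl := sqint_integrable gL.
have gk k := sqint_mul_integrable gL (eL k).
set c := \int[m]_x phi x; set c' := \int[m]_x g x.
set C := Num.sqrt (ip m (fun x => g x - c') (fun x => g x - c')) +
         \sum_k nrm1 m (fun x => g x * e k x).
have [N0 HN0] := rt_eventually C (divr_gt0 eps0 (@ltr0n R 2)).
exists N0 => N /HN0[Npos CN].
have dl := l1B phiL gl.
have [s1 n1] := l1_site_mean N n dl.
have [s2 _] := l1_site_mean N n gl.
have el1 := sqint_integrable (sqint_elsym eL N n).
have n2 := site_mean_bounded n Npos gL gk (erefl c').
have cc : `|c - c'| <= eps / 4.
  apply: le_trans Hg; rewrite /c /c' -RintegralB//.
  exact: normr_Rintegral_le.
rewrite [leLHS](_ : _ = nrm1 (power_measure m N) (fun z =>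
  (site_mean (fun x => phi x - g x) n z + (site_mean g n z - c' * elsym e n z)) -
  (c - c') * elsym e n z)); last first.
  congr nrm1; apply/funext => z.
  have -> : site_mean (fun x => phi x - g x) n z = site_mean phi n z - site_mean g n z.
    rewrite /site_mean -mulrBr; congr (_ * _); rewrite -sumrB.
    by apply: eq_bigr => i _; rewrite /site mulrBl.
  ring.
have l2 : (power_measure m N).-integrable setT
    (EFin \o (fun z => site_mean g n z - c' * elsym e n z)).
  by apply: l1B => //; exact: l1Z.
apply: (le_trans (nrm1B _ _)); [exact: l1D|exact: l1Z|].
rewrite nrm1Z//.
have -> : eps * rt N ^+ deg n = (eps / 4 * rt N ^+ deg n +
    eps / 2 * rt N ^+ deg n) + eps / 4 * rt N ^+ deg n by field.
rewrite lerD//.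
  apply: (le_trans (nrm1D _ _)) => //; rewrite lerD//.
    apply: (le_trans n1); rewrite ler_wpM2r ?exprn_ge0 ?rt_ge0//.
  by apply: (le_trans n2); rewrite ler_wpM2r ?exprn_ge0 ?rt_ge0.
by apply: ler_pM => //; [exact: nrm1_ge0|exact: nrm1_elsym].
Qed.

Definition scaled_elsym N n (z : N.-tuple T) : R := elsym e n z / rt N ^+ deg n.

Definition fluct N k (z : N.-tuple T) : R := (\sum_i site (e k) i z) / rt N.

(** Multiply E_n by the sum of e_k over the sites. At a free site this adds the letter k and yields
    E at [incr n k] with multiplicity n_k + 1; at a site carrying l it leaves e_k e_l, and these
    terms form the site means. *)
Lemma scaled_elsym_incr N n k (z : N.-tuple T) : (0 < N)%N ->
  (n k).+1%:R * scaled_elsym (incr n k) z =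
  fluct k z * scaled_elsym n z -
  \sum_(l | (0 < n l)%N)
    site_mean (fun x => e k x * e l x) (decr n l) z / rt N ^+ deg (decr n l).
Proof.
move=> N0; have r0 : rt N != 0 by rewrite gt_eqF// rt_gt0.
have rd (n' : I -> nat) : rt N ^+ deg n' != 0 by rewrite expf_neq0.
have n0 : N%:R != 0 :> R by rewrite pnatr_eq0 -lt0n.
rewrite /scaled_elsym mulrA -elsym_incr /fluct mulrACA -invfM deg_incr exprS.
have w0 : rt N * rt N ^+ deg n != 0 by rewrite mulf_neq0.
apply: (@mulIf _ _ w0); rewrite divfK//.
rewrite mulrBl divfK// [X in _ - X]mulr_suml.
rewrite [X in _ - X](eq_bigr (fun l => \sum_i site (e k) i z *
   (site (e l) i z * elsym_at e (decr n l) i z))); last first.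
  move=> l nl; rewrite /site_mean -(deg_decr nl) exprS.
  have := rd (decr n l); set r := rt N ^+ _ => rr.
  set S := \sum_i _.
  have -> : N%:R^-1 * S / r * (rt N * (rt N * r)) = S.
    by rewrite [rt N * (rt N * r)]mulrA -expr2 rt_sqr; field; rewrite n0 rr.
  by rewrite /S; apply: eq_bigr => i _; rewrite /site !mulrA.
rewrite exchange_big/= mulr_suml -sumrB; apply: eq_bigr => i _.
rewrite (elsym_split n i z) mulrDr [X in _ = _ + X - _]mulr_sumr addrK//.
Qed.

(* The three-term recurrence of the Hermite polynomials, which [scaled_elsym]
   satisfies only up to this defect. *)
Definition elsym_defect N n k (z : N.-tuple T) : R :=
  (n k).+1%:R * scaled_elsym (incr n k) z - fluct k z * scaled_elsym n z +
  (0 < n k)%N%:R * scaled_elsym (decr n k) z.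

(** By orthonormality e_k e_l has mean 1 for l = k and 0 otherwise, so in the limit only the site
    mean with l = k remains, and it cancels the last term of the defect. *)
Lemma elsym_defect_cvg n k eps : 0 < eps -> exists N0, forall N, (N0 <= N)%N ->
  (power_measure m N).-integrable setT (EFin \o @elsym_defect N n k) /\
  nrm1 (power_measure m N) (elsym_defect n k) <= eps.
Proof.
move=> eps0.
(* One share of eps per letter; the successor makes J positive at once. *)
pose J := #|I|.+1%:R : R.
have J0 : 0 < J by rewrite ltr0n.
have kl l := sqint_mul_integrable (eL k) (eL l).
have /choice[N0 HN0] : forall l, exists N0, forall N, (N0 <= N)%N ->
    nrm1 (power_measure m N)
      (fun z => site_mean (fun x => e k x * e l x) (decr n l) z -
        (\int[m]_x (e k x * e l x)) * elsym e (decr n l) z) <=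
    eps / J * rt N ^+ deg (decr n l).
  by move=> l; apply: site_mean_cvg => //; exact: divr_gt0.
exists (\max_l N0 l).+1 => N NN.
have Npos : (0 < N)%N by apply: leq_trans NN.
have r0 : rt N != 0 by rewrite gt_eqF// rt_gt0.
have rd (n' : I -> nat) : rt N ^+ deg n' != 0 by rewrite expf_neq0.
pose F l (z : N.-tuple T) := (rt N ^+ deg (decr n l))^-1 *
  (site_mean (fun x => e k x * e l x) (decr n l) z -
        (\int[m]_x (e k x * e l x)) * elsym e (decr n l) z).
have E : elsym_defect n k = fun z : N.-tuple T => - 1 * \sum_(l | (0 < n l)%N) F l z.
  apply/funext => z; rewrite /elsym_defect scaled_elsym_incr//.
  rewrite [X in X + _ = _]addrAC subrr add0r addrC.
  rewrite mulN1r /F; under [in RHS]eq_bigr do rewrite mulrBr mulrC.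
  rewrite sumrB opprB; congr (_ - _).
  have [nk|nk] := posnP (n k).
    rewrite mul0r big1// => l nl; have := ee k l; rewrite /ip => ->.
    case: eqVneq => [kl'|_]; last by rewrite mul0r mulr0.
    by move: nl; rewrite -kl' nk.
  rewrite mul1r (bigD1 k)//= big1 ?addr0 => [|l /andP[nl lk]].
    by have := ee k k; rewrite /ip => ->; rewrite eqxx mul1r /scaled_elsym mulrC.
  by have := ee k l; rewrite /ip => ->; rewrite eq_sym (negPf lk) mul0r mulr0.
have FL l : (power_measure m N).-integrable setT (EFin \o F l).
  apply: l1Z; apply: l1B; first exact: (l1_site_mean N (decr n l) (kl l)).1.
  apply: l1Z; exact: sqint_integrable (sqint_elsym eL N _).
have sFL : (power_measure m N).-integrable setT
    (EFin \o (fun z => \sum_(l | (0 < n l)%N) F l z)) by apply: l1_sum.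
rewrite E; split; first exact: l1Z.
rewrite nrm1Z// normrN1 mul1r; apply: (le_trans (nrm1_sum _ _)) => //.
apply: (@le_trans _ _ (\sum_(l : I) eps / J)).
  rewrite big_mkcond; apply: ler_sum => l _; case: ifP => nl; last first.
    by rewrite divr_ge0 ?ltW.
  have rp : 0 < rt N ^+ deg (decr n l) by rewrite exprn_gt0 ?rt_gt0.
  rewrite nrm1Z; last first.
    apply: l1B; first exact: (l1_site_mean N (decr n l) (kl l)).1.
    apply: l1Z; exact: sqint_integrable (sqint_elsym eL N _).
  rewrite ger0_norm; last by rewrite invr_ge0 ltW.
  rewrite ler_pdivrMl// mulrC; apply: HN0.
  by apply: leq_trans (ltnW NN); exact: leq_bigmax.
rewrite sumr_const -[_ *+ _]mulr_natr -mulrA ler_piMr//; first exact: ltW.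
by rewrite mulrC ler_pdivrMr// mul1r ler_nat leqnSn.
Qed.

End elementary_sums_asymptotics.

(** * Hermite limits in probability *)

Section measure_cover.
Context d (T : measurableType d) (R : realType) (P : probability T R).

Lemma measure_cover (A B C : set T) (b c : R) :
  measurable A -> measurable B -> measurable C -> A `<=` B `|` C ->
  (P B <= b%:E)%E -> (P C <= c%:E)%E -> (P A <= (b + c)%:E)%E.
Proof.
move=> mA mB mC ABC Pb Pc; apply: (@le_trans _ _ (P (B `|` C))).
  by apply: le_measure => //; rewrite mem_set//; exact: measurableU.
by rewrite EFinD; apply: le_trans (measureU2 _ _ _) _ => //; exact: leeD.
Qed.

Lemma measurable_norm_ge (f : T -> R) eps : measurable_fun setT f ->
  measurable [set x | eps <= `|f x|].
Proof.
move=> mf; rewrite -[X in measurable X]setTI; apply: measurable_fun_le => //.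
exact: measurableT_comp.
Qed.

End measure_cover.

Section convergence_in_probability.
Context d (T : measurableType d) (R : realType) (m : probability T R).
Implicit Types F G : forall N, N.-tuple T -> R.

Definition measurable_seq F := forall N, measurable_fun setT (F N).

Definition cvP0 F := forall eps delta : R, 0 < eps -> 0 < delta ->
  exists N0, forall N, (N0 <= N)%N ->
  (power_measure m N [set z | (eps <= `|F N z|)%R] <= delta%:E)%E.

Definition tight F := forall delta : R, 0 < delta -> exists2 B : R, 0 < B &
  forall N, (power_measure m N [set z | (B <= `|F N z|)%R] <= delta%:E)%E.

Lemma cvP0D F G : measurable_seq F -> measurable_seq G -> cvP0 F -> cvP0 G ->
  cvP0 (fun N z => F N z + G N z).
Proof.
move=> mF mG cF cG eps delta e0 d0.
have e2 : 0 < eps / 2 by rewrite divr_gt0.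
have d2 : 0 < delta / 2 by rewrite divr_gt0.
have [N1 H1] := cF _ _ e2 d2; have [N2 H2] := cG _ _ e2 d2.
exists (maxn N1 N2) => N; rewrite geq_max => /andP[/H1 h1 /H2 h2].
rewrite (splitr delta); apply: measure_cover h1 h2.
- by apply: measurable_norm_ge; exact: (measurable_funD (mF N) (mG N)).
- exact: (measurable_norm_ge _ (mF N)).
- exact: (measurable_norm_ge _ (mG N)).
- move=> z /= H; have := le_trans H (ler_normD _ _).
  have [hF|hF] := leP (eps / 2) `|F N z|; first by left.
  have [hG|hG] := leP (eps / 2) `|G N z|; first by right.
  lra.
Qed.

Lemma cvP0M F G : measurable_seq F -> measurable_seq G -> tight F -> cvP0 G ->
  cvP0 (fun N z => F N z * G N z).
Proof.
move=> mF mG tF cG eps delta e0 d0.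
have d2 : 0 < delta / 2 by rewrite divr_gt0.
have [B B0 H1] := tF _ d2.
have [N2 H2] := cG _ _ (divr_gt0 e0 B0) d2.
exists N2 => N /H2 h2.
rewrite (splitr delta); apply: measure_cover (H1 N) h2.
- by apply: measurable_norm_ge; exact: (measurable_funM (mF N) (mG N)).
- exact: (measurable_norm_ge _ (mF N)).
- exact: (measurable_norm_ge _ (mG N)).
- move=> z /= H.
  have [hF|hF] := leP B `|F N z|; first by left.
  right; rewrite /= ler_pdivrMr//; apply: (le_trans H).
  by rewrite normrM mulrC ler_wpM2l// ltW.
Qed.

Lemma tight_cst c : tight (fun N z => c).
Proof.
move=> delta d0; exists (`|c| + 1) => [|N]; first by rewrite ltr_wpDl.
have -> : [set z : N.-tuple T | (`|c| + 1 <= `|c|)%R] = set0.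
  by apply/seteqP; split => z //=; rewrite gerDl ler10.
by rewrite measure0 lee_fin ltW.
Qed.

Lemma tightD F G : measurable_seq F -> measurable_seq G -> tight F -> tight G ->
  tight (fun N z => F N z + G N z).
Proof.
move=> mF mG tF tG delta d0.
have d2 : 0 < delta / 2 by rewrite divr_gt0.
have [B B0 H1] := tF _ d2; have [C C0 H2] := tG _ d2.
exists (B + C) => [|N]; first exact: addr_gt0.
rewrite (splitr delta); apply: measure_cover (H1 N) (H2 N).
- by apply: measurable_norm_ge; exact: (measurable_funD (mF N) (mG N)).
- exact: (measurable_norm_ge _ (mF N)).
- exact: (measurable_norm_ge _ (mG N)).
- move=> z /= H; have := le_trans H (ler_normD _ _).
  have [hF|hF] := leP B `|F N z|; first by left.
  have [hG|hG] := leP C `|G N z|; first by right.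
  lra.
Qed.

Lemma tightM F G : measurable_seq F -> measurable_seq G -> tight F -> tight G ->
  tight (fun N z => F N z * G N z).
Proof.
move=> mF mG tF tG delta d0.
have d2 : 0 < delta / 2 by rewrite divr_gt0.
have [B B0 H1] := tF _ d2; have [C C0 H2] := tG _ d2.
exists (B * C) => [|N]; first exact: mulr_gt0.
rewrite (splitr delta); apply: measure_cover (H1 N) (H2 N).
- by apply: measurable_norm_ge; exact: (measurable_funM (mF N) (mG N)).
- exact: (measurable_norm_ge _ (mF N)).
- exact: (measurable_norm_ge _ (mG N)).
- move=> z /= H.
  have [hF|hF] := leP B `|F N z|; first by left.
  have [hG|hG] := leP C `|G N z|; first by right.
  have : `|F N z * G N z| < B * C by rewrite normrM ltr_pM.
  by rewrite ltNge H.
Qed.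

Lemma cvP0Z c F : measurable_seq F -> cvP0 F -> cvP0 (fun N z => c * F N z).
Proof. by move=> mF; apply: cvP0M => //; exact: tight_cst. Qed.

Lemma cvP0_eq F G : (forall N, (0 < N)%N -> F N =1 G N) -> cvP0 F -> cvP0 G.
Proof.
move=> FG cF eps delta e0 d0; have [N0 H] := cF eps delta e0 d0.
exists (maxn N0 1) => N; rewrite geq_max => /andP[/H h N1].
by congr (_ <= _)%E : h; congr (power_measure m N _); apply/seteqP; split => z /=; rewrite FG.
Qed.

Lemma cvP0_nrm1 F :
  (forall eps, 0 < eps -> exists N0, forall N, (N0 <= N)%N ->
    (power_measure m N).-integrable setT (EFin \o F N) /\
    nrm1 (power_measure m N) (F N) <= eps) ->
  cvP0 F.
Proof.
move=> cF eps delta e0 d0; have [N0 H] := cF _ (mulr_gt0 e0 d0).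
exists N0 => N /H[iF nF].
apply: (le_trans (markov_nrm1 e0 iF)).
by rewrite lee_fin ler_pdivrMr// mulrC.
Qed.

Lemma tight_sqint F C : (forall N, sqint (power_measure m N) (F N)) ->
  (forall N, ip (power_measure m N) (F N) (F N) <= C) -> tight F.
Proof.
move=> FL FC delta d0.
have C0 : 0 <= Num.sqrt C by exact: sqrtr_ge0.
have B0 : 0 < (Num.sqrt C + 1) / delta by rewrite divr_gt0// ltr_wpDl.
exists ((Num.sqrt C + 1) / delta) => // N.
apply: (le_trans (markov_nrm1 B0 (sqint_integrable (FL N)))).
rewrite lee_fin ler_pdivrMr// mulrC divfK ?gt_eqF//.
apply: (le_trans (nrm1_sqint (FL N))).
apply: (@le_trans _ _ (Num.sqrt C)); last by rewrite lerDl.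
by rewrite ler_wsqrtr.
Qed.

End convergence_in_probability.

Section hermite.
Variable R : realType.

(* Computes H_n(u) and H_(n+1)(u) at once. *)
Fixpoint herm2 (n : nat) (u : R) : R * R :=
  match n with
  | 0 => (1, u)
  | n.+1 => let: (a, b) := herm2 n u in (b, u * b - n.+1%:R * a)
  end.

Definition herm n u := (herm2 n u).1.

Lemma herm0 u : herm 0 u = 1. Proof. by []. Qed.

Lemma herm1 u : herm 1 u = u. Proof. by []. Qed.

Lemma hermS n u : herm n.+2 u = u * herm n.+1 u - n.+1%:R * herm n u.
Proof. by rewrite /herm /=; case: (herm2 n u). Qed.

Definition qherm n u := herm n u / n`!%:R.

Lemma qherm_rec n u : n.+1%:R * qherm n.+1 u =
  u * qherm n u - (0 < n)%N%:R * qherm n.-1 u.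
Proof.
have f0 k : k`!%:R != 0 :> R by rewrite pnatr_eq0 -lt0n fact_gt0.
have s0 k : k.+1%:R != 0 :> R by rewrite pnatr_eq0.
case: n => [|n]; first by rewrite mul0r subr0 /qherm factS fact0 herm0 herm1; field.
rewrite /qherm hermS !factS !natrM mul1r/=.
move: (s0 n) (s0 n.+1) (f0 n).
move: (n.+1%:R) (n.+2%:R) (n`!%:R) (herm n u) (herm n.+1 u) => a b c h0 h1 a0 b0 c0.
by field; rewrite a0 b0 c0.
Qed.

Lemma measurable_qherm n : measurable_fun setT (qherm n).
Proof.
apply: measurable_funM => //.
have [n1 n2] : measurable_fun setT (herm n) /\ measurable_fun setT (herm n.+1).
  elim: n => [|n [IH1 IH2]]; first by split; [exact: measurable_cst|exact: measurable_id].
  split=> //; rewrite (_ : herm _ = fun u => u * herm n.+1 u - n.+1%:R * herm n u).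
    apply: measurable_funB; apply: measurable_funM => //.
  by apply/funext => u; rewrite hermS.
exact: n1.
Qed.

End hermite.

Section elsym_limit.
Context d (T : measurableType d) (R : realType) (m : probability T R).
Variables (I : finType) (e : I -> T -> R).
Hypothesis eL : forall i, sqint m (e i).
Hypothesis ee : forall i j, ip m (e i) (e j) = (i == j)%:R.
Hypothesis e1 : forall i, ip m (e i) (fun=> 1) = 0.

Lemma sqint_fluct N k : sqint (power_measure m N) (@fluct _ _ _ _ e N k).
Proof.
rewrite (_ : fluct _ k = fun z => (rt R N)^-1 * \sum_i site (e k) i z).
  by apply: sqintZ; apply: sqint_sum => i _; exact: sqint_site.
by apply/funext => z; rewrite mulrC.
Qed.

Lemma measurable_fluct k : measurable_seq (fun N => @fluct _ _ _ _ e N k).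
Proof. by move=> N; exact: sqint_measurable (sqint_fluct N k). Qed.

Lemma measurable_scaled_elsym n :
  measurable_seq (fun N => @scaled_elsym _ _ _ _ e N n).
Proof.
move=> N; apply: measurable_funM => //.
exact: sqint_measurable (sqint_elsym eL N n).
Qed.

Lemma ip_fluct N k : ip (power_measure m N) (@fluct _ _ _ _ e N k) (@fluct _ _ _ _ e N k) <= 1.
Proof.
have [N0|N0] := posnP N.
  rewrite (_ : fluct _ k = fun=> 0).
    rewrite [leLHS](_ : _ = 0) ?ler01// /ip.
    by under eq_Rintegral do rewrite mulr0; rewrite Rintegral_probability_cst.
  have r0 : rt R N = 0 by rewrite /rt N0 sqrtr0.
  by apply/funext => z; rewrite /fluct r0 invr0 mulr0.
have r0 : rt R N != 0 by rewrite gt_eqF// rt_gt0.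
rewrite (_ : fluct _ k = fun z => rt R N * (N%:R^-1 * \sum_i site (e k) i z)).
  have ml := sqint_mean N (eL k).
  rewrite ipZl//; last exact: sqintZ.
  rewrite ipZr// ip_mean// ee eqxx mulrA -expr2 rt_sqr div1r mulfV//.
  by rewrite pnatr_eq0 -lt0n.
apply/funext => z; rewrite /fluct -(rt_sqr R N) expr2.
by field.
Qed.

Lemma tight_fluct k : tight m (fun N => @fluct _ _ _ _ e N k).
Proof.
by apply: (@tight_sqint _ _ _ _ _ 1) => N; [exact: sqint_fluct|exact: ip_fluct].
Qed.

Definition hermite_limit (n : I -> nat) N (z : N.-tuple T) : R :=
  \prod_k qherm (n k) (fluct e k z).

Lemma measurable_hermite_limit n : measurable_seq (hermite_limit n).
Proof.
move=> N; apply: measurable_prod => k _.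
by apply: measurableT_comp; [exact: measurable_qherm|exact: measurable_fluct].
Qed.

Lemma hermite_limit_incr n k N (z : N.-tuple T) :
  (n k).+1%:R * hermite_limit (incr n k) z =
  fluct e k z * hermite_limit n z - (0 < n k)%N%:R * hermite_limit (decr n k) z.
Proof.
rewrite /hermite_limit (bigD1 k)//= [in X in _ = X - _](bigD1 k)//=.
rewrite [in X in _ = _ - X](bigD1 k)//=.
have -> : incr n k k = (n k).+1 by rewrite /incr eqxx addn1.
have -> : decr n k k = (n k).-1 by rewrite /decr eqxx subn1.
rewrite (eq_bigr (fun j => qherm (n j) (fluct e j z))); last first.
  by move=> j /negPf jk; rewrite /incr jk addn0.
rewrite [in X in _ = _ - X](eq_bigr (fun j => qherm (n j) (fluct e j z))); last first.
  by move=> j /negPf jk; rewrite /decr jk subn0.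
by rewrite mulrA qherm_rec; ring.
Qed.

(** Both sequences satisfy the same recurrence up to [elsym_defect]. So, up to constants, their
    difference at [incr n k] is the defect plus the differences at n and [decr n k], the former
    multiplied by the tight [fluct]. *)
Lemma scaled_elsym_cvg n :
  cvP0 m (fun N z => scaled_elsym e n z - hermite_limit n z).
Proof.
have mF n' : measurable_seq (fun N z => @scaled_elsym _ _ _ _ e N n' z - hermite_limit n' z).
  move=> N; apply: measurable_funB; first exact: measurable_scaled_elsym.
  exact: measurable_hermite_limit.
elim/multi_index_ind: n => [n n0|n k IH].
  move=> eps delta e0 d0; exists 0%N => N _.
  have -> : [set z : N.-tuple T | (eps <= `|scaled_elsym e n z - hermite_limit n z|)%R] = set0.
    apply/seteqP; split => z //=.
    rewrite /scaled_elsym n0 expr0 divr1 /elsym.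
    under eq_bigl do rewrite hastype0//.
    rewrite big_pred1_eq /emono /pf big1 => [|i _]; last by rewrite ffunE.
    rewrite /hermite_limit big1 => [|k _]; last first.
      by rewrite deg_eq0// /qherm fact0 herm0 divr1.
    by rewrite subrr normr0 leNgt e0.
  by rewrite measure0 lee_fin ltW.
have c0 : (n k).+1%:R != 0 :> R by rewrite pnatr_eq0.
pose D N (z : N.-tuple T) := elsym_defect e n k z.
have mD : measurable_seq D.
  move=> N; apply: measurable_funD.
    apply: measurable_funB; apply: measurable_funM => //.
    - exact: measurable_scaled_elsym.
    - exact: measurable_fluct.
    - exact: measurable_scaled_elsym.
  by apply: measurable_funM => //; exact: measurable_scaled_elsym.
have cD : cvP0 m D.
  by apply: cvP0_nrm1 => eps e0; exact: elsym_defect_cvg.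
pose G n' N (z : N.-tuple T) := scaled_elsym e n' z - hermite_limit n' z.
apply: (@cvP0_eq _ _ _ _ (fun N z => (n k).+1%:R^-1 *
   ((D N z + fluct e k z * G n N z) + - (0 < n k)%N%:R * G (decr n k) N z))).
  move=> N _ z; rewrite /D /G /elsym_defect.
  have := hermite_limit_incr n k z.
  set x := hermite_limit (incr n k) z => H.
  by rewrite -[X in _ = _ - X](mulKf c0) H; field.
have m1 : measurable_seq (fun N (z : N.-tuple T) => fluct e k z * G n N z).
  by move=> N; apply: measurable_funM; [exact: measurable_fluct|exact: mF].
have m2 : measurable_seq (fun N (z : N.-tuple T) => - (0 < n k)%N%:R * G (decr n k) N z).
  by move=> N; apply: measurable_funM => //; exact: mF.
apply: cvP0Z.
  by move=> N; apply: measurable_funD (m2 N); exact: (measurable_funD (mD N) (m1 N)).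
apply: cvP0D => //.
- by move=> N; exact: (measurable_funD (mD N) (m1 N)).
- apply: cvP0D => //; apply: cvP0M.
  + exact: measurable_fluct.
  + exact: mF.
  + exact: tight_fluct.
  + exact: IH.
- apply: cvP0Z; first exact: mF.
  (* For [n k = 0] truncated subtraction makes [decr n k] equal to n, and the induction hypothesis
     applies directly. *)
  have [nk|nk] := posnP (n k); last by apply: IH; rewrite -(deg_decr nk).
  rewrite (_ : decr n k = n); first exact: IH.
  apply/funext => j; rewrite /decr; case: eqVneq => [->|_]; last by rewrite subn0.
  by rewrite nk.
Qed.

End elsym_limit.

(** * Mehler's formula *)

Section subexponential.
Variable R : realType.
Implicit Types c : nat -> R.

(** Radius of convergence at least 1, in a form visibly stable under products, shifts and termwise
    differentiation. *)
Definition subexp c := forall r : R, 1 < r ->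
  exists2 C : R, 0 <= C & forall n, `|c n| <= C * r ^+ n.

Lemma subexpM c c' : subexp c -> subexp c' -> subexp (fun n => c n * c' n).
Proof.
move=> sc sc' r r1.
have r0 : 0 <= r by rewrite ltW// (lt_trans _ r1).
have s1 : 1 < Num.sqrt r by rewrite -sqrtr1 ltr_sqrt// (lt_trans _ r1).
have [C C0 HC] := sc _ s1; have [D D0 HD] := sc' _ s1.
exists (C * D) => [|n]; first exact: mulr_ge0.
rewrite normrM -(sqr_sqrtr r0) exprAC expr2 mulrACA.
by rewrite ler_pM.
Qed.

Lemma subexpS c : subexp c -> subexp (fun n => c n.+1).
Proof.
move=> sc r r1; have r0 : 0 <= r by rewrite ltW// (lt_trans _ r1).
have [C C0 HC] := sc _ r1; exists (C * r) => [|n]; first exact: mulr_ge0.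
by rewrite -mulrA -exprS.
Qed.

Lemma subexp_le c c' : (forall n, `|c n| <= `|c' n|) -> subexp c' -> subexp c.
Proof.
move=> cc' sc' r r1; have [C C0 HC] := sc' _ r1; exists C => // n.
exact: le_trans (cc' n) (HC n).
Qed.

Lemma subexp_natS : subexp (fun n => n.+1%:R).
Proof.
move=> r r1; have d0 : 0 < r - 1 by rewrite subr_gt0.
exists (1 + (r - 1)^-1) => [|n]; first by rewrite addr_ge0// invr_ge0 ltW.
rewrite ger0_norm//.
(* Bernoulli's inequality. *)
have B : 1 + n%:R * (r - 1) <= r ^+ n.
  elim: n => [|n IH]; first by rewrite mul0r addr0 expr0.
  rewrite exprS; apply: (@le_trans _ _ (r * (1 + n%:R * (r - 1)))); last first.
    by rewrite ler_wpM2l// ltW// (lt_trans _ r1).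
  have n0 : 0 <= n%:R :> R by [].
  rewrite -natr1; have := mulr_ge0 n0 (sqr_ge0 (r - 1)); nra.
have rn1 : 1 <= r ^+ n by rewrite exprn_ege1// ltW.
have H : n%:R <= (r - 1)^-1 * r ^+ n.
  by rewrite ler_pdivlMl// mulrC; apply: le_trans B; rewrite lerDr.
by rewrite -natr1 mulrDl mul1r addrC lerD.
Qed.

Lemma subexp_cvg c x : subexp c -> `|x| < 1 -> cvgn (pseries c x).
Proof.
move=> sc x1.
(* With this r > 1 the ratio r |x| of the majorizing geometric series is still below 1. *)
pose r := 2 / (1 + `|x|).
have p0 : 0 < 1 + `|x| by rewrite ltr_wpDr.
have r1 : 1 < r by rewrite /r ltr_pdivlMr// mul1r; lra.
have [C C0 HC] := sc _ r1.
have r0 : 0 <= r by rewrite ltW// (lt_trans _ r1).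
apply: normed_cvg.
apply: (@series_le_cvg _ _ (geometric C (r * `|x|))) => [n //=|n|n|].
- by rewrite /= mulr_ge0// exprn_ge0// mulr_ge0.
- by rewrite /= normrM normrX exprMn mulrA ler_wpM2r// exprn_ge0.
- apply: is_cvg_geometric_series; rewrite ger0_norm ?mulr_ge0//.
  by rewrite /r mulrAC ltr_pdivrMr// mul1r; lra.
Qed.

Definition psum c x : R := limn (pseries c x).

Definition cshift c (n : nat) : R := if n is k.+1 then c k else 0.

Lemma subexp_cshift c : subexp c -> subexp (cshift c).
Proof.
move=> sc r r1; have [C C0 HC] := sc _ r1.
have r0 : 0 <= r by rewrite ltW// (lt_trans _ r1).
exists C => // -[|n] /=; first by rewrite normr0 mulr_ge0// exprn_ge0.
apply: (le_trans (HC n)); rewrite ler_wpM2l// exprS ler_peMl ?exprn_ge0//.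
exact: ltW.
Qed.

Lemma subexpD c c' : subexp c -> subexp c' -> subexp (fun n => c n + c' n).
Proof.
move=> sc sc' r r1; have [C C0 HC] := sc _ r1; have [D D0 HD] := sc' _ r1.
exists (C + D) => [|n]; first exact: addr_ge0.
by rewrite mulrDl (le_trans (ler_normD _ _))// lerD.
Qed.

Lemma subexpZ a c : subexp c -> subexp (fun n => a * c n).
Proof.
move=> sc r r1; have [C C0 HC] := sc _ r1.
exists (`|a| * C) => [|n]; first exact: mulr_ge0.
by rewrite normrM -mulrA ler_wpM2l.
Qed.

Lemma psumD c c' x : subexp c -> subexp c' -> `|x| < 1 ->
  psum (fun n => c n + c' n) x = psum c x + psum c' x.
Proof.
move=> sc sc' x1; apply: cvg_lim => //.
rewrite (_ : pseries _ x = fun n => pseries c x n + pseries c' x n).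
  by apply: cvgD; exact: subexp_cvg.
apply/funext => n; rewrite /pseries /series/= -big_split/=.
by apply: eq_bigr => i _; rewrite mulrDl.
Qed.

Lemma psumZ a c x : subexp c -> `|x| < 1 ->
  psum (fun n => a * c n) x = a * psum c x.
Proof.
move=> sc x1; apply: cvg_lim => //.
rewrite (_ : pseries _ x = fun n => a * pseries c x n).
  by apply: cvgMr; exact: subexp_cvg.
apply/funext => n; rewrite /pseries /series/= mulr_sumr/=.
by apply: eq_bigr => i _; rewrite mulrA.
Qed.

Lemma psum_cshift c x : subexp c -> `|x| < 1 -> psum (cshift c) x = x * psum c x.
Proof.
move=> sc x1; apply: cvg_lim => //; rewrite -cvg_shiftS/=.
rewrite (_ : (fun n => _) = fun n => x * pseries c x n).
  by apply: cvgMr; exact: subexp_cvg.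
apply/funext => n; rewrite /pseries /series/= big_nat_recl//= mul0r add0r.
by rewrite mulr_sumr; apply: eq_bigr => i _; rewrite exprS; ring.
Qed.

End subexponential.

Section mehler.
Variable R : realType.

(** Hermite polynomials of norm 1 for the Gaussian law. In this normalization the recurrence has
    multiplier u / sqrt(n + 2), which tends to 0, and that keeps the growth in n subexponential. *)
Definition nherm n (u : R) := herm n u / Num.sqrt n`!%:R.

Let sqf0 n : Num.sqrt n`!%:R != 0 :> R.
Proof. by rewrite gt_eqF// sqrtr_gt0 ltr0n fact_gt0. Qed.

Let sqn0 n : Num.sqrt n.+1%:R != 0 :> R.
Proof. by rewrite gt_eqF// sqrtr_gt0 ltr0n. Qed.

Lemma nherm_mul n u v : nherm n u * nherm n v = herm n u * herm n v / n`!%:R.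
Proof.
rewrite /nherm mulrACA -invfM -expr2 sqr_sqrtr//.
Qed.

Lemma nhermS n u : Num.sqrt n.+2%:R * nherm n.+2 u =
  u * nherm n.+1 u - Num.sqrt n.+1%:R * nherm n u.
Proof.
rewrite /nherm hermS !factS !natrM !sqrtrM//.
rewrite -[X in _ - X * _](_ : Num.sqrt n.+1%:R ^+ 2 = n.+1%:R); last by rewrite sqr_sqrtr.
move: (sqn0 n) (sqn0 n.+1) (sqf0 n).
move: (Num.sqrt n.+1%:R) (Num.sqrt n.+2%:R) (Num.sqrt n`!%:R) => a b c a0 b0 c0.
by field; rewrite a0 b0 c0.
Qed.

(** Eventually the recurrence gives |h_(n+2)| <= (r - 1/r) |h_(n+1)| + |h_n|, which reproduces a
    bound C r^n because (r - 1/r) r + 1 = r^2. The finitely many earlier indices only enlarge C.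
    Uniformity in u is kept for [mehler_uniform]. *)
Lemma nherm_bound B r : 0 <= B -> 1 < r -> exists2 C : R, 0 <= C &
  forall n u, `|u| <= B -> `|nherm n u| <= C * r ^+ n.
Proof.
move=> B0 r1; have r0 : 0 < r by rewrite (lt_trans _ r1).
have step n u : `|nherm n.+2 u| <= `|u| / Num.sqrt n.+2%:R * `|nherm n.+1 u| + `|nherm n u|.
  have s2 : 0 < Num.sqrt n.+2%:R :> R by rewrite sqrtr_gt0.
  rewrite -(ler_pM2l s2) -{1}(ger0_norm (ltW s2)) -normrM nhermS.
  apply: (le_trans (ler_normB _ _)); rewrite mulrDr !normrM; apply: lerD.
    rewrite le_eqVlt; apply/orP; left; apply/eqP; field; by rewrite gt_eqF.
  rewrite ger0_norm ?sqrtr_ge0// ler_wpM2r// ler_sqrt// ler_nat; exact: leqnSn.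
have crude n u : `|u| <= B -> `|nherm n u| <= (B + 1) ^+ n /\
    `|nherm n.+1 u| <= (B + 1) ^+ n.+1.
  move=> uB; elim: n => [|n [IH1 IH2]].
    rewrite /nherm herm0 herm1 factS fact0 muln1 sqrtr1 !divr1 normr1 expr0 expr1.
    by split => //; apply: (le_trans uB); rewrite lerDl.
  split=> //; apply: (le_trans (step n u)).
  have h1 : `|u| / Num.sqrt n.+2%:R <= B.
    rewrite ler_pdivrMr ?sqrtr_gt0//; apply: (le_trans uB).
    by rewrite ler_peMr// -[leLHS]sqrtr1 ler_sqrt// ler1n.
  apply: (@le_trans _ _ (B * (B + 1) ^+ n.+1 + (B + 1) ^+ n)).
    by apply: lerD => //; apply: ler_pM => //; rewrite divr_ge0// sqrtr_ge0.
  rewrite [leRHS]exprS mulrDl mul1r lerD2l exprS ler_peMl ?exprn_ge0 ?addr_ge0//.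
  by rewrite lerDr.
pose n1 := (Num.truncn ((B / (r - r^-1)) ^+ 2)).+1.
have d0 : 0 < r - r^-1 by rewrite subr_gt0 (lt_trans _ r1)// invf_lt1.
have big n u : `|u| <= B -> (n1 <= n)%N -> `|u| / Num.sqrt n.+2%:R <= r - r^-1.
  move=> uB n1n; rewrite ler_pdivrMr ?sqrtr_gt0//; apply: (le_trans uB).
  rewrite mulrC -ler_pdivrMr//; apply: (le_trans (ler_norm _)).
  rewrite -sqrtr_sqr ler_sqrt//; apply: ltW.
  apply: lt_le_trans (_ : _ < n1%:R) _; first exact: truncnS_gt.
  by rewrite ler_nat; apply: (leq_trans n1n); rewrite -addn2 leq_addr.
pose C := (B + 1) ^+ n1.+1.
have C1 : 1 <= C by rewrite /C exprn_ege1// lerDr.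
have C0 : 0 <= C by exact: le_trans C1.
have small n u : (n <= n1.+1)%N -> `|u| <= B -> `|nherm n u| <= C * r ^+ n.
  move=> nn uB; apply: (le_trans (crude n u uB).1).
  apply: (@le_trans _ _ C); first by rewrite /C ler_weXn2l// lerDr.
  by rewrite ler_peMr// exprn_ege1// ltW.
exists C => // n u uB.
suff : `|nherm n u| <= C * r ^+ n /\ `|nherm n.+1 u| <= C * r ^+ n.+1 by case.
elim: n => [|n [IH1 IH2]]; first by split; exact: small.
split=> //; have [nn|nn] := leqP n.+2 n1.+1; first exact: small.
apply: (le_trans (step n u)).
apply: (@le_trans _ _ ((r - r^-1) * (C * r ^+ n.+1) + C * r ^+ n)).
  apply: lerD => //; apply: ler_pM => //.
  by apply: big.
rewrite le_eqVlt; apply/orP; left; apply/eqP; rewrite !exprS.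
by field; rewrite gt_eqF.
Qed.

Lemma subexp_nherm u : subexp (nherm ^~ u).
Proof.
move=> r r1; have [C C0 HC] := nherm_bound (normr_ge0 u) r1.
by exists C => // n; exact: HC.
Qed.

Lemma subexp_sqrtS : subexp (fun n => Num.sqrt n.+1%:R : R).
Proof.
apply: subexp_le (@subexp_natS R) => n.
rewrite !ger0_norm ?sqrtr_ge0//.
rewrite -[leRHS]sqr_sqrtr// expr2 ler_peMr ?sqrtr_ge0//.
by rewrite -[leLHS]sqrtr1 ler_sqrt// ler1n.
Qed.

Variables u v : R.

Definition mehler_coef n := herm n u * herm n v / n`!%:R.
(** Companions of the Mehler coefficients with one or both indices raised. The three-term recurrence
    yields a closed linear system for their generating functions ([BE], [CE], [DE]), and the series
    of [cD] is the derivative of the Mehler series ([dE]). *)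
Let cB n := herm n.+1 u * herm n v / n`!%:R.
Let cC n := herm n u * herm n.+1 v / n`!%:R.
Let cD n := herm n.+1 u * herm n.+1 v / n`!%:R.

Lemma subexp_mehler_coef : subexp mehler_coef.
Proof.
apply: (@subexp_le _ _ (fun n => nherm n u * nherm n v)) => [n|].
  by rewrite nherm_mul.
by apply: subexpM; exact: subexp_nherm.
Qed.

Let hermE n w : herm n w = Num.sqrt n`!%:R * nherm n w.
Proof. by rewrite /nherm mulrC divfK. Qed.

Let f0 n : n`!%:R != 0 :> R.
Proof. by rewrite pnatr_eq0 -lt0n fact_gt0. Qed.

Let nS0 n : n.+1%:R != 0 :> R.
Proof. by rewrite pnatr_eq0. Qed.

Let hermSE n w : herm n.+1 w / Num.sqrt n`!%:R = Num.sqrt n.+1%:R * nherm n.+1 w.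
Proof. by rewrite hermE factS natrM sqrtrM//; field; exact: sqf0. Qed.

Let mixE n (x y : R) : x * y / n`!%:R =
  (x / Num.sqrt n`!%:R) * (y / Num.sqrt n`!%:R).
Proof. by rewrite mulrACA -invfM -expr2 sqr_sqrtr. Qed.

Let sB : subexp cB.
Proof.
apply: (@subexp_le _ _ (fun n => (Num.sqrt n.+1%:R * nherm n.+1 u) * nherm n v)) => [n|].
  by rewrite /cB mixE hermSE.
apply: subexpM; last exact: subexp_nherm.
apply: subexpM; first exact: subexp_sqrtS.
by apply: (@subexpS _ (nherm ^~ u)); exact: subexp_nherm.
Qed.

Let sC : subexp cC.
Proof.
apply: (@subexp_le _ _ (fun n => nherm n u * (Num.sqrt n.+1%:R * nherm n.+1 v))) => [n|].
  by rewrite /cC mixE hermSE.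
apply: subexpM; first exact: subexp_nherm.
apply: subexpM; first exact: subexp_sqrtS.
by apply: (@subexpS _ (nherm ^~ v)); exact: subexp_nherm.
Qed.

Let dE : pseries_diffs mehler_coef = cD.
Proof.
apply/funext => n; rewrite /pseries_diffs /mehler_coef /cD factS natrM.
by move: (f0 n) (nS0 n); move: (n.+1%:R) (n`!%:R) => a b a0 b0; field; rewrite a0 b0.
Qed.

Lemma subexp_diffs (c : nat -> R) : subexp c -> subexp (pseries_diffs c).
Proof.
by move=> sc; apply: subexpM; [exact: subexp_natS|exact: subexpS].
Qed.

Let sD : subexp cD.
Proof. by rewrite -dE; apply: subexp_diffs; exact: subexp_mehler_coef. Qed.

Let BE : cB = fun n => u * mehler_coef n + -1 * cshift cC n.
Proof.
apply/funext => -[|n]; rewrite /cB /mehler_coef /= /cC.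
  by rewrite !herm1 !herm0 fact0; field.
rewrite hermS factS natrM.
by move: (f0 n) (nS0 n); move: (n.+1%:R) (n`!%:R) => a b a0 b0; field; rewrite a0 b0.
Qed.

Let CE : cC = fun n => v * mehler_coef n + -1 * cshift cB n.
Proof.
apply/funext => -[|n]; rewrite /cC /mehler_coef /= /cB.
  by rewrite !herm1 !herm0 fact0; field.
rewrite hermS factS natrM.
by move: (f0 n) (nS0 n); move: (n.+1%:R) (n`!%:R) => a b a0 b0; field; rewrite a0 b0.
Qed.

Let DE : cD = fun n => u * cC n +
  (- v * cshift cC n + (cshift mehler_coef n + cshift (cshift cD) n)).
Proof.
apply/funext => -[|[|n]]; rewrite /cD /cC /mehler_coef /=.
- by rewrite !herm1 !herm0 fact0; field.
- by rewrite !hermS !herm1 !herm0 !factS fact0; field.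
- rewrite (hermS n.+1 u) (hermS n.+1 v) !factS !natrM.
  rewrite (hermS n v).
  move: (f0 n) (nS0 n) (nS0 n.+1); rewrite -(natr1 n.+1) -(natr1 n).
  move: (n%:R) (n`!%:R) (herm n u) (herm n v) (herm n.+1 u) (herm n.+1 v) => a b h0 k0 h1 k1 b0 a0 a1.
  by field; rewrite ?b0 ?a0 ?a1.
Qed.

(* Together with [is_derive_mehler_log], says that psum mehler_coef and
   expR \o mehler_log have the same logarithmic derivative. *)
Lemma mehler_ode x : `|x| < 1 ->
  (1 - x ^+ 2) ^+ 2 * psum (pseries_diffs mehler_coef) x =
  ((u - x * v) * (v - x * u) + x * (1 - x ^+ 2)) * psum mehler_coef x.
Proof.
move=> x1; rewrite dE.
have sA := subexp_mehler_coef.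
have hB : psum cB x = u * psum mehler_coef x - x * psum cC x.
  rewrite [in LHS]BE psumD//; [|exact: subexpZ|exact: subexpZ (subexp_cshift _)].
  by rewrite !psumZ ?psum_cshift// ?mulN1r//; exact: subexp_cshift.
have hC : psum cC x = v * psum mehler_coef x - x * psum cB x.
  rewrite [in LHS]CE psumD//; [|exact: subexpZ|exact: subexpZ (subexp_cshift _)].
  by rewrite !psumZ ?psum_cshift// ?mulN1r//; exact: subexp_cshift.
have hD : psum cD x = u * psum cC x + (- v * (x * psum cC x) +
    (x * psum mehler_coef x + x * (x * psum cD x))).
  have s1 := subexp_cshift sC; have s2 := subexp_cshift sA.
  have s3 := subexp_cshift sD; have s4 := subexp_cshift s3.
  have t1 := subexpZ (- v) s1; have t2 := subexpD s2 s4.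
  rewrite [in LHS]DE (psumD (subexpZ u sC) (subexpD t1 t2))// (psumD t1 t2)//.
  by rewrite (psumD s2 s4)// !psumZ// !psum_cshift.
have x2 : 1 - x ^+ 2 != 0.
  by rewrite subr_eq0 eq_sym -real_normK ?num_real// lt_eqF// expr_lt1.
set A := psum mehler_coef x in hB hC hD *.
move: hB hC hD; set b := psum cB x; set c := psum cC x; set D := psum cD x.
move=> hB hC hD.
(* Eliminating the series of [cB] expresses that of [cC] through A; then [hD] does the same for the
   derivative. *)
have hc : (1 - x ^+ 2) * c = (v - x * u) * A.
  by rewrite mulrBl mul1r {1}hC hB; ring.
have hd : (1 - x ^+ 2) * D = (u - x * v) * c + x * A.
  by rewrite mulrBl mul1r {1}hD; ring.
rewrite expr2 -mulrA hd mulrDr mulrCA hc; ring.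
Qed.

End mehler.

Section mehler_closed_form.
Variable R : realType.
Variables u v : R.

(** Logarithm of the Mehler kernel: the density of a standard bivariate Gaussian law with
    correlation s relative to the product of its marginals. *)
Definition mehler_log s : R :=
  - (ln (1 - s ^+ 2) / 2) +
  (2 * s * u * v - s ^+ 2 * (u ^+ 2 + v ^+ 2)) / (2 * (1 - s ^+ 2)).

Lemma is_derive_mehler_log (x : R) : `|x| < 1 -> is_derive x (1 : R) mehler_log
  (x / (1 - x ^+ 2) + (u - x * v) * (v - x * u) / (1 - x ^+ 2) ^+ 2).
Proof.
move=> x1.
have d0 : 0 < 1 - x ^+ 2.
  by rewrite subr_gt0 -real_normK ?num_real// expr_lt1.
have d0' : 1 - x ^+ 2 != 0 by rewrite gt_eqF.
have D1 : is_derive x (1 : R) (fun y : R => 1 - y ^+ 2) (- (2 * x)).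
  by apply: is_derive_eq; rewrite /GRing.scale /=; ring.
have D2 : is_derive x (1 : R) (fun y : R => ln (1 - y ^+ 2)) (- (2 * x) / (1 - x ^+ 2)).
  have Dl := is_derive1_ln d0.
  have Dc := @is_derive1_comp R (@ln R) (fun y : R => 1 - y ^+ 2) x _ _ Dl D1.
  by apply: (is_derive_eq Dc); rewrite mulrC.
have D3 : is_derive x (1 : R) (fun y : R => (1 - y ^+ 2)^-1)
    ((2 * x) / (1 - x ^+ 2) ^+ 2).
  have Dv := @is_deriveV R (fun y : R => 1 - y ^+ 2) x _ _ d0' D1.
  by apply: (is_derive_eq Dv); rewrite /GRing.scale /=; field.
have D4 : is_derive x (1 : R) (fun y : R => 2 * y * u * v - y ^+ 2 * (u ^+ 2 + v ^+ 2))
    (2 * u * v - 2 * x * (u ^+ 2 + v ^+ 2)).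
  by apply: is_derive_eq; rewrite /GRing.scale /=; ring.
have D5 : is_derive x (1 : R) (fun y : R =>
    - (ln (1 - y ^+ 2) * 2^-1) +
    ((2 * y * u * v - y ^+ 2 * (u ^+ 2 + v ^+ 2)) * (2^-1 * (1 - y ^+ 2)^-1)))
  (x / (1 - x ^+ 2) + (u - x * v) * (v - x * u) / (1 - x ^+ 2) ^+ 2).
  apply: is_derive_eq; rewrite /GRing.scale /=.
  by field.
rewrite (_ : mehler_log = fun y : R => - (ln (1 - y ^+ 2) * 2^-1) +
    ((2 * y * u * v - y ^+ 2 * (u ^+ 2 + v ^+ 2)) * (2^-1 * (1 - y ^+ 2)^-1)))//.
by apply/funext => y; rewrite /mehler_log invfM.
Qed.

(** The quotient of the two sides has derivative 0 on |x| < 1 by [mehler_ode], and value 1 at 0. *)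
Lemma mehler_formula s : 0 <= s < 1 ->
  psum (mehler_coef u v) s = expR (mehler_log s).
Proof.
move=> /andP[s0 s1].
have sA := subexp_mehler_coef u v.
pose G (x : R) := psum (mehler_coef u v) x * expR (- mehler_log x).
have DG (x : R) : `|x| < 1 -> is_derive x (1 : R) G 0.
  move=> x1.
  have [K xK K1] : exists2 K : R, `|x| < K & K < 1.
    by exists ((`|x| + 1) / 2); lra.
  have K0 : 0 <= K by rewrite (le_trans _ (ltW xK)).
  have nK : `|K| < 1 by rewrite ger0_norm.
  have sd := subexp_diffs sA.
  have DA : is_derive x (1 : R) (psum (mehler_coef u v))
      (psum (pseries_diffs (mehler_coef u v)) x).
    apply: (@pseries_snd_diffs _ _ K); try exact: subexp_cvg.
    - by apply: subexp_cvg => //; exact: subexp_diffs.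
    - by rewrite (ger0_norm K0).
  have DL := is_derive_mehler_log x1.
  have DN : is_derive x (1 : R) (fun y => - mehler_log y) (- (x / (1 - x ^+ 2) +
      (u - x * v) * (v - x * u) / (1 - x ^+ 2) ^+ 2)).
    exact: is_deriveN.
  have DE := @is_derive1_comp R (@expR R) _ x _ _ (is_derive_expR _) DN.
  have DM := @is_deriveM _ _ _ _ _ _ _ _ DA DE.
  apply: (is_derive_eq DM); rewrite /GRing.scale /=.
  have ode := mehler_ode u v x1.
  have d0 : 1 - x ^+ 2 != 0.
    by rewrite gt_eqF// subr_gt0 -real_normK ?num_real// expr_lt1.
  have -> : psum (pseries_diffs (mehler_coef u v)) x =
      ((u - x * v) * (v - x * u) + x * (1 - x ^+ 2)) * psum (mehler_coef u v) x
      / (1 - x ^+ 2) ^+ 2.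
    by rewrite -ode; field.
  by field.
have in1 x : x \in `[0, s] -> `|x| < 1.
  by rewrite in_itv/= => /andP[x0 xs]; rewrite ger0_norm// (le_lt_trans xs).
have G0 : G 0 = 1.
  rewrite /G /mehler_log expr0n/= subr0 ln1 !(mul0r, mulr0, oppr0, addr0, subr0, expR0, mulr1).
  rewrite /psum; apply: cvg_lim => //; rewrite -cvg_shiftS/=.
  apply: cvg_near_cst; near=> n; rewrite /pseries /series/= big_nat_recl//=.
  rewrite expr0 mulr1 big1 ?addr0 => [|i _]; last by rewrite exprS mul0r mulr0.
  by rewrite /mehler_coef !herm0 fact0 mulr1 divr1.
have [||c _] := @MVT_segment R G (fun=> 0) 0 s s0.
- move=> x; rewrite in_itv/= => /andP[x0 xs]; apply: DG; apply: in1.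
  by rewrite in_itv/= !ltW.
- apply: derivable_within_continuous => x xs.
  by have [] := DG x (in1 x xs).
rewrite mul0r => /eqP; rewrite subr_eq0 G0 /G expRN => /eqP H.
by apply: (mulIf (lt0r_neq0 (expR_gt0 (- mehler_log s)))); rewrite expRN H mulfV ?lt0r_neq0 ?expR_gt0.
Unshelve. all: by end_near. Qed.

End mehler_closed_form.

Section mehler_uniform.
Variable R : realType.

(** A common geometric majorant C^2 t^n, with one C and t for all u and v in the box, bounds all
    tails at once. *)
Lemma mehler_uniform (s B delta : R) : 0 <= s < 1 -> 0 <= B -> 0 < delta ->
  exists m0, forall m, (m0 <= m)%N -> forall u v, `|u| <= B -> `|v| <= B ->
  `|\sum_(n < m) s ^+ n * mehler_coef u v n - expR (mehler_log u v s)| <= delta.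
Proof.
move=> s01 B0 d0; have /andP[s0 s1] := s01.
(* q replaces s in order to be positive even for s = 0, since r divides by it; r is then chosen so
   that r^2 q = (1 + q) / 2 < 1. *)
pose q := (1 + s) / 2.
have q0 : 0 < q by rewrite /q; lra.
have q1 : q < 1 by rewrite /q; lra.
have sq : s < q by rewrite /q; lra.
pose r := Num.sqrt (q^-1 * ((1 + q) / 2)).
have rr : 1 < q^-1 * ((1 + q) / 2).
  by rewrite mulrC ltr_pdivlMr// mul1r; lra.
have r1 : 1 < r by rewrite -sqrtr1 ltr_sqrt// (lt_trans _ rr).
have [C C0 HC] := nherm_bound B0 r1.
pose t := (1 + q) / 2.
have t1 : t < 1 by rewrite /t; lra.
have t0 : 0 < t by rewrite /t; lra.
have term n u v : `|u| <= B -> `|v| <= B ->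
    `|mehler_coef u v n * s ^+ n| <= C ^+ 2 * t ^+ n.
  move=> uB vB; rewrite /mehler_coef -nherm_mul normrM (normrM (nherm n u)) normrX (ger0_norm s0).
  apply: (@le_trans _ _ ((C * r ^+ n) * (C * r ^+ n) * q ^+ n)).
    apply: ler_pM => //; first exact: exprn_ge0.
      by apply: ler_pM => //; exact: HC.
    by rewrite lerXn2r ?nnegrE// ltW.
  rewrite mulrACA -!expr2 -mulrA ler_wpM2l ?sqr_ge0//.
  rewrite exprAC /r sqr_sqrtr; last by rewrite ltW// (lt_trans _ rr).
  by rewrite -exprMn mulrAC mulVf ?gt_eqF// mul1r.
have tail m M u v : (m <= M)%N -> `|u| <= B -> `|v| <= B ->
    `|pseries (mehler_coef u v) s M - pseries (mehler_coef u v) s m| <=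
    C ^+ 2 * t ^+ m / (1 - t).
  move=> mM uB vB; rewrite sub_series_geq// (le_trans (ler_norm_sum _ _ _))//.
  apply: (@le_trans _ _ (\sum_(m <= k < M) C ^+ 2 * t ^+ k)).
    by apply: ler_sum => i _; exact: term.
  rewrite -mulr_sumr -mulrA ler_wpM2l ?sqr_ge0//.
  rewrite ler_pdivlMr ?subr_gt0//.
  rewrite mulr_suml (eq_bigr (fun k => - (t ^+ k.+1 - t ^+ k))); last first.
    by move=> k _; rewrite exprS; ring.
  by rewrite sumrN telescope_sumr// opprB gerBl exprn_ge0// ltW.
have [m0 Hm0] : exists m0, forall m, (m0 <= m)%N -> C ^+ 2 * t ^+ m / (1 - t) <= delta.
  have cv : (fun m => C ^+ 2 / (1 - t) * t ^+ m) @ \oo --> (C ^+ 2 / (1 - t) * 0 : R).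
    by apply: cvgMr; apply: cvg_expr; rewrite ger0_norm// ltW.
  have /cvgrPdist_le/(_ _ d0)[m0 _ H] := cv.
  exists m0 => m /H; rewrite mulr0 sub0r normrN => {}H.
  apply: le_trans H; apply: le_trans (ler_norm _).
  by rewrite mulrAC.
exists m0 => m m0m u v uB vB.
rewrite -mehler_formula// (_ : \sum_(n < m) _ = pseries (mehler_coef u v) s m); last first.
  by rewrite /pseries /series/= big_mkord; apply: eq_bigr => i _; rewrite mulrC.
apply: le_trans (Hm0 _ m0m).
have cv := subexp_cvg (subexp_mehler_coef u v) (_ : `|s| < 1).
have {}cv : cvgn (pseries (mehler_coef u v) s) by apply: cv; rewrite ger0_norm.
rewrite distrC ler_distl; apply/andP; split.
  apply: limr_ge => //; near=> M.
  have := tail m M u v _ uB vB; rewrite ler_distl => /(_ _)/andP[|//].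
  by near: M; exact: nbhs_infty_ge.
apply: limr_le => //; near=> M.
have := tail m M u v _ uB vB; rewrite ler_distl => /(_ _)/andP[|//].
by near: M; exact: nbhs_infty_ge.
Unshelve. all: by end_near. Qed.

End mehler_uniform.

(** * Lower tail of the partial sums *)

Section more_in_probability.
Context d (T : measurableType d) (R : realType) (m : probability T R).

Lemma cvP0_deterministic (x : nat -> R) : x @ \oo --> 0 ->
  cvP0 m (fun N z => x N).
Proof.
move=> /cvgrPdist_lt cx eps delta e0 d0; have [N0 _ H] := cx _ e0.
exists N0 => N /H; rewrite sub0r normrN => xe.
rewrite (_ : [set z : N.-tuple T | (eps <= `|x N|)%R] = set0); last first.
  by apply/seteqP; split => z //=; rewrite leNgt xe.
by rewrite measure0 lee_fin ltW.
Qed.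

Lemma tight_deterministic (x : nat -> R) C : (forall N, `|x N| <= C) ->
  tight m (fun N z => x N).
Proof.
move=> xC delta d0; exists (C + 1) => [|N].
  by rewrite ltr_wpDl// (le_trans (normr_ge0 _) (xC 0%N)).
rewrite (_ : [set z : N.-tuple T | (C + 1 <= `|x N|)%R] = set0); last first.
  apply/seteqP; split => z //=; have := xC N => h1 h2.
  by have := le_trans h2 h1; rewrite gerDl ler10.
by rewrite measure0 lee_fin ltW.
Qed.

Lemma cvP0_sum (J : Type) (r : seq J) (F : J -> forall N, N.-tuple T -> R) :
  (forall j, measurable_seq (F j)) -> (forall j, cvP0 m (F j)) ->
  cvP0 m (fun N z => \sum_(j <- r) F j N z).
Proof.
move=> mF cF; elim: r => [|j r IH].
  apply: (@cvP0_eq _ _ _ _ (fun N z => 0)); last first.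
    by apply: cvP0_deterministic; exact: cvg_cst.
  by move=> N _ z; rewrite big_nil.
apply: (@cvP0_eq _ _ _ _ (fun N z => F j N z + \sum_(j <- r) F j N z)).
  by move=> N _ z; rewrite big_cons.
apply: cvP0D => //.
by move=> N; apply: (@measurable_sum _ _ _ _ _ _ (fun j => F j N)) => k; exact: mF.
Qed.

Lemma tight_eq (F G : forall N, N.-tuple T -> R) : (forall N, F N =1 G N) ->
  tight m F -> tight m G.
Proof.
move=> FG tF delta /tF[B B0 H]; exists B => // N.
have := H N; congr (_ <= _)%E; congr (power_measure m N _).
by apply/seteqP; split => z /=; rewrite FG.
Qed.

Lemma tight_prod (J : eqType) (r : seq J) (F : J -> forall N, N.-tuple T -> R) :
  (forall j, measurable_seq (F j)) -> (forall j, tight m (F j)) ->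
  tight m (fun N z => \prod_(j <- r) F j N z).
Proof.
move=> mF tF; elim: r => [|j r IH].
  by apply: tight_eq (tight_cst m 1) => N z; rewrite big_nil.
apply: (@tight_eq (fun N z => F j N z * \prod_(j <- r) F j N z)).
  by move=> N z; rewrite big_cons.
apply: tightM => //.
by move=> N; apply: (@measurable_prod _ _ _ _ _ _ (fun j => F j N)) => k _; exact: mF.
Qed.

Lemma tight_qherm (F : forall N, N.-tuple T -> R) n : measurable_seq F ->
  tight m F -> tight m (fun N z => qherm n (F N z)).
Proof.
move=> mF tF.
have mh k : measurable_seq (fun N z => herm k (F N z)).
  move=> N; have := measurable_qherm (R := R) k.
  move=> mq; rewrite (_ : (fun z => _) = fun z => k`!%:R * qherm k (F N z)).
    by apply: measurable_funM => //; exact: (measurableT_comp mq (mF N)).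
  by apply/funext => z; rewrite /qherm mulrC divfK// pnatr_eq0 -lt0n fact_gt0.
have [th _] : tight m (fun N z => herm n (F N z)) /\
    tight m (fun N z => herm n.+1 (F N z)).
  elim: n => [|n [IH1 IH2]]; first by split => //; exact: tight_cst.
  split=> //.
  have t1 := tightM mF (mh n.+1) tF IH2.
  have mc c : measurable_seq (fun N (z : N.-tuple T) => c : R) by [].
  have t2 := tightM (mc (- n.+1%:R)) (mh n) (tight_cst m _) IH1.
  have m1 : measurable_seq (fun N z => F N z * herm n.+1 (F N z)).
    by move=> N; apply: measurable_funM; [exact: mF|exact: mh].
  have m2 : measurable_seq (fun N z => - n.+1%:R * herm n (F N z)).
    by move=> N; apply: measurable_funM => //; exact: mh.
  by apply: tight_eq (tightD m1 m2 t1 t2) => N z; rewrite hermS mulNr.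
have mc : measurable_seq (fun N (z : N.-tuple T) => n`!%:R^-1 : R) by [].
exact: (tightM (mh n) mc th (tight_cst m _)).
Qed.

End more_in_probability.

Section ffact_ratio.
Variable R : realType.

Lemma ffact_ratio_cvg n : (N ^_ n)%:R / N%:R ^+ n @[N --> \oo] --> (1 : R).
Proof.
elim: n => [|n IH].
  by apply: cvg_near_cst; apply: nearW => N; rewrite ffactn0 expr0 divr1.
have E : \forall N \near \oo, (N ^_ n)%:R / N%:R ^+ n * (1 - n%:R * N%:R^-1) =
    (N ^_ n.+1)%:R / N%:R ^+ n.+1 :> R.
  near=> N; rewrite ffactnSr natrM natrB; last by near: N; exact: nbhs_infty_ge.
  have N0 : N%:R != 0 :> R.
    by rewrite pnatr_eq0 -lt0n; near: N; exact: nbhs_infty_gt.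
  rewrite exprS; field; by rewrite N0 expf_neq0.
have cv : (N ^_ n)%:R / N%:R ^+ n * (1 - n%:R * N%:R^-1) @[N --> \oo] -->
    (1 * (1 - n%:R * 0) : R).
  apply: cvgM => //; apply: cvgB; first exact: cvg_cst.
  apply: cvgMr; rewrite -cvg_shiftS/=; exact: cvg_harmonic.
rewrite mulr0 subr0 mulr1 in cv.
by apply: cvg_trans cv; exact: near_eq_cvg.
Unshelve. all: by end_near. Qed.

End ffact_ratio.

Section coordinate_letters.
Context d (T : measurableType d) (R : realType) (P Q : probability T R).
Notation m := (P \x Q : probability (T * T)%type R)%E.

Lemma sqint_fst f : sqint P f -> sqint m (fun z => f z.1).
Proof.
move=> fL; have := sqint_tensor fL (sqint_cst Q 1).
by congr sqint; apply/funext => z; rewrite mulr1.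
Qed.

Lemma sqint_snd f : sqint Q f -> sqint m (fun z => f z.2).
Proof.
move=> fL; have := sqint_tensor (sqint_cst P 1) fL.
by congr sqint; apply/funext => z; rewrite mul1r.
Qed.

Lemma ip_fst f g : sqint P f -> sqint P g ->
  ip m (fun z => f z.1) (fun z => g z.1) = ip P f g.
Proof.
move=> fL gL.
have := ip_tensor fL (sqint_cst Q 1) gL (sqint_cst Q 1).
rewrite ip11 mulr1 => <-; congr ip; apply/funext => z; by rewrite mulr1.
Qed.

Lemma ip_snd f g : sqint Q f -> sqint Q g ->
  ip m (fun z => f z.2) (fun z => g z.2) = ip Q f g.
Proof.
move=> fL gL.
have := ip_tensor (sqint_cst P 1) fL (sqint_cst P 1) gL.
rewrite ip11 mul1r => <-; congr ip; apply/funext => z; by rewrite mul1r.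
Qed.

Variables (I : finType) (a b : I -> T -> R) (s : I -> R).
Hypothesis ab : orthonormal_letters P Q a b.

Local Notation mi n := (fun k => nat_of_ord (n k)).

(** Both families are read as functions of the pair, so that the one-family asymptotics under [m]
    apply to each and U_k, V_k live on the same space. *)
Definition fstl (i : I) (z : T * T) : R := a i z.1.
Definition sndl (i : I) (z : T * T) : R := b i z.2.

Lemma fstlL i : sqint m (fstl i).
Proof. by case: ab => aL _ _ _ _ _; exact: sqint_fst. Qed.
Lemma sndlL i : sqint m (sndl i).
Proof. by case: ab => _ bL _ _ _ _; exact: sqint_snd. Qed.
Lemma ip_fstl i j : ip m (fstl i) (fstl j) = (i == j)%:R.
Proof. by case: ab => aL _ aa _ _ _; rewrite ip_fst. Qed.
Lemma ip_sndl i j : ip m (sndl i) (sndl j) = (i == j)%:R.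
Proof. by case: ab => _ bL _ bb _ _; rewrite ip_snd. Qed.
Lemma ip_fstl1 i : ip m (fstl i) (fun=> 1) = 0.
Proof.
case: ab => aL _ _ _ a1 _; have := a1 i; rewrite -ip_fst//; exact: sqint_cst.
Qed.
Lemma ip_sndl1 i : ip m (sndl i) (fun=> 1) = 0.
Proof.
case: ab => _ bL _ _ _ b1; have := b1 i; rewrite -ip_snd//; exact: sqint_cst.
Qed.

Lemma monoE N (f g : {ffun 'I_N -> option I}) z :
  mono a b f g z = emono fstl f z * emono sndl g z.
Proof.
rewrite /mono /emono /pf -big_split/=; apply: eq_bigr => i _; rewrite /ten.
by case: (f i) (g i) => [k|] [l|].
Qed.

Lemma coefE N M (f g : {ffun 'I_N -> option I}) : coef s M f g =
  \sum_(n : {ffun I -> 'I_M.+1} | hastype (mi n) f && hastype (mi n) g)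
    (\prod_k s k ^+ n k) / (@nwords I N (mi n))%:R.
Proof.
rewrite /coef; case: ifPn => [/andP[/forallP bf fg]|H]; last first.
  rewrite big_pred0// => n; apply/negbTE; apply: contra H => /andP[/hastypeP nf /hastypeP ng].
  apply/andP; split; first by apply/forallP => k; rewrite nf -ltnS.
  by apply/same_occP => k; rewrite nf ng.
pose n0 : {ffun I -> 'I_M.+1} := [ffun k => inord (occ f (Some k))].
have n0E k : n0 k = occ f (Some k) :> nat by rewrite ffunE inordK// ltnS.
rewrite (big_pred1 n0) => [|n].
  congr (_ / _%:R).
    by rewrite word_weightE; apply: eq_bigr => k _; rewrite n0E.
  apply: eq_card => h; rewrite !inE; apply/same_occP/hastypeP => H k.
    by rewrite -H n0E.
  by rewrite H n0E.
apply/andP/eqP => [[/hastypeP nf _]|->].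
  by apply/ffunP => k; apply/val_inj; rewrite /= n0E nf.
split; apply/hastypeP => k; first by rewrite n0E.
by rewrite n0E; move/same_occP : fg => ->.
Qed.

Lemma chaosE N M (z : N.-tuple (T * T)) : chaos a b s M z =
  \sum_(n : {ffun I -> 'I_M.+1}) (\prod_k s k ^+ n k) / (@nwords I N (mi n))%:R *
    (elsym fstl (mi n) z * elsym sndl (mi n) z).
Proof.
rewrite /chaos /comb.
under eq_bigr do under eq_bigr do rewrite coefE mulr_suml big_mkcond/=.
under eq_bigr do rewrite exchange_big/=.
rewrite exchange_big/=; apply: eq_bigr => n _.
rewrite /elsym big_distrlr/= mulr_sumr big_mkcond [RHS]big_mkcond/=.
apply: eq_bigr => f _.
case: ifPn => nf /=; last by rewrite big1// => g _; rewrite (negPf nf).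
rewrite mulr_sumr [RHS]big_mkcond/=; apply: eq_bigr => g _.
by case: ifP => // _; rewrite monoE.
Qed.

(** What [chaos] approaches. Replacing E_n by Hermite products in the expansion ([mehler_productE])
    makes it factor over the letters into truncated Mehler series. *)
Definition mehler_product M N (z : N.-tuple (T * T)) : R :=
  \prod_k \sum_(j < M.+1) s k ^+ j * mehler_coef (fluct fstl k z) (fluct sndl k z) j.

Lemma mehler_productE M N (z : N.-tuple (T * T)) : mehler_product M z =
  \sum_(n : {ffun I -> 'I_M.+1}) (\prod_k s k ^+ n k) * (\prod_k (n k)`!)%:R *
    (hermite_limit fstl (mi n) z * hermite_limit sndl (mi n) z).
Proof.
rewrite /mehler_product bigA_distr_bigA/=; apply: eq_bigr => n _.
rewrite /hermite_limit natr_prod -!big_split/=; apply: eq_bigr => k _.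
rewrite /mehler_coef /qherm; field.
by rewrite pnatr_eq0 -lt0n fact_gt0.
Qed.

Lemma measurable_chaos M : measurable_seq (fun N => @chaos _ T R N _ a b s M).
Proof.
by move=> N; apply: (sqint_measurable (m := power_measure m N));
  case: ab => aL bL _ _ _ _; exact: sqint_chaos.
Qed.

Lemma tight_scaled_elsym (e : I -> T * T -> R) n : (forall i, sqint m (e i)) ->
  (forall i j, ip m (e i) (e j) = (i == j)%:R) ->
  (forall i, ip m (e i) (fun=> 1) = 0) ->
  tight m (fun N => @scaled_elsym _ _ _ _ e N n).
Proof.
move=> eL ee e1; apply: (@tight_sqint _ _ _ _ _ 1) => N.
  rewrite (_ : scaled_elsym _ n = fun z => (rt R N ^+ deg n)^-1 * elsym e n z).
    by apply: sqintZ; exact: sqint_elsym.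
  by apply/funext => z; rewrite mulrC.
rewrite (_ : scaled_elsym _ n = fun z => (rt R N ^+ deg n)^-1 * elsym e n z); last first.
  by apply/funext => z; rewrite mulrC.
have sL := sqint_elsym eL N n.
rewrite ipZl//; last exact: sqintZ.
rewrite ipZr// ip_elsym// mulrA -invfM -expr2 exprAC rt_sqr -natrX.
have [->|N0] := posnP (N ^ deg n)%N; first by rewrite invr0 mul0r.
by rewrite ler_pdivrMl ?ltr0n// mulr1 ler_nat nwords_le.
Qed.

Lemma nwords_ratio_cvg (n : I -> nat) :
  (N%:R ^+ deg n / (@nwords I N n)%:R) @[N --> \oo] --> ((\prod_k (n k)`!)%:R : R).
Proof.
set p := (\prod_k (n k)`!)%N.
have p0 : p%:R != 0 :> R.
  by rewrite pnatr_eq0 -lt0n prodn_gt0// => k; exact: fact_gt0.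
have E N : N%:R ^+ deg n / (@nwords I N n)%:R =
    p%:R * ((N ^_ deg n)%:R / N%:R ^+ deg n)^-1 :> R.
  rewrite -nwords_ffact natrM invf_div invfM mulrCA; congr (_ * _).
  by rewrite [RHS]mulrCA -/p mulfV// mulr1.
have cv : p%:R * ((N ^_ deg n)%:R / N%:R ^+ deg n)^-1 @[N --> \oo] -->
    (p%:R * 1^-1 : R).
  apply: cvgM; first exact: cvg_cst.
  by apply: cvgV; [rewrite oner_neq0|exact: ffact_ratio_cvg].
rewrite invr1 mulr1 in cv.
by under eq_fun do rewrite E.
Qed.

Lemma chaos_cvg M : cvP0 m (fun N z => chaos a b s M z - mehler_product M z).
Proof.
pose c N (n : {ffun I -> 'I_M.+1}) : R := N%:R ^+ deg (mi n) / (@nwords I N (mi n))%:R.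
pose p (n : {ffun I -> 'I_M.+1}) : R := (\prod_k (n k)`!)%:R.
pose S (n : {ffun I -> 'I_M.+1}) N (z : N.-tuple (T * T)) := scaled_elsym fstl (mi n) z.
pose S' (n : {ffun I -> 'I_M.+1}) N (z : N.-tuple (T * T)) := scaled_elsym sndl (mi n) z.
pose h (n : {ffun I -> 'I_M.+1}) N (z : N.-tuple (T * T)) := hermite_limit fstl (mi n) z.
pose h' (n : {ffun I -> 'I_M.+1}) N (z : N.-tuple (T * T)) := hermite_limit sndl (mi n) z.
have mS n : measurable_seq (S n) by exact: measurable_scaled_elsym fstlL _.
have mS' n : measurable_seq (S' n) by exact: measurable_scaled_elsym sndlL _.
have mh n : measurable_seq (h n) by exact: measurable_hermite_limit fstlL _.
have mh' n : measurable_seq (h' n) by exact: measurable_hermite_limit sndlL _.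
have cS n : cvP0 m (fun N z => S n N z - h n N z).
  exact: (scaled_elsym_cvg fstlL ip_fstl ip_fstl1).
have cS' n : cvP0 m (fun N z => S' n N z - h' n N z).
  exact: (scaled_elsym_cvg sndlL ip_sndl ip_sndl1).
have tS' n : tight m (S' n) by exact: (tight_scaled_elsym _ sndlL ip_sndl ip_sndl1).
have th n : tight m (h n).
  apply: (@tight_prod _ _ _ _ _ _ (fun k N z => qherm (n k) (fluct fstl k z))).
    move=> k N; apply: measurableT_comp; first exact: measurable_qherm.
    exact: (measurable_fluct fstlL).
  move=> k; apply: tight_qherm; first exact: (measurable_fluct fstlL).
  exact: (tight_fluct fstlL ip_fstl ip_fstl1).
have th' n : tight m (h' n).
  apply: (@tight_prod _ _ _ _ _ _ (fun k N z => qherm (n k) (fluct sndl k z))).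
    move=> k N; apply: measurableT_comp; first exact: measurable_qherm.
    exact: (measurable_fluct sndlL).
  move=> k; apply: tight_qherm; first exact: (measurable_fluct sndlL).
  exact: (tight_fluct sndlL ip_sndl ip_sndl1).
(* The difference c S S' - p h h' with one factor changed at a time; each term is a tight sequence
   times one tending to 0 in probability. *)
pose D (n : {ffun I -> 'I_M.+1}) N (z : N.-tuple (T * T)) : R :=
  (\prod_k s k ^+ n k) * (c N n * (S' n N z * (S n N z - h n N z) + h n N z * (S' n N z - h' n N z)) +
   (h n N z * h' n N z) * (c N n - p n)).
apply: (@cvP0_eq _ _ _ _ (fun N z => \sum_n D n N z)).
  move=> N N0 z; rewrite chaosE mehler_productE -sumrB; apply: eq_bigr => n _.
  have r0 : rt R N ^+ deg (mi n) != 0 by rewrite expf_neq0// gt_eqF// rt_gt0.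
  rewrite /D /c -(rt_sqr R N) exprAC.
  have -> : elsym fstl (mi n) z = S n N z * rt R N ^+ deg (mi n) by rewrite /S /scaled_elsym divfK.
  have -> : elsym sndl (mi n) z = S' n N z * rt R N ^+ deg (mi n) by rewrite /S' /scaled_elsym divfK.
  rewrite -/(h n N z) -/(h' n N z) -/(p n).
  ring.
have ccvg n : c N n @[N --> \oo] --> p n by exact: nwords_ratio_cvg.
have m1 n : measurable_seq (fun N z => S n N z - h n N z).
  by move=> N; apply: measurable_funB; [exact: mS|exact: mh].
have m1' n : measurable_seq (fun N z => S' n N z - h' n N z).
  by move=> N; apply: measurable_funB; [exact: mS'|exact: mh'].
have m2 n : measurable_seq (fun N z => S' n N z * (S n N z - h n N z)).
  by move=> N; apply: measurable_funM; [exact: mS'|exact: m1].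
have m2' n : measurable_seq (fun N z => h n N z * (S' n N z - h' n N z)).
  by move=> N; apply: measurable_funM; [exact: mh|exact: m1'].
have m3 n : measurable_seq (fun N z =>
    S' n N z * (S n N z - h n N z) + h n N z * (S' n N z - h' n N z)).
  by move=> N; apply: measurable_funD; [exact: m2|exact: m2'].
have mc (x : nat -> R) : measurable_seq (fun N (z : N.-tuple (T * T)) => x N) by [].
have m4 n : measurable_seq (fun N z => h n N z * h' n N z).
  by move=> N; apply: measurable_funM; [exact: mh|exact: mh'].
have m5 n : measurable_seq (fun N z => c N n *
    (S' n N z * (S n N z - h n N z) + h n N z * (S' n N z - h' n N z))).
  by move=> N; apply: measurable_funM => //; exact: m3.
have m6 n : measurable_seq (fun N z => (h n N z * h' n N z) * (c N n - p n)).
  by move=> N; apply: measurable_funM => //; exact: m4.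
apply: cvP0_sum => n.
  move=> N; apply: measurable_funM => //.
  by apply: measurable_funD; [exact: m5|exact: m6].
apply: cvP0Z; first by move=> N; apply: measurable_funD; [exact: m5|exact: m6].
apply: cvP0D => //.
  apply: cvP0M => //.
    have [C [_ HC]] := cvg_seq_bounded (cvgP _ (ccvg n)).
    apply: (@tight_deterministic _ _ _ _ _ (C + 1)) => N.
    by apply: (HC (C + 1)) => //; rewrite ltrDl.
  apply: cvP0D => //; exact: cvP0M.
apply: cvP0M => //; first exact: tightM.
apply: cvP0_deterministic; rewrite -(subrr (p n)).
by apply: cvgB => //; exact: cvg_cst.
Qed.

End coordinate_letters.

(** The dropped summand -ln(1 - s^2) / 2 is nonnegative. The remaining bilinear and quadratic parts
    are separated because they are estimated by different moments. *)
Lemma mehler_log_ge (R : realType) (u v s : R) : 0 <= s < 1 ->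
  s / (1 - s ^+ 2) * (u * v) - s ^+ 2 / (2 * (1 - s ^+ 2)) * (u ^+ 2 + v ^+ 2) <=
  mehler_log u v s.
Proof.
move=> /andP[s0 s1]; have d0 : 0 < 1 - s ^+ 2 by rewrite subr_gt0 expr_lt1.
rewrite /mehler_log.
have -> : s / (1 - s ^+ 2) * (u * v) - s ^+ 2 / (2 * (1 - s ^+ 2)) * (u ^+ 2 + v ^+ 2) =
  (2 * s * u * v - s ^+ 2 * (u ^+ 2 + v ^+ 2)) / (2 * (1 - s ^+ 2)).
  by field; rewrite gt_eqF.
rewrite lerDr oppr_ge0 pmulr_lle0//; apply: ln_le0.
by rewrite gerBl sqr_ge0.
Qed.

(** A crude floor on a box, which turns the additive error of [mehler_uniform] into a relative
    one. *)
Lemma mehler_log_bounded (R : realType) (u v s B : R) : 0 <= s < 1 ->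
  `|u| <= B -> `|v| <= B -> - (2 * B ^+ 2 / (1 - s ^+ 2)) <= mehler_log u v s.
Proof.
move=> s01 uB vB; apply: le_trans (mehler_log_ge u v s01).
move: s01 => /andP[s0 s1]; have d0 : 0 < 1 - s ^+ 2 by rewrite subr_gt0 expr_lt1.
have B0 : 0 <= B by exact: le_trans uB.
have u2 : u ^+ 2 <= B ^+ 2 by rewrite -real_normK ?num_real// lerXn2r ?nnegrE.
have v2 : v ^+ 2 <= B ^+ 2 by rewrite -real_normK ?num_real// lerXn2r ?nnegrE.
have -> : s / (1 - s ^+ 2) * (u * v) - s ^+ 2 / (2 * (1 - s ^+ 2)) * (u ^+ 2 + v ^+ 2) =
  (s * (u * v) - s ^+ 2 * (u ^+ 2 + v ^+ 2) / 2) / (1 - s ^+ 2).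
  by field; rewrite gt_eqF.
rewrite -mulNr ler_pM2r ?invr_gt0//.
have uv : - B ^+ 2 <= u * v.
  suff : `|u * v| <= B ^+ 2 by rewrite ler_norml => /andP[].
  by rewrite normrM expr2 ler_pM.
have s2 : s ^+ 2 <= 1 by rewrite expr_le1// ltW.
have : - B ^+ 2 <= s * (u * v).
  apply: (@le_trans _ _ (s * - B ^+ 2)); last by rewrite ler_wpM2l.
  by rewrite mulrN lerN2 ler_piMl ?sqr_ge0// ltW.
have : s ^+ 2 * (u ^+ 2 + v ^+ 2) <= u ^+ 2 + v ^+ 2.
  by rewrite ler_piMl// addr_ge0// sqr_ge0.
lra.
Qed.

(** A relative loss of 1 / (2 (n + 1)) in each of n factors costs at most one half in total. *)
Lemma bernoulli_half (R : realType) n :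
  2^-1 <= (1 - (2 * n.+1%:R)^-1 : R) ^+ n.
Proof.
set t : R := (2 * n.+1%:R)^-1.
have t1 : 0 <= t <= 1.
  rewrite /t invr_ge0 mulr_ge0//= invf_le1 ?mulr_gt0//.
  by rewrite -natrM ler1n muln_gt0.
have H k : 1 - k%:R * t <= (1 - t) ^+ k.
  elim: k => [|k IH]; first by rewrite mul0r subr0.
  have [t0 {}t1] := andP t1.
  apply: (@le_trans _ _ ((1 - t) * (1 - k%:R * t))).
    rewrite -natr1; have : 0 <= k%:R * t ^+ 2 by rewrite mulr_ge0// sqr_ge0.
    lra.
  by rewrite exprS ler_wpM2l// subr_ge0.
apply: le_trans (H n).
suff : n%:R * t <= 2^-1 by lra.
by rewrite /t invfM mulrCA ler_piMr// ler_pdivrMr ?ltr0n// mul1r ler_nat.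
Qed.

Section lower_tail.
Context d (T : measurableType d) (R : realType) (P Q : probability T R).
Notation m := (P \x Q : probability (T * T)%type R)%E.

Section fixed_letters.
Variables (I : finType) (a b : I -> T -> R) (s : I -> R).
Hypothesis ab : orthonormal_letters P Q a b.

Let delta (k : I) : I -> nat := incr (fun=> 0%N) k.

Lemma fluct_elsym (e : I -> T * T -> R) N k (z : N.-tuple (T * T)) :
  fluct e k z = elsym e (delta k) z / rt R N.
Proof.
rewrite /fluct; congr (_ / _).
have := elsym_incr e (fun=> 0%N) k z; rewrite mul1r => <-.
apply: eq_bigr => i _; rewrite /elsym_at big_mkcondr/=.
under eq_bigl do rewrite hastype0 ?/deg ?big1//.
rewrite big_pred1_eq ffunE eqxx /emono /pf big1 ?mulr1// => j _; by rewrite ffunE.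
Qed.

Lemma nwords_delta N k : @nwords I N (delta k) = N.
Proof.
have := @nwords_incr I N (fun=> 0%N) k.
by rewrite mul1n => ->; rewrite nwords0 ?/deg ?big1// subn0 muln1.
Qed.

Lemma hastype_delta_inj N (f : {ffun 'I_N -> option I}) k l :
  hastype (delta k) f -> hastype (delta l) f -> k = l.
Proof.
move=> /hastypeP H /hastypeP H'; have := H k; rewrite H' /delta /incr eqxx.
by case: eqVneq.
Qed.

(** The products U_k V_k are orthogonal for different k, being sums over disjoint families of
    monomials with a single letter k in each coordinate. Only the squares s_k^2 have a controlled
    sum, so this second moment is used instead of adding L^1 norms, whose sum would involve sum_k
    s_k. *)
Lemma ip_fluct_prod N (c : I -> R) :
  let F z := \sum_k c k * (fluct (fstl a) k z * fluct (sndl b) k z) in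
  sqint (power_measure m N) F /\
  ip (power_measure m N) F F <= \sum_k c k ^+ 2.
Proof.
case: (ab) => aL bL aa bb a1 b1 F.
pose w (f g : {ffun 'I_N -> option I}) : R :=
  \sum_(k | hastype (delta k) f && hastype (delta k) g) c k / N%:R.
have FE : F = comb a b w.
  apply/funext => z; rewrite /comb /F.
  under [RHS]eq_bigr do under eq_bigr do rewrite /w mulr_suml big_mkcond/=.
  under [RHS]eq_bigr do rewrite exchange_big/=.
  rewrite [RHS]exchange_big/=; apply: eq_bigr => k _.
  transitivity (elsym (fstl a) (delta k) z * elsym (sndl b) (delta k) z * (c k / N%:R)).
    by rewrite !fluct_elsym mulrACA -invfM -expr2 rt_sqr; ring.
  rewrite /elsym big_distrlr/= big_distrl/= big_mkcond.
  apply: eq_bigr => f _; case: ifPn => nf /=; last by rewrite big1// => g _; rewrite (negPf nf).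
  rewrite big_distrl big_mkcond/=; apply: eq_bigr => g _.
  by case: ifP => // _; rewrite monoE mulrC.
rewrite FE; split; first exact: sqint_comb.
rewrite ip_comb//.
(* At most one k fits a given pair (f, g), so the square has no cross terms. *)
have E f g : w f g * w f g =
  \sum_(k | hastype (delta k) f && hastype (delta k) g) (c k / N%:R) ^+ 2.
  rewrite /w; have [[k Hk]|H] := pselect (exists k, hastype (delta k) f && hastype (delta k) g).
    have E l : hastype (delta l) f && hastype (delta l) g = (l == k).
      apply/idP/eqP => [/andP[lf _]|->//].
      by move/andP : Hk => [kf _]; exact: hastype_delta_inj lf kf.
    by rewrite (eq_bigl _ _ E) [RHS](eq_bigl _ _ E) !big_pred1_eq -expr2.
  by rewrite !big_pred0 ?mul0r// => k; apply/negP => Hk; apply: H; exists k.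
under eq_bigr do under eq_bigr do rewrite E big_mkcond/=.
under eq_bigr do rewrite exchange_big/=.
rewrite exchange_big/=; apply: ler_sum => k _.
rewrite (eq_bigr (fun f : {ffun 'I_N -> option I} =>
  if hastype (delta k) f then N%:R * (c k / N%:R) ^+ 2 else 0)); last first.
  move=> f _; case: ifPn => kf /=; last by rewrite big1// => g _; rewrite (negPf kf).
  rewrite -big_mkcond/= sumr_const [RHS]mulr_natl; congr (_ *+ _).
  exact: nwords_delta.
rewrite -big_mkcond/= sumr_const (_ : #|_| = N); last exact: nwords_delta.
rewrite -mulr_natl; have [->|N0] := posnP N; first by rewrite !mul0r sqr_ge0.
rewrite exprMn; set n : R := N%:R.
have n0 : n != 0 by rewrite pnatr_eq0 -lt0n.
by rewrite le_eqVlt; apply/orP; left; apply/eqP; field.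
Qed.

Let energy k N (z : N.-tuple (T * T)) : R :=
  fluct (fstl a) k z ^+ 2 + fluct (sndl b) k z ^+ 2.

Lemma nrm1_energy N k : (power_measure m N).-integrable setT (EFin \o @energy k N) /\
  nrm1 (power_measure m N) (@energy k N) <= 2.
Proof.
have H (e : I -> T * T -> R) : (forall i, sqint m (e i)) ->
    (forall i j, ip m (e i) (e j) = (i == j)%:R) ->
    (forall i, ip m (e i) (fun=> 1) = 0) ->
    (power_measure m N).-integrable setT (EFin \o (fun z => @fluct _ _ _ _ e N k z ^+ 2)) /\
    nrm1 (power_measure m N) (fun z => @fluct _ _ _ _ e N k z ^+ 2) <= 1.
  move=> eL ee e1; have uL := sqint_fluct eL N k; split; first by case: uL.
  apply: le_trans (nrm1_mul uL uL) _.
  by rewrite -expr2 sqr_sqrtr ?ip_ge0//; exact: ip_fluct.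
have [h1 h2] := H _ (fstlL ab) (ip_fstl ab) (ip_fstl1 ab).
have [h3 h4] := H _ (sndlL ab) (ip_sndl ab) (ip_sndl1 ab).
split; first exact: l1D.
by apply: le_trans (nrm1D h1 h3) _; rewrite (_ : 2 = 1 + 1)//; exact: lerD.
Qed.

Definition log_bound N (z : N.-tuple (T * T)) : R :=
  \sum_k (s k / (1 - s k ^+ 2)) * (fluct (fstl a) k z * fluct (sndl b) k z) -
  \sum_k (s k ^+ 2 / (2 * (1 - s k ^+ 2))) * energy k z.

(** The bilinear part is bounded through its second moment, the quadratic part term by term, its
    weights being of order s_k^2. Neither bound involves the number of letters. *)
Lemma nrm1_log_bound N S2 s1 : (forall k, 0 <= s k <= s1) -> 0 <= s1 < 1 ->
  \sum_k s k ^+ 2 <= S2 ->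
  (power_measure m N).-integrable setT (EFin \o @log_bound N) /\
  nrm1 (power_measure m N) (@log_bound N) <=
    Num.sqrt (S2 / (1 - s1 ^+ 2) ^+ 2) + S2 / (1 - s1 ^+ 2).
Proof.
move=> ss /andP[s10 s11] sS.
have d0 : 0 < 1 - s1 ^+ 2 by rewrite subr_gt0 expr_lt1.
have dk k : 1 - s1 ^+ 2 <= 1 - s k ^+ 2.
  have /andP[h1 h2] := ss k; rewrite lerB// lerXn2r ?nnegrE//.
have [FL Fle] := ip_fluct_prod N (fun k => s k / (1 - s k ^+ 2)).
pose q k := s k ^+ 2 / (2 * (1 - s k ^+ 2)).
have q0 k : 0 <= q k <= s k ^+ 2 / (2 * (1 - s1 ^+ 2)).
  have dk0 := lt_le_trans d0 (dk k).
  rewrite /q divr_ge0 ?sqr_ge0 ?mulr_ge0 ?(ltW dk0)//=.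
  by rewrite ler_wpM2l ?sqr_ge0// lef_pV2 ?posrE ?mulr_gt0// ler_pM2l.
have qL k : (power_measure m N).-integrable setT
    (EFin \o (fun z => q k * @energy k N z)).
  by apply: l1Z; case: (nrm1_energy N k).
have QL : (power_measure m N).-integrable setT
    (EFin \o (fun z => \sum_k q k * @energy k N z)).
  by apply: (@l1_sum _ _ _ _ _ _ _ (fun k z => q k * @energy k N z)).
split; first by apply: l1B; first exact: sqint_integrable FL.
apply: le_trans (nrm1B (sqint_integrable FL) QL) _.
apply: lerD.
  apply: le_trans (nrm1_sqint FL) _; apply: ler_wsqrtr.
  apply: le_trans Fle _.
  apply: (@le_trans _ _ (\sum_k s k ^+ 2 / (1 - s1 ^+ 2) ^+ 2)); last first.
    by rewrite -mulr_suml ler_wpM2r// invr_ge0 exprn_ge0// ltW.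
  apply: ler_sum => k _; rewrite expr_div_n ler_wpM2l ?sqr_ge0//.
  have dk0 := lt_le_trans d0 (dk k).
  by rewrite lef_pV2 ?posrE ?exprn_gt0// lerXn2r// nnegrE ltW.
apply: le_trans (@nrm1_sum _ _ _ (power_measure m N) _ (index_enum I) predT
  (fun k z => q k * @energy k N z) (fun k _ => qL k)) _.
apply: (@le_trans _ _ (\sum_k s k ^+ 2 / (1 - s1 ^+ 2))); last first.
  by rewrite -mulr_suml ler_wpM2r// invr_ge0 ltW.
apply: ler_sum => k _; have [eL e2] := nrm1_energy N k.
have /andP[qk0 qk] := q0 k.
rewrite nrm1Z// ger0_norm//; apply: le_trans (ler_pM qk0 (nrm1_ge0 _ _) qk e2) _.
by rewrite le_eqVlt; apply/orP; left; apply/eqP; field; rewrite gt_eqF.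
Qed.

Lemma mehler_product_lower B : (forall k, 0 <= s k < 1) -> 0 <= B ->
  exists M0, forall M, (M0 <= M)%N -> forall N (z : N.-tuple (T * T)),
  (forall k, `|fluct (fstl a) k z| <= B) -> (forall k, `|fluct (sndl b) k z| <= B) ->
  2^-1 * expR (@log_bound N z) <= mehler_product a b s M z.
Proof.
(* The relative loss allowed per factor, so that [bernoulli_half] applies with the number of letters
   as exponent. *)
move=> s01 B0; pose t : R := (2 * #|I|.+1%:R)^-1.
have t01 : 0 < t <= 1.
  rewrite /t invr_gt0 mulr_gt0//= invf_le1 ?mulr_gt0//.
  by rewrite -natrM ler1n muln_gt0.
have [t0 t1] := andP t01.
(* A floor for the k-th Mehler kernel on the box; an absolute error [t * W k] is then a relative
   error of at most t. *)
pose W k : R := expR (- (2 * B ^+ 2 / (1 - s k ^+ 2))).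
have tW k : 0 < t * W k by rewrite mulr_gt0// expR_gt0.
have /choice[m0 Hm0] : forall k, exists m0, forall m', (m0 <= m')%N ->
    forall u v, `|u| <= B -> `|v| <= B ->
    `|\sum_(n < m') s k ^+ n * mehler_coef u v n - expR (mehler_log u v (s k))| <= t * W k.
  by move=> k; exact: mehler_uniform.
exists (\max_k m0 k) => M MM N z Uz Vz.
pose L k := mehler_log (fluct (fstl a) k z) (fluct (sndl b) k z) (s k).
have H k : (1 - t) * expR (L k) <=
    \sum_(j < M.+1) s k ^+ j * mehler_coef (fluct (fstl a) k z) (fluct (sndl b) k z) j.
  have := Hm0 k M.+1 (leq_trans (leq_trans (leq_bigmax k) MM) (leqnSn _)) _ _ (Uz k) (Vz k).
  rewrite ler_norml => /andP[h _].
  have : t * W k <= t * expR (L k).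
    by rewrite ler_pM2l// ler_expR; exact: mehler_log_bounded.
  by rewrite -/(L k) in h *; lra.
apply: (@le_trans _ _ (\prod_k ((1 - t) * expR (L k)))); last first.
  apply: ler_prod => k _; rewrite H andbT mulr_ge0 ?expR_ge0//; lra.
rewrite big_split/= prodr_const -expR_sum.
apply: ler_pM; rewrite ?expR_ge0//; first exact: bernoulli_half.
rewrite ler_expR /log_bound -sumrB; apply: ler_sum => k _.
exact: mehler_log_ge.
Qed.

Lemma measurable_mehler_product M :
  measurable_seq (fun N => @mehler_product _ T R _ a b s M N).
Proof.
move=> N; rewrite (funext (@mehler_productE _ _ _ _ a b s M N)).
apply: (@measurable_sum _ _ _ _ _ _ (fun n : {ffun I -> 'I_M.+1} =>
  fun z : N.-tuple (T * T) => \prod_k s k ^+ n k * (\prod_k (n k)`!)%:R *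
  (hermite_limit (fstl a) (fun k => n k) z * hermite_limit (sndl b) (fun k => n k) z))).
move=> n; apply: measurable_funM => //; apply: measurable_funM.
  exact: measurable_hermite_limit (fstlL ab) _ _.
exact: measurable_hermite_limit (sndlL ab) _ _.
Qed.

End fixed_letters.

(* The point is that [eps] does not depend on the number of letters. *)
Lemma chaos_lower_tail (S2 s1 eta : R) : 0 <= S2 -> 0 <= s1 < 1 -> 0 < eta ->
  exists2 eps, 0 < eps &
  forall (I : finType) (a b : I -> T -> R) (s : I -> R),
  orthonormal_letters P Q a b -> (forall k, 0 <= s k <= s1) ->
  \sum_k s k ^+ 2 <= S2 ->
  exists M0, forall M, (M0 <= M)%N -> exists N0, forall N, (N0 <= N)%N ->
  (power_measure m N [set z | (chaos a b s M z < eps)%R] <= eta%:E)%E.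
Proof.
move=> S20 s101 eta0; have [s10 s11] := andP s101.
have d0 : 0 < 1 - s1 ^+ 2 by rewrite subr_gt0 expr_lt1.
pose C : R := Num.sqrt (S2 / (1 - s1 ^+ 2) ^+ 2) + S2 / (1 - s1 ^+ 2).
have C0 : 0 <= C by rewrite addr_ge0 ?sqrtr_ge0// divr_ge0// ltW.
have e3 : 0 < eta / 3 by rewrite divr_gt0.
have e6 : 0 < eta / 6 by rewrite divr_gt0.
(* By Markov's inequality |log_bound| reaches K with probability at most eta / 3; the summand 1
   keeps K positive. Otherwise the Mehler product is at least exp(-K) / 2, twice the eps below, and
   passing to [chaos] may cost one eps. *)
pose K := C / (eta / 3) + 1; have K0 : 0 < K by rewrite ltr_wpDl// divr_ge0// ltW.
exists (expR (- K) / 4) => [|I a b s ab ss sS]; first by rewrite divr_gt0// expR_gt0.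
set eps : R := expR (- K) / 4.
have eps0 : 0 < eps by rewrite divr_gt0// expR_gt0.
(* B grows with the number of letters, which affects only M0 and N0. Since B >= 1, a number whose
   square is at most B is itself at most B in absolute value. *)
pose B : R := #|I|%:R / (eta / 6) + 1.
have B1 : 1 <= B by rewrite lerDr divr_ge0// ltW.
have B0 : 0 < B by exact: lt_le_trans B1.
have s01 k : 0 <= s k < 1 by have /andP[-> h] := ss k; exact: le_lt_trans s11.
have [M0 HM0] := mehler_product_lower a b s01 (ltW B0).
exists M0 => M /HM0 HM.
have [N0 HN0] := chaos_cvg s ab M eps0 e3.
exists N0 => N /HN0 HN.
have [LL Le] := nrm1_log_bound ab N ss s101 sS.
pose G (z : N.-tuple (T * T)) : R :=
  \sum_k (fluct (fstl a) k z ^+ 2 + fluct (sndl b) k z ^+ 2).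
have GE := fun k => nrm1_energy ab N k.
have GL : (power_measure m N).-integrable setT (EFin \o G).
  by apply: (@l1_sum _ _ _ _ _ _ _ (fun k (z : N.-tuple (T * T)) =>
    fluct (fstl a) k z ^+ 2 + fluct (sndl b) k z ^+ 2)) => k _; case: (GE k).
have G2 : nrm1 (power_measure m N) G <= 2 * #|I|%:R.
  apply: le_trans (@nrm1_sum _ _ _ (power_measure m N) _ (index_enum I) predT
    (fun k (z : N.-tuple (T * T)) =>
    fluct (fstl a) k z ^+ 2 + fluct (sndl b) k z ^+ 2) _) _.
    by move=> k _; case: (GE k).
  rewrite mulr_natr -sumr_const; apply: ler_sum => k _; by case: (GE k).
have mC := measurable_chaos s ab M (N := N).
have mD : measurable_fun setT (fun z : N.-tuple (T * T) =>
    chaos a b s M z - mehler_product a b s M z).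
  by apply: measurable_funB => //; exact: (measurable_mehler_product s ab M (N := N)).
have mLL := integrable_measurable LL.
have mG := integrable_measurable GL.
rewrite (_ : eta = eta / 3 + (eta / 3 + eta / 3)); last by field.
apply: (@measure_cover _ _ _ _ _ [set z | K <= `|log_bound a b s z|]
  ([set z | B <= `|G z|] `|` [set z | eps <= `|chaos a b s M z - mehler_product a b s M z|])).
- rewrite (_ : mkset _ = ~` [set z | eps <= chaos a b s M z]).
    apply: measurableC; rewrite -[X in measurable X]setTI.
    exact: measurable_fun_le.
  by apply/seteqP; split => z /=; rewrite ltNge => /negP.
- exact: measurable_norm_ge.
- by apply: measurableU; exact: measurable_norm_ge.
- move=> z /= zC; have [?|LK] := leP K `|log_bound a b s z|; first by left.
  have [?|GB] := leP B `|G z|; first by right; left.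
  right; right; rewrite leNgt; apply/negP => zD.
  have GB' : G z <= B.
    by apply: ltW; apply: le_lt_trans GB; exact: ler_norm.
  have sq (u : R) : u ^+ 2 <= B -> `|u| <= B.
    move=> uB; rewrite -(ler_pXn2r (n := 2))// ?nnegrE; last exact: ltW.
    rewrite real_normK ?num_real//; apply: (le_trans uB).
    by rewrite expr2 ler_peMl// ltW.
  have Gk k : fluct (fstl a) k z ^+ 2 + fluct (sndl b) k z ^+ 2 <= G z.
    rewrite /G (bigD1 k)//= lerDl; apply: sumr_ge0 => j _.
    by rewrite addr_ge0// sqr_ge0.
  have low : 2^-1 * expR (log_bound a b s z) <= mehler_product a b s M z.
    apply: HM => k; apply: sq; apply: (le_trans _ (le_trans (Gk k) GB')).
      by rewrite lerDl sqr_ge0.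
    by rewrite lerDr sqr_ge0.
  have : expR (- K) <= expR (log_bound a b s z).
    by rewrite ler_expR; move: LK; rewrite ltr_norml => /andP[/ltW].
  move: zD zC; rewrite ltr_norml /eps => /andP[zD _] zC.
  by have := expR_gt0 (- K); lra.
- apply: le_trans (markov_nrm1 K0 LL) _; rewrite lee_fin ler_pdivrMr//.
  apply: le_trans Le _; rewrite -/C mulrDr mulr1 mulrCA divff ?gt_eqF// mulr1.
  by rewrite lerDl ltW.
- apply: (@measure_cover _ _ _ _ _ [set z | B <= `|G z|]
    [set z | eps <= `|chaos a b s M z - mehler_product a b s M z|]).
  + by apply: measurableU; exact: measurable_norm_ge.
  + exact: measurable_norm_ge.
  + exact: measurable_norm_ge.
  + by [].
  + apply: le_trans (markov_nrm1 B0 GL) _; rewrite lee_fin ler_pdivrMr//.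
    apply: le_trans G2 _.
    have -> : eta / 3 * B = 2 * #|I|%:R + eta / 3.
      by rewrite /B; field; rewrite gt_eqF.
    by rewrite lerDl ltW.
  + exact: HN.
Qed.

End lower_tail.

(** * The singular value decomposition *)

Section square_integrable_norm.
Context d (T : measurableType d) (R : realType) (P : probability T R).

Lemma Lfun_sqint f : f \in Lfun P 2%:E -> sqint P f.
Proof.
move=> fL; split; last exact: Lfun2_integrable_sqr.
by move: fL; rewrite inE => /andP[/set_mem].
Qed.

Lemma ip_EFin f : sqint P f -> (\int[P]_x (f x ^+ 2)%:E)%E = (ip P f f)%:E.
Proof.
move=> [mf f2]; rewrite /ip /Rintegral fineK; last exact: integrable_fin_num f2.
by apply: eq_integral => x _; rewrite expr2.
Qed.

Lemma Lnorm2_sqr f : sqint P f ->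
  (('N[P]_2%:E[EFin \o f]) `^ 2)%E = (ip P f f)%:E.
Proof.
move=> fL; rewrite -ip_EFin// poweR_Lnorm//; apply: eq_integral => x _ /=.
by rewrite powR_mulrn// real_normK// num_real.
Qed.

Lemma sqint_Lfun f : sqint P f -> f \in Lfun P 2%:E.
Proof.
move=> fL; rewrite inE; apply/andP; split; [apply/mem_set; case: fL => //|apply/mem_set].
rewrite /= /finite_norm (@lty_poweRy _ _ 2)//.
by rewrite Lnorm2_sqr// ltry.
Qed.

Lemma eq_ip_ae f g h : sqint P f -> sqint P g -> sqint P h ->
  f = g %[ae P] -> ip P f h = ip P g h.
Proof.
move=> [mf _] [mg _] [mh _] fg; congr fine; apply: ae_eq_integral => //.
- by apply/measurable_EFinP; exact: measurable_funM.
- by apply/measurable_EFinP; exact: measurable_funM.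
- by apply: filterS fg => x /= fgx Dx; rewrite fgx.
Qed.

(** The square norm of the remainder is that of f minus the sum of squared coefficients; null
    functions in the family are harmless because their coefficients vanish ([ce]). *)
Lemma parseval e f : orthonormal_basis P e -> sqint P f ->
  [/\ forall n, \sum_(k < n) ip P f (e k) ^+ 2 <= ip P f f &
      \sum_(k < n) ip P f (e k) ^+ 2 @[n --> \oo] --> ip P f f].
Proof.
case=> eL eo en ex fL.
have eS k : sqint P (e k) by exact: Lfun_sqint.
have ce k : ip P f (e k) ^+ 2 * ip P (e k) (e k) = ip P f (e k) ^+ 2.
  have [e1|e0] := en k; first by rewrite [ip P (e k) _]e1 mulr1.
  suff -> : ip P f (e k) = 0 by rewrite expr0n mul0r.
  rewrite ipC (@eq_ip_ae _ (fun=> 0))//; last exact: sqint_cst.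
  by rewrite /ip; under eq_Rintegral do rewrite mul0r; rewrite Rintegral_probability_cst.
pose rem n x := f x - \sum_(k < n) ip P f (e k) * e k x.
have sS n : sqint P (fun x => \sum_(k < n) ip P f (e k) * e k x).
  by apply: sqint_sum => k _; exact: sqintZ.
have remS n : sqint P (rem n) by exact: sqintB.
have E n : ip P (rem n) (rem n) = ip P f f - \sum_(k < n) ip P f (e k) ^+ 2.
  have h1 : ip P f (fun x => \sum_(k < n) ip P f (e k) * e k x) =
      \sum_(k < n) ip P f (e k) ^+ 2.
    rewrite ip_sumr//; last by move=> k _; exact: sqintZ.
    by apply: eq_bigr => k _; rewrite ipZr.
  have h2 (k : 'I_n) : ip P (e k) (fun x => \sum_(k < n) ip P f (e k) * e k x) =
      ip P f (e k) * ip P (e k) (e k).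
    rewrite ip_sumr//; last by move=> j _; exact: sqintZ.
    rewrite (bigD1 k)//= ipZr// big1 ?addr0// => j jk.
    by rewrite ipZr// [ip P (e k) _]eo ?mulr0// eq_sym.
  have h3 : ip P (fun x => \sum_(k < n) ip P f (e k) * e k x)
      (fun x => \sum_(k < n) ip P f (e k) * e k x) = \sum_(k < n) ip P f (e k) ^+ 2.
    rewrite {1}ip_suml//; last by move=> k _; exact: sqintZ.
    by apply: eq_bigr => k _; rewrite ipZl// h2 mulrA -expr2 ce.
  have h1' := h1; rewrite ipC in h1'.
  rewrite ipBl// ipBr// ipBr// h1 h3 h1'; ring.
split=> [n|]; first by rewrite -subr_ge0 -E ip_ge0.
have rem0 : ip P (rem n) (rem n) @[n --> \oo] --> 0.
  apply/cvgrPdist_le => eps eps0.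
  have /fine_cvgP[fin cv] := ex f (sqint_Lfun fL).
  (* Below 1 the square of the norm is at most the norm, so the bound by eps passes to the
     square. *)
  move/cvgrPdist_lt : cv => /(_ (Num.min 1 eps)); rewrite lt_min ltr01 eps0 => /(_ isT) cv.
  apply: filterS2 fin cv => n Nf Nle; rewrite sub0r normrN ger0_norm ?ip_ge0//.
  move: Nf Nle; set N := ('N[P]_2%:E[_])%E => Nf Nle.
  have := Lnorm2_sqr (remS n); rewrite -[Lnorm _ _ _]/N -(fineK Nf) poweR_EFin => -[<-].
  have N0 : 0 <= fine N by rewrite fine_ge0// Lnorm_ge0.
  move: Nle; rewrite sub0r normrN ger0_norm// lt_min => /andP[N1 Ne].
  by rewrite powR_mulrn//; apply: le_trans (ltW Ne); rewrite expr2 ler_piMl// ltW.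
have cv : ip P f f - ip P (rem n) (rem n) @[n --> \oo] --> ip P f f - 0.
  by apply: cvgB => //; exact: cvg_cst.
rewrite subr0 in cv.
suff -> : (fun n => \sum_(k < n) ip P f (e k) ^+ 2) =
  (fun n => ip P f f - ip P (rem n) (rem n)) by [].
by apply/funext => n; rewrite E subKr.
Qed.

End square_integrable_norm.

Section transition_inner_products.
Context d (T : measurableType d) (R : realType) (P Q : probability T R).
Notation m := (P \x Q : probability (T * T)%type R)%E.
Variable xi : T * T -> R.
Hypothesis xiL : sqint m xi.

Lemma integral_section (P' : probability T R) (u f : T -> R) (c : R) :
  P'.-integrable setT (fun x => (u x * (f x * c))%:E) ->
  (\int[P']_x (u x * (f x * c))%:E)%E = ((\int[P']_x (f x * u x)) * c)%:E.
Proof.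
(* For c = 0 the integrability of [f * u] is unknown, but both sides vanish. *)
move=> ui; have [->|c0] := eqVneq c 0.
  rewrite mulr0; under eq_integral do rewrite mulr0 mulr0.
  by rewrite integral0.
have fu : P'.-integrable setT (EFin \o (fun x => f x * u x)).
  have := l1Z c^-1 ui; apply: eq_integrable => // x _ /=.
  by congr EFin; field.
rewrite -RintegralZr// /Rintegral fineK; last first.
  apply: integrable_fin_num => //.
  by apply: eq_integrable ui => // x _ /=; congr EFin; ring.
by apply: eq_integral => x _; congr EFin; ring.
Qed.

Lemma ip_opA f g h : sqint P f -> sqint Q g -> sqint Q h ->
  opA P xi f = h %[ae Q] ->
  ip m xi (fun z => f z.1 * g z.2) = ip Q h g.
Proof.
move=> fL gL hL fh; have xfg := sqint_mul_integrable xiL (sqint_tensor fL gL).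
rewrite /ip /Rintegral; congr fine.
rewrite -[LHS](integral21_prod_meas1 xfg).
apply: ae_eq_integral => //.
- exact: measurable_fubini_G xfg.
- by apply/measurable_EFinP; apply: measurable_funM; [case: hL|case: gL].
have := ae_integrable2 xfg; apply: filterS2 fh => y /= hy xy _.
by rewrite /fubini_G /= -[h y]hy // -integral_section.
Qed.

Lemma ip_opA_adj f g h : sqint P f -> sqint Q g -> sqint P h ->
  opA_adj Q xi g = h %[ae P] ->
  ip m xi (fun z => f z.1 * g z.2) = ip P f h.
Proof.
move=> fL gL hL fh; have xfg := sqint_mul_integrable xiL (sqint_tensor fL gL).
rewrite ipC /ip /Rintegral; congr fine.
under eq_integral do rewrite mulrC.
rewrite -[LHS](integral12_prod_meas1 xfg).
apply: ae_eq_integral => //.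
- exact: measurable_fubini_F xfg.
- by apply/measurable_EFinP; apply: measurable_funM; [case: fL|case: hL].
have := ae_integrable1 xfg; apply: filterS2 fh => x /= hx xy _.
rewrite /fubini_F /= -[h x]hx // mulrC -integral_section//.
  by apply: eq_integral => y _; congr EFin; ring.
by apply: eq_integrable xy => // y _ /=; congr EFin; ring.
Qed.

End transition_inner_products.

Section singular_facts.
Context d (T : measurableType d) (R : realType) (P Q : probability T R).
Notation m := (P \x Q : probability (T * T)%type R)%E.
Variables (xi : T * T -> R) (s : nat -> R) (alpha beta : nat -> T -> R).
Hypothesis xiL : sqint m xi.
Hypothesis sd : singular_decomposition P Q xi s alpha beta.

Lemma alphaL k : sqint P (alpha k).
Proof. by apply: Lfun_sqint; case: sd => -[]. Qed.

Lemma betaL k : sqint Q (beta k).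
Proof. by apply: Lfun_sqint; case: sd => _ []. Qed.

Lemma ip_alpha j k : j != k -> ip P (alpha j) (alpha k) = 0.
Proof. by case: sd => -[_ + _ _] *; apply. Qed.

Lemma ip_beta j k : j != k -> ip Q (beta j) (beta k) = 0.
Proof. by case: sd => _ [_ + _ _] *; apply. Qed.

Lemma ip_alpha1 k : ip P (alpha k.+1) (fun=> 1) = 0.
Proof.
rewrite ipC -(@ip_alpha 0 k.+1)//; apply: eq_ip_ae; [exact: sqint_cst|exact: alphaL..|].
by have := sd_alpha0 sd; apply: filterS => x /= H Dx; rewrite H.
Qed.

Lemma ip_beta1 k : ip Q (beta k.+1) (fun=> 1) = 0.
Proof.
rewrite ipC -(@ip_beta 0 k.+1)//; apply: eq_ip_ae; [exact: sqint_cst|exact: betaL..|].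
by have := sd_beta0 sd; apply: filterS => x /= H Dx; rewrite H.
Qed.

Lemma ip_xi_alpha j g : sqint Q g ->
  ip m xi (fun z => alpha j z.1 * g z.2) = s j * ip Q (beta j) g.
Proof.
move=> gL; rewrite (@ip_opA _ _ _ _ _ _ xiL _ _ (fun y => s j * beta j y))//.
- by rewrite ipZl//; exact: betaL.
- exact: alphaL.
- by apply: sqintZ; exact: betaL.
- exact: sd_A sd j.
Qed.

Lemma ip_xi_beta l f : sqint P f ->
  ip m xi (fun z => f z.1 * beta l z.2) = s l * ip P f (alpha l).
Proof.
move=> gL; rewrite (@ip_opA_adj _ _ _ _ _ _ xiL _ _ (fun y => s l * alpha l y))//.
- by rewrite ipZr//; exact: alphaL.
- exact: betaL.
- by apply: sqintZ; exact: alphaL.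
- exact: sd_Aadj sd l.
Qed.

(** Parseval's identity in the basis alpha for almost every section xi(., y), whose coefficients are
    s_k beta_k(y), followed by dominated convergence in y. It is the source of the L^2 convergence
    of the truncated kernels. *)
Lemma singular_parseval :
  \sum_(k < n) s k ^+ 2 * ip Q (beta k) (beta k) @[n --> \oo] --> ip m xi xi.
Proof.
have [mxi xi2] := xiL.
pose F n y : \bar R := (\sum_(k < n) (s k * beta k y) ^+ 2)%:E.
pose G y : \bar R := (\int[P]_x (xi (x, y) ^+ 2)%:E)%E.
have GE : G = fubini_G P (fun z => (xi z ^+ 2)%:E) by [].
have sk n : sqint Q (fun y => s n * beta n y) by apply: sqintZ; exact: betaL.
have IF n : (\int[Q]_y F n y)%E = (\sum_(k < n) s k ^+ 2 * ip Q (beta k) (beta k))%:E.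
  rewrite (_ : integral _ _ _ = \sum_(k < n) \int[Q]_y ((s k * beta k y) ^+ 2)%:E)%E; last first.
    rewrite -integral_sum//; last by move=> k; case: (sk k).
    by apply: eq_integral => y _; rewrite sumEFin.
  rewrite -sumEFin; apply: eq_bigr => k _.
  by have bL := betaL k; rewrite ip_EFin// ipZl// ipZr// mulrA -expr2.
have iG : Q.-integrable setT G.
  apply/integrableP; split; first exact: (measurable_fubini_G xi2).
  rewrite (eq_integral G) => [|y _]; last first.
    by rewrite gee0_abs// integral_ge0// => x _; rewrite lee_fin sqr_ge0.
  by rewrite GE (integral21_prod_meas1 xi2) ip_EFin// ltry.
have aes : {ae Q, forall y, sqint P (fun x => xi (x, y))}.
  have := ae_integrable2 xi2; apply: filterS => y /= iy; split => //.
  exact: measurableT_comp mxi (measurable_pair2 y).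
have aeb : {ae Q, forall y, forall k, opA P xi (alpha k) y = s k * beta k y}.
  apply/ae_foralln => k; have := sd_A sd k; apply: filterS => y /= H; exact: H.
have ipE y k : opA P xi (alpha k) y = s k * beta k y ->
    s k * beta k y = ip P (fun x => xi (x, y)) (alpha k).
  by move=> <-; rewrite ipC.
have [|||||_ _] := @dominated_convergence _ _ _ Q setT measurableT F G G.
- move=> n; apply/measurable_EFinP.
  apply: (@measurable_sum _ _ _ _ _ _ (fun (k : 'I_n) y => (s k * beta k y) ^+ 2)) => k.
  by case: (sk k) => mk _; exact: measurable_funX.
- by case/integrableP : iG.
- apply: filterS2 aes aeb => y yL yk _; rewrite /G ip_EFin//.
  apply: cvg_EFin; first exact: nearW.
  have [_] := parseval (sd_alpha sd) yL.
  by under eq_fun do under eq_bigr do rewrite -ipE//.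
- exact: iG.
- apply: filterS2 aes aeb => y yL yk n _; rewrite /G ip_EFin//.
  rewrite gee0_abs ?lee_fin ?sumr_ge0// => [|k _]; last exact: sqr_ge0.
  have [+ _] := parseval (sd_alpha sd) yL => /(_ n).
  by under eq_bigr do rewrite -ipE//.
rewrite GE (integral21_prod_meas1 xi2) ip_EFin//.
under eq_fun do rewrite IF.
by move/fine_cvgP => [_].
Qed.

End singular_facts.

Section singular_letters.
Context d (T : measurableType d) (R : realType) (P Q : probability T R).
Notation m := (P \x Q : probability (T * T)%type R)%E.
Variables (xi : T * T -> R) (s : nat -> R) (alpha beta : nat -> T -> R).
Hypothesis xiL : sqint m xi.
Hypothesis xi1 : ip m xi (fun=> 1) = 1.
Hypothesis sd : singular_decomposition P Q xi s alpha beta.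

(* The bases may contain null functions and s may vanish; these indices carry
   no letter. *)
Definition active k := (s k.+1 != 0) && (ip Q (beta k.+1) (beta k.+1) == 1).

Definition index_set K : finType := {k : 'I_K | active k}.

Definition lsv K (i : index_set K) : T -> R := alpha (val (val i)).+1.
Definition rsv K (i : index_set K) : T -> R := beta (val (val i)).+1.
Definition sv K (i : index_set K) : R := s (val (val i)).+1.

Lemma ip_beta01 k : ip Q (beta k) (beta k) = 1 \/ ip Q (beta k) (beta k) = 0.
Proof.
have [H|H] := onb_normalized (sd_beta sd) k; [by left|right].
rewrite (@eq_ip_ae _ _ _ _ _ (fun=> 0)).
- by rewrite /ip; under eq_Rintegral do rewrite mul0r; rewrite Rintegral_probability_cst.
- exact: betaL sd k.
- exact: sqint_cst.
- exact: betaL sd k.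
- exact: H.
Qed.

(** [active] normalizes only beta. Computing the inner product of xi with alpha_k beta_k once
    through A and once through its adjoint transfers this to alpha, as s_k is nonzero. *)
Lemma active_alpha k : active k -> ip P (alpha k.+1) (alpha k.+1) = 1.
Proof.
move=> /andP[s0 /eqP b1]; apply: (mulfI s0).
rewrite -(ip_xi_beta xiL sd); last exact: alphaL sd _.
by rewrite (ip_xi_alpha xiL sd) ?b1//; exact: betaL sd _.
Qed.

Lemma index_eq K (i j : index_set K) :
  ((val (val i)).+1 == (val (val j)).+1) = (i == j).
Proof. by rewrite eqSS. Qed.

Lemma singular_letters K : orthonormal_letters P Q (@lsv K) (@rsv K).
Proof.
split=> [i|i|i j|i j|i|i].
- exact: alphaL sd _.
- exact: betaL sd _.
- have [->|ij] := eqVneq i j; first by apply: active_alpha; exact: (valP j).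
  by apply: (ip_alpha sd); rewrite index_eq.
- have [->|ij] := eqVneq i j; first by case/andP : (valP j) => _ /eqP.
  by apply: (ip_beta sd); rewrite index_eq.
- exact: ip_alpha1 sd _.
- exact: ip_beta1 sd _.
Qed.

Lemma ip_xi_ten K o o' :
  ip m xi (ten (@lsv K) (@rsv K) o o') = (o == o')%:R * weight (@sv K) o.
Proof.
have [_ bL _ bb a1 b1] := singular_letters K.
case: o o' => [i|] [j|] /=.
- rewrite (ip_xi_alpha xiL sd); last exact: bL.
  by rewrite -/(rsv i) bb mulrC.
- rewrite (ip_xi_alpha xiL sd); last exact: sqint_cst.
  by rewrite -/(rsv i) b1 mulr0 mul0r.
- rewrite (ip_xi_beta xiL sd); last exact: sqint_cst.
  by rewrite ipC -/(lsv j) a1 mulr0 mul0r.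
- by rewrite mulr1 -xi1; congr ip; apply/funext => z; rewrite /ten/= mulr1.
Qed.

Definition truncated K := kernel_of (@lsv K) (@rsv K) (@sv K).

Lemma sqint_truncated K : sqint m (truncated K).
Proof. by case: (singular_letters K) => *; exact: sqint_kernel_of. Qed.

Lemma ip_truncated_ten K o o' :
  ip m (truncated K) (ten (@lsv K) (@rsv K) o o') = (o == o')%:R * weight (@sv K) o.
Proof.
have [aL bL aa bb a1 b1] := singular_letters K.
rewrite ip_suml => [|p _|]; [|by apply: sqintZ; exact: sqint_ten|exact: sqint_ten].
rewrite (bigD1 o)//= ipZl; [|exact: sqint_ten..].
rewrite ip_ten// eqxx/= big1 ?addr0 1?mulrC// => p po.
by rewrite ipZl; [|exact: sqint_ten..]; rewrite ip_ten// (negPf po) mulr0.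
Qed.

(** [emb] includes the letters up to [K0] among those up to K. This lets K tend to infinity while
    the letters of the partial sum stay fixed. *)
Lemma ip_truncated_ten_le K0 K o o' : (K0 <= K)%N ->
  ip m (truncated K) (ten (@lsv K0) (@rsv K0) o o') = (o == o')%:R * weight (@sv K0) o.
Proof.
move=> K0K.
pose emb (i : index_set K0) : index_set K :=
  Sub (widen_ord K0K (val i)) (valP i : active (widen_ord K0K (val i))).
have embI : injective emb.
  by move=> i j /(congr1 val)/(congr1 val)/= /val_inj/val_inj.
have oI : injective (omap emb) by move=> [i|] [j|] //= [ij]; congr Some; apply: embI; apply/val_inj/val_inj.
have -> : ten (@lsv K0) (@rsv K0) o o' = ten (@lsv K) (@rsv K) (omap emb o) (omap emb o').
  by case: o o' => [i|] [j|].
have -> : weight (@sv K0) o = weight (@sv K) (omap emb o) by case: o.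
by rewrite ip_truncated_ten (inj_eq oI).
Qed.

Lemma sum_option (I : finType) (F : option I -> R) :
  \sum_o F o = F None + \sum_i F (Some i).
Proof.
rewrite (bigD1 None)//=; congr (_ + _).
rewrite (reindex_omap Some id)/=; last by case.
by apply: eq_bigl => i; rewrite eqxx.
Qed.

Lemma sum_active K (F : nat -> R) :
  \sum_(k < K | active k) F k = \sum_(i : index_set K) F (val (val i)).
Proof.
rewrite (reindex_omap (val : index_set K -> 'I_K) insub)/=.
  by apply: eq_bigl => -[i iA] /=; rewrite insubT iA/= eqxx.
by move=> i iA; rewrite insubT.
Qed.

(** Both the square norm of [truncated K] and its inner product with [xi], so [energy_cvg] amounts
    to convergence of [truncated] to [xi] in L^2. *)
Definition energy K : R := 1 + \sum_(i : index_set K) sv i ^+ 2.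

Lemma energyE K : energy K = \sum_(k < K.+1) s k ^+ 2 * ip Q (beta k) (beta k).
Proof.
rewrite big_ord_recl (sd_s0 sd) expr1n mul1r.
have b0L := betaL sd 0; have c1L := sqint_cst Q 1.
have b01 : beta 0%N = (fun=> 1) %[ae Q] by exact: sd_beta0 sd.
rewrite (eq_ip_ae b0L c1L b0L b01) ipC (eq_ip_ae b0L c1L c1L b01) ip11.
congr (_ + _); rewrite -(sum_active K (fun k => s k.+1 ^+ 2)) big_mkcond.
apply: eq_bigr => k _; rewrite lift0 /active.
have [->|s0] := eqVneq (s k.+1) 0; first by rewrite expr0n mul0r.
by have [->|->] := ip_beta01 k.+1; rewrite ?eqxx ?mulr1// eq_sym oner_eq0 mulr0.
Qed.

Lemma energy_cvg : energy K @[K --> \oo] --> ip m xi xi.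
Proof.
under eq_fun do rewrite energyE.
have := singular_parseval xiL sd; rewrite -(cvg_shiftS (fun n =>
  \sum_(k < n) s k ^+ 2 * ip Q (beta k) (beta k))); exact.
Qed.

Lemma energy_le K : energy K <= ip m xi xi.
Proof.
have nd : nondecreasing_seq energy.
  apply/nondecreasing_seqP => n; rewrite !energyE [leRHS]big_ord_recr/= lerDl.
  by rewrite mulr_ge0 ?sqr_ge0// ip_ge0.
have := nondecreasing_cvgn_le nd (cvgP _ energy_cvg) K.
by rewrite (cvg_lim _ energy_cvg).
Qed.

Lemma ip_truncated K (phi : T * T -> R) : sqint m phi ->
  (forall o, ip m phi (ten (@lsv K) (@rsv K) o o) = weight (@sv K) o) ->
  ip m phi (truncated K) = energy K.
Proof.
have [aL bL aa bb a1 b1] := singular_letters K.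
move=> phiL H; rewrite ip_sumr//; last by move=> o _; apply: sqintZ; exact: sqint_ten.
rewrite sum_option/= /energy; congr (_ + _).
  by rewrite ipZr// ?H ?mul1r//; exact: sqint_ten.
by apply: eq_bigr => i _; rewrite ipZr// ?H// ?expr2//; exact: sqint_ten.
Qed.

Lemma ip_xi_truncated K : ip m xi (truncated K) = energy K.
Proof. by apply: ip_truncated => // o; rewrite ip_xi_ten eqxx mul1r. Qed.

Lemma ip_truncated_truncated K : ip m (truncated K) (truncated K) = energy K.
Proof.
apply: ip_truncated; first exact: sqint_truncated.
by move=> o; rewrite ip_truncated_ten eqxx mul1r.
Qed.

End singular_letters.

Lemma cvg_prod_finite (R : realType) (I : finType) (u : I -> R^nat) (l : I -> R) :
  (forall i, u i @ \oo --> l i) -> \prod_i u i n @[n --> \oo] --> \prod_i l i.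
Proof.
move=> ul; elim: (index_enum I) => [|i r IH].
  by rewrite big_nil; under eq_fun do rewrite big_nil; exact: cvg_cst.
by rewrite big_cons; under eq_fun do rewrite big_cons; exact: cvgM.
Qed.

Lemma cvg_geometric_sum (R : realType) (x : R) : 0 <= x < 1 ->
  \sum_(j < n.+1) x ^+ j @[n --> \oo] --> (1 - x)^-1.
Proof.
move=> /andP[x0 x1]; have := @cvg_geometric_series R 1 x.
rewrite ger0_norm// => /(_ x1); rewrite mul1r -cvg_shiftS/= => H.
suff -> : (fun n => \sum_(j < n.+1) x ^+ j) = (fun n => series (geometric 1 x) n.+1) by [].
apply/funext => n; rewrite /series/= big_mkord; apply: eq_bigr => j _.
by rewrite mul1r.
Qed.

Lemma geometric_sum_le (R : realType) (x : R) n : 0 <= x < 1 ->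
  \sum_(j < n.+1) x ^+ j <= (1 - x)^-1.
Proof.
move=> x01; have /andP[x0 x1] := x01.
have nd : nondecreasing_seq (fun n => \sum_(j < n.+1) x ^+ j).
  by apply/nondecreasing_seqP => k; rewrite [leRHS]big_ord_recr/= lerDl exprn_ge0.
have cv := cvg_geometric_sum x01.
by have := nondecreasing_cvgn_le nd (cvgP _ cv) n; rewrite (cvg_lim _ cv).
Qed.

(** * Contiguity *)

Section likelihood_approximation.
Context d (T : measurableType d) (R : realType) (P Q : probability T R).
Notation m := (P \x Q : probability (T * T)%type R)%E.
Variables (xi : T * T -> R) (s : nat -> R) (alpha beta : nat -> T -> R).
Hypothesis xiL : sqint m xi.
Hypothesis xi1 : ip m xi (fun=> 1) = 1.
Hypothesis sd : singular_decomposition P Q xi s alpha beta.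
Hypothesis s_le : forall k, (1 <= k)%N -> s k <= s 1%N.
Hypothesis s1_lt1 : s 1%N < 1.

Notation index_set := (index_set Q s beta).
Notation lsvK K := (@lsv _ T R Q s alpha beta K).
Notation rsvK K := (@rsv _ T R Q s beta K).
Notation svK K := (@sv _ T R Q s beta K).
Notation sv := (@sv _ T R Q s beta).

Lemma sv_bounds K (i : index_set K) : 0 <= sv i <= s 1%N.
Proof. by rewrite s_le// andbT; have /andP[] := sd_s_bounds sd (val (val i)).+1. Qed.

Lemma s1_bounds : 0 <= s 1%N < 1.
Proof. by rewrite s1_lt1 andbT; have /andP[] := sd_s_bounds sd 1%N. Qed.

Lemma sv_sqr K (i : index_set K) : 0 <= sv i ^+ 2 < 1.
Proof.
have /andP[h1 h2] := sv_bounds i.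
by rewrite sqr_ge0 expr_lt1//; exact: le_lt_trans s1_lt1.
Qed.

(* The limit in M and N of the square norm of the partial sum with letters in
   [index_set K]. *)
Definition mass K : R := \prod_(i : index_set K) (1 - sv i ^+ 2)^-1.

Lemma mass_factor K (i : index_set K) : 1 <= (1 - sv i ^+ 2)^-1.
Proof.
have /andP[h1 h2] := sv_sqr i.
by rewrite invf_ge1 ?subr_gt0// gerBl.
Qed.

Lemma mass_nondecreasing : nondecreasing_seq mass.
Proof.
apply/nondecreasing_seqP => K; rewrite /mass.
pose F k : R := (1 - s k.+1 ^+ 2)^-1.
have E n : \prod_(i : index_set n) (1 - sv i ^+ 2)^-1 =
    \prod_(k < n | active Q s beta k) F k.
  rewrite (reindex_omap (val : index_set n -> 'I_n) insub)/=.
    by apply: eq_bigl => -[i iA] /=; rewrite insubT iA/= eqxx.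
  by move=> i iA; rewrite insubT.
rewrite !E [leRHS]big_mkcond big_ord_recr/= -big_mkcond/=.
have F1 k : 1 <= F k.
  have /andP[h1 h2] := sd_s_bounds sd k.+1.
  have h3 := le_lt_trans (s_le (isT : (1 <= k.+1)%N)) s1_lt1.
  by rewrite /F invf_ge1 ?gerBl ?sqr_ge0// subr_gt0 expr_lt1.
apply: ler_peMr; first by apply: prodr_ge0 => k _; exact: le_trans (F1 k).
by case: ifP.
Qed.

Lemma sum_sv_sqr K : \sum_(i : index_set K) sv i ^+ 2 <= ip m xi xi - 1.
Proof. by rewrite lerBrDl; exact: energy_le xiL sd K. Qed.

(** For x = s_k^2 one has (1 - x)^-1 = 1 + x / (1 - x) <= exp(x / (1 - s_1^2)), so a bound on the
    sum of the s_k^2 bounds the product uniformly in K. *)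
Lemma mass_le K : mass K <= expR ((ip m xi xi - 1) / (1 - s 1%N ^+ 2)).
Proof.
have /andP[s10 s11] := s1_bounds.
have d0 : 0 < 1 - s 1%N ^+ 2 by rewrite subr_gt0 expr_lt1.
apply: (@le_trans _ _ (\prod_(i : index_set K) expR (sv i ^+ 2 / (1 - s 1%N ^+ 2)))).
  apply: ler_prod => i _; rewrite (le_trans ler01 (mass_factor i))/=.
  have /andP[h1 h2] := sv_sqr i; have /andP[h3 h4] := sv_bounds i.
  apply: le_trans (expR_ge1Dx _).
  have D0 : 0 < 1 - sv i ^+ 2 by rewrite subr_gt0.
  have -> : (1 - sv i ^+ 2)^-1 = 1 + sv i ^+ 2 / (1 - sv i ^+ 2).
    by field; rewrite gt_eqF.
  by rewrite lerD2l ler_wpM2l// lef_pV2// lerB// lerXn2r// nnegrE.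
rewrite -expR_sum ler_expR -mulr_suml ler_wpM2r ?invr_ge0 ?(ltW d0)//.
exact: sum_sv_sqr.
Qed.

Lemma is_cvg_mass : cvgn mass.
Proof.
apply: nondecreasing_is_cvgn; first exact: mass_nondecreasing.
by exists (expR ((ip m xi xi - 1) / (1 - s 1%N ^+ 2))) => _ [K _ <-]; exact: mass_le.
Qed.

Let Cinf : R := limn mass.

Lemma mass_le_lim K : mass K <= Cinf.
Proof. exact: nondecreasing_cvgn_le mass_nondecreasing is_cvg_mass K. Qed.

Lemma normL_le_mass K N M : normL (svK K) N M <= mass K.
Proof.
apply: le_trans (normL_le _ _ _) _; apply: ler_prod => i _.
rewrite geometric_sum_le ?sv_sqr// andbT.
by apply: sumr_ge0 => j _; rewrite exprn_ge0// sqr_ge0.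
Qed.

(** K is chosen first, then M for this K. Once N is at least M times the number of letters, [normL]
    no longer depends on N, which gives uniformity in N. *)
Lemma normL_near_lim eps : 0 < eps -> exists K, exists M0, forall M, (M0 <= M)%N ->
  forall N, (#|index_set K| * M <= N)%N ->
  Cinf - normL (svK K) N M <= eps.
Proof.
move=> e0; have e2 : 0 < eps / 2 by rewrite divr_gt0.
have /cvgrPdist_le/(_ _ e2)[K _ HK] := is_cvg_mass.
have {}HK := HK K (leqnn K).
exists K.
have cv : \prod_(i : index_set K) \sum_(j < n.+1) (sv i ^+ 2) ^+ j @[n --> \oo] --> mass K.
  by apply: cvg_prod_finite => i; apply: cvg_geometric_sum; exact: sv_sqr.
have /cvgrPdist_le/(_ _ e2)[M0 _ HM] := cv.
exists M0 => M MM N NN; rewrite normL_eq//.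
have := HM M MM; rewrite ler_norml => /andP[_].
move: HK; rewrite ler_norml -/Cinf => /andP[_]; lra.
Qed.

(** [chaos_approximation] with K letters in the kernel and [K0] in the partial sum. As K tends to
    infinity with N fixed, the error of replacing [xi] vanishes, and the norm of the full average
    stays below [Cinf]. *)
Lemma likelihood_approximation K0 M N (phi : N.-tuple (T * T) -> R) :
  sqint (power_measure m N) phi -> symY phi ->
  `|ip (power_measure m N) (pf (fun=> xi)) phi -
    ip (power_measure m N) (chaos (lsvK K0) (rsvK K0) (svK K0) M) phi| <=
  Num.sqrt (Cinf - normL (svK K0) N M) * Num.sqrt (ip (power_measure m N) phi phi).
Proof.
move=> phiL phiS; set D := `|_|; set S := Num.sqrt (Cinf - _).
set n := Num.sqrt (ip _ phi phi).
pose err K : R := ip m xi xi ^+ N - 2 * energy Q s beta K ^+ N + energy Q s beta K ^+ N.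
have H K : (K0 <= K)%N -> D <= (Num.sqrt (err K) + S) * n.
  move=> K0K.
  have := chaos_approximation M (singular_letters xiL sd K0)
    (singular_letters xiL sd K) xiL (ip_xi_ten xiL xi1 sd (K := K0))
    (fun o o' => ip_truncated_ten_le xiL sd o o' K0K) phiL phiS.
  rewrite ip_xi_truncated// (ip_truncated_truncated xiL sd) -/D -/n => h.
  apply: le_trans h _; apply: ler_wpM2r; first exact: sqrtr_ge0.
  rewrite lerD2l; apply: ler_wsqrtr; rewrite lerB//.
  exact: le_trans (normL_le_mass _ _ _) (mass_le_lim K).
have cE : err K @[K --> \oo] --> ip m xi xi ^+ N - 2 * ip m xi xi ^+ N + ip m xi xi ^+ N.
  have c1 : energy Q s beta K ^+ N @[K --> \oo] --> ip m xi xi ^+ N.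
    exact: (cvg_comp _ _ (energy_cvg xiL sd) (@exprn_continuous R N _)).
  apply: cvgD => //; apply: cvgB; first exact: cvg_cst.
  by apply: cvgM => //; exact: cvg_cst.
have c2 : Num.sqrt (err K) @[K --> \oo] -->
    Num.sqrt (ip m xi xi ^+ N - 2 * ip m xi xi ^+ N + ip m xi xi ^+ N).
  exact: (cvg_comp _ _ cE (@sqrt_continuous R _)).
have E0 : ip m xi xi ^+ N - 2 * ip m xi xi ^+ N + ip m xi xi ^+ N = 0 by ring.
rewrite E0 sqrtr0 in c2.
have c3 : (Num.sqrt (err K) + S) * n @[K --> \oo] --> (0 + S) * n.
  by apply: cvgM; [apply: cvgD => //|]; exact: cvg_cst.
rewrite add0r in c3.
apply: cvgr_to_ge c3 _.
by exists K0.
Qed.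

(** With K = M = 0 the partial sum and the approximation error each contribute at most the square
    root of [Cinf], whence the 2. *)
Lemma likelihood_bounded N (phi : N.-tuple (T * T) -> R) :
  sqint (power_measure m N) phi -> symY phi ->
  `|ip (power_measure m N) (pf (fun=> xi)) phi| <=
  2 * Num.sqrt Cinf * Num.sqrt (ip (power_measure m N) phi phi).
Proof.
move=> phiL phiS; have h1 := likelihood_approximation 0 0 phiL phiS.
have [aL bL aa bb a1 b1] := singular_letters xiL sd 0.
have cL : sqint (power_measure m N) (chaos (lsvK 0) (rsvK 0) (svK 0) 0).
  exact: sqint_chaos.
have h2 := cauchy_schwarz_norm cL phiL.
rewrite ip_chaos// in h2.
set n := Num.sqrt (ip _ phi phi) in h1 h2 *.
have n0 : 0 <= n by exact: sqrtr_ge0.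
have le1 : Num.sqrt (Cinf - normL (svK 0) N 0) * n <= Num.sqrt Cinf * n.
  apply: ler_wpM2r => //; apply: ler_wsqrtr; rewrite gerBl.
  by have := ip_ge0 (power_measure m N) (chaos (lsvK 0) (rsvK 0) (svK 0) 0); rewrite ip_chaos.
have le2 : Num.sqrt (normL (svK 0) N 0) * n <= Num.sqrt Cinf * n.
  apply: ler_wpM2r => //; apply: ler_wsqrtr.
  exact: le_trans (normL_le_mass _ _ _) (mass_le_lim 0).
have := ler_normD (ip (power_measure m N) (pf (fun=> xi)) phi -
  ip (power_measure m N) (chaos (lsvK 0) (rsvK 0) (svK 0) 0) phi)
  (ip (power_measure m N) (chaos (lsvK 0) (rsvK 0) (svK 0) 0) phi).
rewrite subrK; lra.
Qed.

End likelihood_approximation.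

Section indicators.
Context d (T : measurableType d) (R : realType) (m : probability T R).

Lemma sqint_indic (A : set T) : measurable A -> sqint m (\1_A : T -> R).
Proof.
move=> mA; apply: (@sqint_bounded _ _ _ _ _ 1) => [|x].
  exact: measurable_indic.
by rewrite indicE ger0_norm// lern1 leq_b1.
Qed.

Lemma ip_indic (A : set T) : measurable A -> ip m (\1_A : T -> R) \1_A = fine (m A).
Proof.
move=> mA; rewrite /ip /Rintegral; congr fine.
transitivity (\int[m]_x (\1_A x)%:E)%E.
  by apply: eq_integral => x _; rewrite indicE -natrM mulnb andbb.
by rewrite integral_indic// setIT.
Qed.

End indicators.

Section mutual_contiguity.
Context d (T : measurableType d) (R : realType) (P Q : probability T R).
Notation m := (P \x Q : probability (T * T)%type R)%E.
Variables (mu : probability (T * T)%type R).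
Variables (xi : T * T -> R) (s : nat -> R) (alpha beta : nat -> T -> R).
Hypothesis xiL : sqint m xi.
Hypothesis xi_mu : forall N (A : set (N.-tuple (T * T))), measurable A ->
  power_measure mu N A = (ip (power_measure m N) (pf (fun=> xi)) \1_A)%:E.
Hypothesis xi1 : ip m xi (fun=> 1) = 1.
Hypothesis sd : singular_decomposition P Q xi s alpha beta.
Hypothesis s_le : forall k, (1 <= k)%N -> s k <= s 1%N.
Hypothesis s1_lt1 : s 1%N < 1.

Definition permY_invariant N (A : set (N.-tuple (T * T))) :=
  measurable A /\ forall p z, A (permY p z) <-> A z.

Lemma symY_indic N (A : set (N.-tuple (T * T))) : permY_invariant A ->
  symY (\1_A : N.-tuple (T * T) -> R).
Proof.
move=> [_ AS] p z; rewrite !indicE; congr (nat_of_bool _)%:R.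
by apply/idP/idP => /set_mem/AS/mem_set.
Qed.

Lemma coupling_le_independent N (A : set (N.-tuple (T * T))) : permY_invariant A ->
  fine (power_measure mu N A) <=
  2 * Num.sqrt (limn (mass Q s beta)) * Num.sqrt (fine (power_measure m N A)).
Proof.
move=> Ai; have [mA _] := Ai.
have := likelihood_bounded xiL xi1 sd s_le s1_lt1 (sqint_indic _ mA) (symY_indic Ai).
rewrite ip_indic// xi_mu//=; apply: le_trans; exact: ler_norm.
Qed.

(** On the part of A where the partial sum c is at least eps, eps times the independent probability
    is at most the inner product of c with the indicator, which is close to the coupled probability.
    One eta pays for the region where c is below eps, the other for the approximation error divided
    by eps. *)
Lemma independent_le_coupling eta : 0 < eta -> exists2 eps, 0 < eps &
  exists N0, forall N, (N0 <= N)%N -> forall A : set (N.-tuple (T * T)),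
  permY_invariant A ->
  fine (power_measure m N A) <= fine (power_measure mu N A) / eps + 2 * eta.
Proof.
move=> eta0.
have S20 : 0 <= ip m xi xi - 1.
  have := cauchy_schwarz xiL (sqint_cst m 1).
  by rewrite xi1 ip11 expr1n mulr1 subr_ge0.
have [eps eps0 Heps] := chaos_lower_tail P Q S20 (s1_bounds sd s1_lt1) eta0.
exists eps => //.
(* The error is the square root of a difference of square norms, so this threshold makes it at most
   eps * eta. The letters are chosen only after eps. *)
have ee0 : 0 < (eps * eta) ^+ 2 by rewrite exprn_gt0// mulr_gt0.
have [K [M1 HM1]] := normL_near_lim xiL sd s_le s1_lt1 ee0.
have [M0 HM0] := Heps _ _ _ _ (singular_letters xiL sd K) (sv_bounds sd s_le (K := K))
  (sum_sv_sqr xiL sd K).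
pose M := maxn M0 M1.
have [N0 HN0] := HM0 M (leq_maxl _ _).
exists (maxn N0 (#|index_set Q s beta K| * M)) => N.
rewrite geq_max => /andP[/HN0 low NM] A Ai; have [mA _] := Ai.
have {}NM := HM1 M (leq_maxr _ _) N NM.
set c := chaos _ _ _ M in low.
have cL : sqint (power_measure m N) c.
  by case: (singular_letters xiL sd K) => *; exact: sqint_chaos.
pose G := [set z : N.-tuple (T * T) | eps <= c z].
have mG : measurable G.
  rewrite -[X in measurable X]setTI; apply: measurable_fun_le => //.
  exact: sqint_measurable cL.
(* [chaos] is invariant, so cutting A down to G keeps the invariance that the approximation
   requires. *)
have Gi : permY_invariant (A `&` G).
  split; first exact: measurableI.
  by move=> p z; rewrite /G /c /setI /= chaos_symY; have := Ai.2 p z; tauto.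
have mAG := Gi.1.
have iL := sqint_indic (power_measure m N) mAG.
have h1 := likelihood_approximation xiL xi1 sd s_le s1_lt1 K M iL (symY_indic Gi).
rewrite -/c ip_indic// in h1.
set r := fine (power_measure m N (A `&` G)) in h1 *.
have finm (B : set (N.-tuple (T * T))) : measurable B ->
    power_measure m N B = (fine (power_measure m N B))%:E.
  by move=> mB; rewrite fineK// fin_num_measure.
have finmu (B : set (N.-tuple (T * T))) : measurable B ->
    power_measure mu N B = (fine (power_measure mu N B))%:E.
  by move=> mB; rewrite fineK// fin_num_measure.
have r1 : r <= 1.
  by rewrite -lee_fin -finm//; exact: probability_le1.
have r0 : 0 <= r by rewrite fine_ge0.
have h2 : Num.sqrt (limn (mass Q s beta) - normL (@sv _ T R Q s beta K) N M) *
    Num.sqrt r <= eps * eta.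
  rewrite -[leRHS]mulr1; apply: ler_pM; rewrite ?sqrtr_ge0//.
    rewrite -[leRHS]ger0_norm ?mulr_ge0 ?(ltW eps0) ?(ltW eta0)//.
    by rewrite -sqrtr_sqr ler_wsqrtr.
  by rewrite -[leRHS]sqrtr1 ler_wsqrtr.
have h3 : fine (power_measure mu N (A `&` G)) <= fine (power_measure mu N A).
  rewrite -lee_fin -finmu// -finmu//; apply: le_measure; first exact/mem_set.
    exact/mem_set.
  exact: subIsetl.
have h4 : eps * r <= ip (power_measure m N) c \1_(A `&` G).
  rewrite /r -ip_indic// -ipZl//; apply: ip_le => //; first exact: sqintZ.
  move=> z; rewrite indicE; case: (boolP (z \in A `&` G)) => [/set_mem[_ zG]|_].
    by rewrite !mulr1.
  by rewrite !mulr0.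
have h5 : fine (power_measure m N A) <= r + eta.
  rewrite -lee_fin -finm//; apply: (@measure_cover _ _ _ _ A (A `&` G) (~` G)) => //.
  - exact: measurableC.
  - by move=> z Az; have [Gz|nGz] := pselect (G z); [left|right].
  - by rewrite -finm.
  - rewrite (_ : ~` G = [set z | (c z < eps)%R])//.
    by apply/seteqP; split => z /=; rewrite ltNge => /negP.
have h6 : fine (power_measure mu N (A `&` G)) =
  ip (power_measure m N) (pf (fun=> xi)) \1_(A `&` G) by rewrite xi_mu.
have h7 : eps * r - eps * eta <= fine (power_measure mu N A).
  apply: le_trans h3; rewrite h6.
  have := le_trans h1 h2; rewrite ler_norml => /andP[]; lra.
have : r - eta <= fine (power_measure mu N A) / eps.
  by rewrite ler_pdivlMr// mulrC mulrBr.
lra.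
Qed.

End mutual_contiguity.

(** [empirical_pair] takes values in bundled measures, so its invariance is an equality of
    structures; the proofs they carry are identified by irrelevance. *)
Lemma eq_subprobability d (T : measurableType d) (R : realType)
  (m1 m2 : @subprobability d T R) :
  (m1 = m2 :> (set T -> \bar R)) -> m1 = m2.
Proof.
case: m1 m2 => f1 c1 [f2 c2] /= e12; rewrite -{}e12 in c2 *; congr SubProbability.Pack.
case: c1 c2 => [[p1 p2] [p3] [p4] [p5] [p6] [p7]] [[q1 q2] [q3] [q4] [q5] [q6] [q7]].
rewrite (Prop_irrelevance q1 p1) (Prop_irrelevance q2 p2) in q3 *.
rewrite (Prop_irrelevance q3 p3) (Prop_irrelevance q4 p4) (Prop_irrelevance q5 p5).
by rewrite (Prop_irrelevance q6 p6) (Prop_irrelevance q7 p7).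
Qed.

(** * Events generated by the empirical measures *)

Section empirical_events.
Context d (T : measurableType d) (R : realType) (N : nat).

Lemma empirical_pair_permY p (z : N.-tuple (T * T)) :
  empirical_pair R (permY p z) = empirical_pair R z.
Proof.
congr (_, _); apply: eq_subprobability; apply/funext => A /=;
  rewrite !empiricalE; congr (_ * _)%E.
  by apply: eq_bigr => i _; rewrite !tnth_map tnth_ord_tuple.
rewrite [RHS](reindex_inj (@perm_inj _ p))/=.
by apply: eq_bigr => i _; rewrite !tnth_map tnth_ord_tuple.
Qed.

Lemma measurable_empirical (f : N.-tuple (T * T) -> N.-tuple T) :
  measurable_fun setT f ->
  measurable_fun setT (fun z => empirical R (f z) : giry T R).
Proof.
move=> mf; apply: measurable_giry_codensity => // B mB.
rewrite (_ : (fun z => _) = fun z => ((N%:R^-1 * \sum_(i < N) \1_B (tnth (f z) i))%:E)).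
  apply/measurable_EFinP; apply: measurable_funM => //.
  apply: (@measurable_sum _ _ _ _ _ _ (fun i z => \1_B (tnth (f z) i))) => i.
  apply: measurableT_comp; first exact: measurable_indic.
  exact: measurableT_comp (measurable_tnth i) mf.
apply/funext => z /=; rewrite empiricalE EFinM -sumEFin; congr (_ * _)%E.
Qed.

Lemma measurable_empirical_pair :
  measurable_fun setT (@empirical_pair d T R N).
Proof.
have mp (f : T * T -> T) : measurable_fun setT f ->
    measurable_fun setT (fun z : N.-tuple (T * T) => map_tuple f z).
  move=> mf; apply/measurable_fun_tnthP => i.
  rewrite (_ : _ \o _ = fun z => f (tnth z i)).
    by apply: measurableT_comp => //; exact: measurable_tnth.
  by apply/funext => z /=; rewrite tnth_map.
by apply: measurable_fun_pair; apply: measurable_empirical; exact: mp.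
Qed.

Lemma empirical_event_permY_invariant (A : set (N.-tuple (T * T))) :
  empirical_sigma_algebra T R N A -> permY_invariant A.
Proof.
move=> [B mB <-]; split.
  exact: (measurable_empirical_pair measurableT mB).
by move=> p z; rewrite setTI /preimage/= empirical_pair_permY.
Qed.

End empirical_events.

(** * From the Radon-Nikodym derivative to the product density *)

Section density.
Context d (T : measurableType d) (R : realType) (m mu : probability T R).
Local Open Scope charge_scope.
Variable xi : T -> R.
Hypothesis mu_ac : mu `<< m.
Hypothesis xi_density :
  EFin \o xi = 'd (charge_of_finite_measure mu) '/d m %[ae m].
Hypothesis xiL : sqint m xi.

(* [xi] is nonnegative only almost everywhere. *)
Let xi' x := Num.max (xi x) 0.

Let xi'L : sqint m xi'.
Proof.
have [mxi _] := xiL; apply: (@sqint_le _ _ _ _ _ xi) => //.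
  by apply: measurable_maxr.
by move=> x; rewrite /xi' /Num.max; case: ifP => // _; rewrite normr0.
Qed.

(** Ties [xi'] to the nonnegative Radon-Nikodym representative through which integrals against mu
    are converted to integrals against m. *)
Let xi'_rn : {ae m, forall x,
  (xi' x)%:E = Radon_Nikodym_SigmaFinite.f mu m x}.
Proof.
have := ae_eq_Radon_Nikodym_SigmaFinite mu_ac measurableT.
apply: filterS2 xi_density => x /= h1 h2.
have := Radon_Nikodym_SigmaFinite.f_ge0 mu_ac x.
by rewrite h2// -h1// lee_fin /xi' => x0; rewrite max_l.
Qed.

Let xi'_mu (psi : T -> \bar R) : measurable_fun setT psi ->
  (forall x, 0 <= psi x)%E ->
  (\int[mu]_x psi x = \int[m]_x (psi x * (xi' x)%:E))%E.
Proof.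
move=> mpsi psi0.
rewrite -(Radon_Nikodym_SigmaFinite.change_of_variables mu_ac psi0)//.
have [mxi _] := xi'L.
apply: ae_eq_integral => //.
- apply: emeasurable_funM => //.
  by apply: measurable_int (Radon_Nikodym_SigmaFinite.f_integrable _).
- by apply: emeasurable_funM => //; exact/measurable_EFinP.
- by apply: filterS xi'_rn => x /= -> _.
Qed.

Let xi_ae : xi = xi' %[ae m].
Proof.
have := ae_eq_Radon_Nikodym_SigmaFinite mu_ac measurableT.
apply: filterS2 xi_density => x /= h1 h2 _.
have := Radon_Nikodym_SigmaFinite.f_ge0 mu_ac x.
by rewrite h2// -h1// lee_fin /xi' => x0; rewrite max_l.
Qed.

Lemma ip_density1 : ip m xi (fun=> 1) = 1.
Proof.
rewrite (eq_ip_ae xiL xi'L (sqint_cst m 1) xi_ae) /ip /Rintegral.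
under eq_integral do rewrite mulr1.
have := @xi'_mu (fun=> 1%E) (measurable_cst _) (fun=> lee01).
under [in X in _ = X]eq_integral do rewrite mul1e.
move=> <-.
exact: (Rintegral_probability_cst mu 1).
Qed.

Lemma ip_pf_density N (A : set (N.-tuple T)) : measurable A ->
  power_measure mu N A = (ip (power_measure m N) (pf (fun=> xi)) \1_A)%:E.
Proof.
move=> mA.
have pL : sqint (power_measure m N) (pf (fun=> xi)) by exact: sqint_pf.
have p'L : sqint (power_measure m N) (pf (fun=> xi')) by exact: sqint_pf.
have AL := sqint_indic (power_measure m N) mA.
have -> : ip (power_measure m N) (pf (fun=> xi)) \1_A =
    ip (power_measure m N) (pf (fun=> xi')) \1_A.
  apply/eqP; rewrite -subr_eq0 -ipBl// -normr_le0.
  (* The powers of [xi] and [xi'] agree in L^2: expanding the square, all four inner products are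
     N-th powers of the same number and cancel. No null set of the product space has to be
     exhibited. *)
  have h : ip (power_measure m N)
      (fun z => pf (fun=> xi) z - pf (fun=> xi') z)
      (fun z => pf (fun=> xi) z - pf (fun=> xi') z) = 0.
    have BL := sqintB pL p'L.
    rewrite ipBl// ipBr// ipBr// !ip_pf//.
    rewrite ![\prod_(i < N) _]prodr_const (ipC _ xi' xi).
    by rewrite (eq_ip_ae xiL xi'L xiL xi_ae) (ipC _ xi' xi)
      (eq_ip_ae xiL xi'L xi'L xi_ae) !subrr.
  apply: (le_trans (cauchy_schwarz_norm (sqintB pL p'L) AL)).
  by rewrite h sqrtr0 mul0r.
have [mxi' _] := xi'L.
rewrite (power_measure_density mxi' _ xi'_mu)//; last first.
  by move=> x; rewrite /xi' le_max lexx orbT.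
rewrite /ip /Rintegral fineK.
  by apply: eq_integral => z _; rewrite mulrC.
exact: (integrable_fin_num _ (sqint_mul_integrable p'L AL)).
Qed.

End density.

Local Open Scope charge_scope.

Theorem theorem8 (R : realType) (d : nat)
    (P Q : probability (euclidean R d) R)
    (mu : probability (euclidean R d * euclidean R d)%type R)
    (mu_fst : forall A : set (euclidean R d), measurable A ->
      pushforward mu fst A = P A)
    (mu_snd : forall A : set (euclidean R d), measurable A ->
      pushforward mu snd A = Q A)
    (mu_ac : mu `<< (P \x Q)%E)
    (xi : euclidean R d * euclidean R d -> R)
    (xi_density : EFin \o xi =
        'd (charge_of_finite_measure mu) '/d
          ((P \x Q)%E : probability (euclidean R d * euclidean R d)%type R)
      %[ae (P \x Q)%E])
    (xi_L2 : xi \in Lfun (P \x Q)%E 2%:E)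
    (s : nat -> R) (alpha beta : nat -> euclidean R d -> R)
    (sd : singular_decomposition P Q xi s alpha beta)
    (s_le : forall k, (1 <= k)%N -> s k <= s 1%N)
    (s1_lt1 : s 1%N < 1)
    (A : forall N, set (N.-tuple (euclidean R d * euclidean R d)))
    (A_G : forall N, (1 <= N)%N ->
      empirical_sigma_algebra (euclidean R d) R N (A N)) :
  (power_measure mu N (A N) @[N --> \oo] --> 0%E)
  <-> (power_measure (P \x Q)%E N (A N) @[N --> \oo] --> 0%E).
Proof.
pose m : probability (euclidean R d * euclidean R d)%type R := (P \x Q)%E.
have xiL : sqint m xi by exact: Lfun_sqint.
have xi1 := ip_density1 mu_ac xi_density xiL.
have xi_mu := ip_pf_density mu_ac xi_density xiL.
have Ainv N : (1 <= N)%N -> permY_invariant (A N).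
  by move=> /A_G; exact: empirical_event_permY_invariant.
have fineE (p : probability (euclidean R d * euclidean R d)%type R) :
    (power_measure p N (A N) @[N --> \oo] --> 0%E) <->
    (fine (power_measure p N (A N)) @[N --> \oo] --> 0).
  split=> [/fine_cvgP[]//|cA]; apply/fine_cvgP; split=> //.
  (* Membership in the sigma-algebra is assumed from N = 1 on, so finiteness is asserted from
     there. *)
  by exists 1%N => // N /= /Ainv[mA _]; exact: fin_num_measure.
rewrite !fineE; split=> [S0|R0].
- apply/cvgrPdist_le => e e0.
  (* The loss in [independent_le_coupling] is twice e / 4; the coupled probability divided by eps is
     allowed the remaining e / 2. *)
  have e4 : 0 < e / 4 by rewrite divr_gt0.
  have [eps eps0 [N0 H]] := independent_le_coupling xiL xi_mu xi1 sd s_le s1_lt1 e4.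
  have se : 0 < eps * (e / 2) by rewrite mulr_gt0// divr_gt0.
  move/cvgrPdist_le : S0 => /(_ _ se)[N1 _ HS].
  exists (maxn 1 (maxn N0 N1)) => // N /=; rewrite !geq_max => /and3P[/Ainv Ai NN0 NN1].
  rewrite sub0r normrN ger0_norm ?fine_ge0//.
  apply: le_trans (H N NN0 _ Ai) _.
  have := HS N NN1; rewrite /= sub0r normrN ger0_norm ?fine_ge0// => hS.
  have : fine (power_measure mu N (A N)) / eps <= e / 2 by rewrite ler_pdivrMr// mulrC.
  lra.
- pose C := 2 * Num.sqrt (limn (mass Q s beta)).
  have cR : C * Num.sqrt (fine (power_measure m N (A N))) @[N --> \oo] -->
      C * Num.sqrt 0.
    apply: cvgM; first exact: cvg_cst.
    exact: (cvg_comp _ _ R0 (@sqrt_continuous R _)).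
  rewrite sqrtr0 mulr0 in cR.
  apply: (@squeeze_cvgr _ _ _ _ (fun=> 0) _ _ _ _ _ cR); last exact: cvg_cst.
  exists 1%N => // N /= /Ainv Ai; rewrite fine_ge0//=.
  exact: (coupling_le_independent xiL xi_mu xi1 sd s_le s1_lt1 Ai).
Qed.
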